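(* Let $d\ge 1$. There exists a constant $c_d>0$ depending only on $d$ such that for every $f\in BV(\mathbb{R}^d)$ $$\liminf_{\lambda\to+\infty}\lambda\,\mathscr{L}^d\big(\{x\in\mathbb{R}^d : \mathsf{A} f(x)>\lambda\}\big)\ \ge\ c_d\,|D^s f|(\mathbb{R}^d).$$ In particular, a function $f\in BV(\mathbb{R}^d)$ belongs to $W^{1,1}(\mathbb{R}^d)$ if and only if $$\liminf_{\lambda\to+\infty}\lambda\,\mathscr{L}^d\big(\{x\in\mathbb{R}^d : \mathsf{A} f(x)>\lambda\}\big)=0.$$
   Context: $\mathscr{L}^d$ is the Lebesgue measure on $\mathbb{R}^d$ and $B(x,r)$ is the ball of center $x$ and radius $r$. For $f\in L^1_{\rm loc}(\mathbb{R}^d)$ and $x\in\mathbb{R}^d$, define $$\mathsf{A} f(x):=\sup_{r>0}\frac1r\,\frac{1}{\mathscr{L}^d(B(x,r))}\int_{B(x,r)}|f(y)-(f)_{x,r}|\,dy\in[0,+\infty],\qquad (f)_{x,r}:=\frac{1}{\mathscr{L}^d(B(x,r))}\int_{B(x,r)}f\,dy.$$ For $f\in BV(\mathbb{R}^d)$, $Df$ is its distributional derivative (a finite $\mathbb{R}^d$-valued Radon measure), $D^sf$ is the singular part of $Df$ with respect to $\mathscr{L}^d$, and $|D^sf|$ is the total variation measure of $D^sf$. *)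

(* Defs.v *)
From HB Require Import structures.
From mathcomp Require Import all_boot all_order all_algebra.
From mathcomp Require Import all_classical all_reals all_analysis.

Set Implicit Arguments.
Unset Strict Implicit.
Unset Printing Implicit Defensive.

Import Order.TTheory GRing.Theory Num.Theory.
Import numFieldNormedType.Exports.

Local Open Scope classical_set_scope.
Local Open Scope ring_scope.

(* 'rV[R]_n carries the sigma-algebra generated by the coordinates; it is the
   Borel one, see rV_measurableE. *)
Section rV_measurable.
Context (R : realType) (n : nat).

Definition rV_coord (i : 'I_n) (x : 'rV[R]_n) : R := x ord0 i.

Definition rV_measurable : set (set 'rV[R]_n) := g_sigma_preimage rV_coord.

Let rV_measurable0 : rV_measurable set0.
Proof. exact: sigma_algebra0. Qed.

Let rV_measurableC A : rV_measurable A -> rV_measurable (~` A).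
Proof. exact: sigma_algebraC. Qed.

Let rV_measurable_bigcup (F : (set 'rV[R]_n)^nat) :
  (forall i, rV_measurable (F i)) -> rV_measurable (\bigcup_i (F i)).
Proof. exact: sigma_algebra_bigcup. Qed.

HB.instance Definition _ := @isMeasurable.Build default_measure_display
  'rV[R]_n rV_measurable rV_measurable0 rV_measurableC rV_measurable_bigcup.

Lemma measurable_rV_coord (i : 'I_n) : measurable_fun setT (rV_coord i).
Proof.
move=> _ Y mY; rewrite setTI; apply: sub_sigma_algebra => /=.
rewrite -bigcup_seq/=; exists i => /=; first by rewrite mem_index_enum.
by exists Y => //; rewrite setTI.
Qed.

Lemma measurable_fun_rV d (T : measurableType d) (f : T -> 'rV[R]_n) :
  (forall i, measurable_fun setT (fun x => f x ord0 i)) -> measurable_fun setT f.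
Proof.
move=> mf; have sub : @measurable _ 'rV[R]_n `<=`
    image_set_system setT f measurable.
  apply: smallest_sub.
    exact/sigma_algebra_image/sigma_algebra_measurable.
  move=> A; rewrite -bigcup_seq => -[i _ [B mB <-]].
  by rewrite /image_set_system/= !setTI; have := mf i measurableT B mB; rewrite setTI.
by move=> _ A mA; exact: sub.
Qed.

End rV_measurable.

Section lebesgue_rV_step.
Context (R : realType) (n : nat).

Definition rV_cons (p : measurableTypeR R * 'rV[R]_n) : 'rV[R]_n.+1 :=
  \row_j (if unlift ord0 j is Some k then p.2 ord0 k else p.1).

Definition rV_uncons (x : 'rV[R]_n.+1) : measurableTypeR R * 'rV[R]_n :=
  (x ord0 ord0, \row_k x ord0 (lift ord0 k)).

Lemma rV_consK : cancel rV_cons rV_uncons.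
Proof.
move=> [a x]; rewrite /rV_uncons /rV_cons mxE unlift_none; congr pair.
by apply/rowP => k; rewrite !mxE liftK.
Qed.

Lemma measurable_rV_cons : measurable_fun setT rV_cons.
Proof.
apply: measurable_fun_rV => i; case: (unliftP ord0 i) => [k|] ->.
- rewrite (_ : (fun _ => _) = rV_coord k \o snd); last first.
    by apply/funext => p /=; rewrite mxE liftK.
  by apply: measurableT_comp; [exact: measurable_rV_coord|].
- rewrite (_ : (fun _ => _) = fst); first exact: measurable_fst.
  by apply/funext => p /=; rewrite mxE unlift_none.
Qed.

Lemma measurable_rV_uncons : measurable_fun setT rV_uncons.
Proof.
apply/measurable_fun_pairP; split; first exact: (@measurable_rV_coord R n.+1 ord0).
apply: measurable_fun_rV => i.
rewrite (_ : (fun _ => _) = rV_coord (lift ord0 i)).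
  exact: measurable_rV_coord.
by apply/funext => x /=; rewrite mxE.
Qed.

Variable m : {sigma_finite_measure set 'rV[R]_n -> \bar R}.

Definition lebesgue_rV_step : set 'rV[R]_n.+1 -> \bar R :=
  pushforward (lebesgue_measure \x m)%E rV_cons.

Let step0 : lebesgue_rV_step set0 = 0%E.
Proof. by rewrite /lebesgue_rV_step /pushforward preimage_set0 measure0. Qed.

Let step_ge0 A : (0 <= lebesgue_rV_step A)%E.
Proof. by rewrite /lebesgue_rV_step /pushforward measure_ge0. Qed.

Let step_sigma_additive : semi_sigma_additive lebesgue_rV_step.
Proof.
exact: (@measure_semi_sigma_additive _ _ _
  (measure_function_pushforward__canonical__measure_function_Measure
    _ measurable_rV_cons)).
Qed.

HB.instance Definition _ := isMeasure.Build _ _ _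
  lebesgue_rV_step step0 step_ge0 step_sigma_additive.

Let step_sigma_finite : sigma_finite setT lebesgue_rV_step.
Proof.
have /sigma_finiteP[F [TF ndF Foo]] := sigma_finiteT (@lebesgue_measure R).
have /sigma_finiteP[G [TG ndG Goo]] := sigma_finiteT m.
exists (fun k => rV_uncons @^-1` (F k `*` G k)).
  rewrite -preimage_bigcup; apply/seteqP; split => // x _ /=.
  have [k _ Fk] : (\bigcup_k F k) (rV_uncons x).1 by rewrite -TF.
  have [l _ Gl] : (\bigcup_k G k) (rV_uncons x).2 by rewrite -TG.
  exists (maxn k l) => //; split.
  - by move: Fk; exact/subsetPset/ndF/leq_maxl.
  - by move: Gl; exact/subsetPset/ndG/leq_maxr.
move=> k; have [mF Fk] := Foo k; have [mG Gk] := Goo k; split.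
  rewrite -[X in measurable X]setTI; apply: measurable_rV_uncons => //.
  exact: measurableX.
rewrite /lebesgue_rV_step /pushforward -comp_preimage.
rewrite (_ : rV_uncons \o rV_cons = id); last exact/funext/rV_consK.
by rewrite preimage_id product_measure1E// lte_mul_pinfty// ge0_fin_numE.
Qed.

HB.instance Definition _ := Measure_isSigmaFinite.Build _ _ _
  lebesgue_rV_step step_sigma_finite.

End lebesgue_rV_step.

(* Lebesgue measure on R^n: a point mass for n = 0, and the product of the
   one-dimensional Lebesgue measure with that of R^n for n.+1. *)
Fixpoint lebesgue_rV (R : realType) (n : nat) :
    {sigma_finite_measure set 'rV[R]_n -> \bar R} :=
  match n with
  | 0 => dirac (0 : 'rV[R]_0)
  | n'.+1 => lebesgue_rV_step (lebesgue_rV R n')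
  end.

Lemma lebesgue_rV_box (R : realType) (n : nat) (A : 'I_n -> set (measurableTypeR R)) :
  (forall i, measurable (A i)) ->
  lebesgue_rV R n [set x | forall i, A i (x ord0 i)] =
  (\prod_(i < n) lebesgue_measure (A i))%E.
Proof.
elim: n A => [|n IH] A mA.
  by rewrite big_ord0 /= diracE mem_set// => -[].
rewrite big_ord_recl -IH//= /lebesgue_rV_step /pushforward.
have mbox : measurable [set x : 'rV[R]_n | forall i, A (lift ord0 i) (x ord0 i)].
  rewrite (_ : mkset _ = \bigcap_(i in [set: 'I_n])
      (rV_coord i @^-1` A (lift ord0 i))); last first.
    by apply/seteqP; split => [x Ax i _|x Ax i]; [exact: Ax|exact: (Ax i I)].
  apply: fin_bigcap_measurable => // i _; rewrite -[X in measurable X]setTI.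
  exact: (@measurable_rV_coord R n i measurableT _ (mA (lift ord0 i))).
rewrite -product_measure1E//; congr product_measure1.
apply/seteqP; split => [[a x] /= Ax|[a x] [/= Aa Ax] i].
  split => [|i] /=; first by have := Ax ord0; rewrite mxE unlift_none.
  by have := Ax (lift ord0 i); rewrite mxE liftK.
by rewrite mxE; case: (unliftP ord0 i) => [k|] ->.
Qed.

Lemma open_measurable_rV (R : realType) (n : nat) (U : set 'rV[R]_n) :
  open U -> measurable U.
Proof.
move=> oU.
pose B (p : 'rV[rat]_n * nat) : set 'rV[R]_n :=
  [set y | forall i, ball (ratr (p.1 ord0 i) : R) p.2.+1%:R^-1 (y ord0 i)].
have mB p : measurable (B p).
  rewrite (_ : B p = \bigcap_(i in [set: 'I_n])
      (rV_coord i @^-1` ball (ratr (p.1 ord0 i) : R) p.2.+1%:R^-1)); last first.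
    by apply/seteqP; split => [y By i _|y By i]; [exact: By|exact: (By i I)].
  apply: fin_bigcap_measurable => // i _; rewrite -[X in measurable X]setTI.
  by apply: measurable_rV_coord => //; exact: measurable_realfun.measurable_ball.
have -> : U = \bigcup_p (if `[< B p `<=` U >] then B p else set0).
  apply/seteqP; split => [x Ux|x [p _]]; last by case: asboolP => // pU /pU.
  have /nbhs_ballP[e /= e0 xeU] : nbhs x U by exact: open_nbhs_nbhs.
  have [k ke] : exists k : nat, k.+1%:R^-1 < e / 2.
    exists (Num.truncn (e / 2)^-1).
    by rewrite invf_plt ?posrE ?divr_gt0// truncnS_gt.
  have qP i : {q : rat | ratr q \in `](x ord0 i - k.+1%:R^-1), (x ord0 i + k.+1%:R^-1)[}.
    by apply/cid/rat_in_itvoo; rewrite -subr_gt0 opprB addrC addrA subrK addr_gt0.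
  have xq i : `|x ord0 i - ratr (sval (qP i))| < k.+1%:R^-1.
    by rewrite distrC ltr_distl; have := svalP (qP i); rewrite in_itv.
  exists (\row_i sval (qP i), k) => //; case: asboolP => [_ i|].
    by rewrite mxE/= /ball/= distrC xq.
  move=> nBU; exfalso; apply: nBU => y By; apply: xeU; split => // i j; rewrite (ord1 i).
  have := By j; rewrite mxE/= /ball/= => yq.
  rewrite -(subrK (ratr (sval (qP j))) (x ord0 j)) -addrA.
  rewrite (le_lt_trans (ler_normD _ _))// (splitr e) ltrD//.
    exact: lt_trans (xq j) ke.
  exact: lt_trans yq ke.
apply: countable_bigcupT_measurable; first exact: countableP.
by move=> p; case: asboolP.
Qed.

Lemma rV_measurableE (R : realType) (n : nat) :
  @measurable _ 'rV[R]_n = <<s @open 'rV[R]_n >>.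
Proof.
apply/seteqP; split; last first.
  apply: smallest_sub; first exact: sigma_algebra_measurable.
  exact: open_measurable_rV.
apply: smallest_sub; first exact: smallest_sigma_algebra.
move=> A; rewrite -bigcup_seq => -[i _ [B mB <-]]; rewrite setTI.
suff : @measurable _ (measurableTypeR R) `<=`
    image_set_system setT (rV_coord i) <<s @open 'rV[R]_n >>.
  by move=> /(_ _ mB); rewrite /image_set_system/= setTI.
rewrite measurable_realfun.RGenOpens.measurableE; apply: smallest_sub.
  exact/sigma_algebra_image/smallest_sigma_algebra.
move=> _ [x [y ->]]; rewrite /image_set_system/= setTI.
apply: sub_sigma_algebra; apply: open_comp; last exact: interval_open.
by move=> ? _; exact: coord_continuous.
Qed.

Section vector_measure.
Context d (T : measurableType d) (R : realType) (n : nat).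

Definition enorm (v : 'rV[R]_n) : R := Num.sqrt (\sum_i v ord0 i ^+ 2).

(* A finite R^n-valued measure is given by its n components, which are finite
   signed measures, that is charges. *)
Definition vmeasure := 'I_n -> {charge set T -> \bar R}.

Implicit Types (mu nu : vmeasure) (lam : {measure set T -> \bar R}).

Definition vvalue mu (A : set T) : 'rV[R]_n := \row_i fine (mu i A).

Definition vmeasure_variation mu (A : set T) : \bar R :=
  ereal_sup [set (\sum_(k <oo) (enorm (vvalue mu (F k)))%:E)%E
    | F in [set F : (set T)^nat | [/\ forall k, measurable (F k),
                                      trivIset setT F & \bigcup_k F k = A]]].

Definition abs_continuous lam mu :=
  forall A, measurable A -> lam A = 0%E -> vmeasure_variation mu A = 0%E.

Definition mutually_singular lam mu :=
  exists N, [/\ measurable N, lam N = 0%E & vmeasure_variation mu (~` N) = 0%E].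

Definition is_singular_part lam mu nu :=
  mutually_singular lam nu /\
  exists2 ac : vmeasure, abs_continuous lam ac &
    forall A i, measurable A -> mu i A = (ac i A + nu i A)%E.

(* The default value is never used, see singular_partP. *)
Definition singular_part lam mu : vmeasure :=
  xget ((fun=> czero) : {classic vmeasure}) (is_singular_part lam mu).

End vector_measure.

Lemma maximal_null_set d (T : measurableType d) (R : realType)
    (lam m : {measure set T -> \bar R}) : (m setT < +oo)%E ->
  exists N, [/\ measurable N, lam N = 0%E &
    forall A, measurable A -> lam A = 0%E -> m (A `\` N) = 0%E].
Proof.
move=> moo; pose S := [set m N | N in [set N | measurable N /\ lam N = 0%E]].
have mfin A : measurable A -> m A \is a fin_num.
  move=> mA; rewrite ge0_fin_numE//; apply: le_lt_trans moo.
  by rewrite le_measure ?inE.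
have Ssup A : measurable A -> lam A = 0%E -> (m A <= ereal_sup S)%E.
  by move=> mA lA; apply: ereal_sup_ubound; exists A.
have Sfin : ereal_sup S \is a fin_num.
  rewrite ge0_fin_numE; last by apply: le_trans (Ssup set0 _ _).
  apply: le_lt_trans moo; apply: ge_ereal_sup => _ [A [mA _] <-].
  by rewrite le_measure ?inE.
have /choice[N HN] : forall k : nat, exists N, [/\ measurable N, lam N = 0%E &
    (ereal_sup S - k.+1%:R^-1%:E < m N)%E].
  move=> k; have k0 : 0 < k.+1%:R^-1 :> R by [].
  by have [_ [A [mA lA] <-] kA] := ub_ereal_sup_adherent k0 Sfin; exists A.
have mN k : measurable (N k) by case: (HN k).
have mUN : measurable (\bigcup_k N k) by exact: bigcupT_measurable.
have lUN : lam (\bigcup_k N k) = 0%E.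
  apply/eqP; rewrite -measure_le0.
  have := @measure_sigma_subadditive _ _ _ lam _ N mN mUN (@subset_refl _ _).
  by rewrite [X in (_ <= X)%E]eseries0// => k _ _; case: (HN k).
have SN : (ereal_sup S <= m (\bigcup_k N k))%E.
  apply/lee_addgt0Pr => e e0.
  have [k _ ke] := near_infty_natSinv_lt (PosNum e0).
  have [_ _ kN] := HN k.
  rewrite -leeBlDr// (le_trans _ (ltW (lt_le_trans kN _)))//.
  - by rewrite leeB// lee_fin ltW//; apply: (ke k) => /=.
  - by rewrite le_measure ?inE//; exact: bigcup_sup.
exists (\bigcup_k N k); split => // A mA lA.
have mAN : measurable (A `\` \bigcup_k N k) by exact: measurableD.
apply/eqP; rewrite -measure_le0 -(@leeD2rE _ (m (\bigcup_k N k))) ?mfin// add0e.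
rewrite -measureU//; last by rewrite setDE -setIA setICl setI0.
rewrite (le_trans _ SN)// Ssup//; first exact: measurableU.
apply/eqP; rewrite -measure_le0.
apply: le_trans (@measureU2 _ _ _ lam _ _ mAN mUN) _.
have -> : (0 = lam A + lam (\bigcup_k N k))%E by rewrite lA lUN adde0.
by rewrite leeD2r// le_measure ?inE//; exact: subDsetl.
Qed.

Section lebesgue_decomposition.
Context d (T : measurableType d) (R : realType) (n : nat).
Variables (lam : {measure set T -> \bar R}) (mu : vmeasure T R n).

Lemma vmeasure_variation0 (nu : vmeasure T R n) A :
  (forall B i, measurable B -> B `<=` A -> nu i B = 0%E) ->
  measurable A -> vmeasure_variation nu A = 0%E.
Proof.
move=> nu0 mA; apply/eqP; rewrite eq_le; apply/andP; split.
  apply: ge_ereal_sup => _ [F [mF _ FA] <-].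
  rewrite eseries0// => k _ _; rewrite /enorm big1 ?sqrtr0// => i _.
  by rewrite mxE nu0 ?expr0n// -FA; exact: bigcup_sup.
pose F k : set T := if k == 0%N then A else set0.
apply: (@le_trans _ _ (\sum_(k <oo) (enorm (vvalue nu (F k)))%:E)%E).
  by apply: nneseries_ge0 => k _ _; rewrite lee_fin sqrtr_ge0.
apply: ereal_sup_ubound; exists F => //; split.
  - by move=> [|k]; rewrite /F/=.
  - by move=> [|i] [|j] _ _ //; rewrite /F/= ?set0I ?setI0 => -[].
  - by apply/seteqP; split => [x [[|k] _]//|x Ax]; exists 0%N.
Qed.

Lemma singular_partP : is_singular_part lam mu (singular_part lam mu).
Proof.
apply: (@xgetPex {classic vmeasure T R n}).
have /choice[N HN] : forall i, exists N, [/\ measurable N, lam N = 0%E &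
    forall A, measurable A -> lam A = 0%E -> forall B, measurable B ->
      B `<=` A `\` N -> mu i B = 0%E].
  move=> i; have [P [Q PQ]] := Hahn_decomposition (mu i).
  pose m := charge_variation PQ.
  have moo : (m setT < +oo)%E by rewrite ltey_eq fin_num_measure.
  have [N [mN lN NA]] := maximal_null_set lam moo.
  exists N; split => // A mA lA B mB BAN.
  apply/eqP; rewrite -abse_eq0 eq_le abse_ge0 andbT.
  apply: (le_trans (abse_charge_variation PQ mB)); rewrite -(NA _ mA lA).
  by rewrite le_measure ?inE//; exact: measurableD.
pose Z := \big[setU/set0]_(i < n) N i.
have mZ : measurable Z.
  by apply: bigsetU_measurable => i _; case: (HN i).
have lZ : lam Z = 0%E.
  have nZ : lam.-negligible Z.
    rewrite /Z; elim/big_ind : _ => [||i _].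
    - exact: negligible_set0.
    - exact: negligibleU.
    - by case: (HN i) => mNi lNi _; exists (N i); split.
  exact: (@measure_negligible _ _ _ lam).
have mZC := measurableC mZ.
exists (fun i => crestr0 (mu i) mZ : {charge set T -> \bar R}); split.
  exists Z; split => //; apply: vmeasure_variation0 => // B i mB BZ.
  rewrite /= /crestr0 mem_set// /crestr (_ : B `&` Z = set0) ?charge0//.
  by apply/seteqP; split => // x [/BZ].
exists (fun i => crestr0 (mu i) mZC : {charge set T -> \bar R}).
  move=> A mA lA; apply: vmeasure_variation0 => // B i mB BA.
  rewrite /= /crestr0 mem_set// /crestr.
  have [_ _ /(_ A mA lA)] := HN i; apply; first exact: measurableI.
  move=> x [Bx nZx]; split; [exact: BA|move=> Nx; apply: nZx].
  by rewrite /Z -bigcup_seq; exists i => //=; rewrite mem_index_enum.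
move=> A i mA /=; rewrite /crestr0 mem_set// /crestr addeC.
by apply: charge_partition => //; rewrite ?setUv ?setICr.
Qed.

End lebesgue_decomposition.

Section charge_integral.
Context d (T : measurableType d) (R : realType).
Variable nu : {charge set T -> \bar R}.

Let P := projT1 (cid (Hahn_decomposition nu)).
Let N := projT1 (cid (projT2 (cid (Hahn_decomposition nu)))).
Let nuPN : hahn_decomposition nu P N :=
  projT2 (cid (projT2 (cid (Hahn_decomposition nu)))).

(* The Jordan decomposition does not depend on the Hahn decomposition, see
   Hahn_decomposition_uniq. *)
Definition charge_integral (f : T -> R) : R :=
  \int[jordan_pos nuPN]_x f x - \int[jordan_neg nuPN]_x f x.

End charge_integral.

Section BV.
Context (R : realType) (n : nat).
Local Notation Rn := 'rV[R]_n.
Local Notation L := (lebesgue_rV R n).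
Implicit Types (f phi : Rn -> R) (x : Rn).

(* Euclidean balls; the library's [ball] on row vectors is the one of the
   supremum norm. *)
Definition eball x (r : R) : set Rn := [set y | enorm (y - x) < r].

Definition average f x (r : R) : R :=
  (fine (L (eball x r)))^-1 * \int[L]_(y in eball x r) f y.

(* sup over r > 0 of 1/r times the mean oscillation of f on B(x, r);
   meaningful for locally integrable f, as the integrals are then finite. *)
Definition oscillation_sup f x : \bar R :=
  ereal_sup [set (r^-1 * average (fun y => `|f y - average f x r|) x r)%:E
    | r in [set r : R | 0 < r]].

Definition partial (i : 'I_n) f : Rn -> R :=
  fun x => 'D_(delta_mx ord0 i : Rn) f x.

Fixpoint Ck (k : nat) f : Prop :=
  continuous f /\
  if k is k'.+1 then
    forall i, (forall x, derivable f x (delta_mx ord0 i)) /\ Ck k' (partial i f)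
  else True.

Definition test_function phi :=
  (forall k, Ck k phi) /\ compact (closure [set x | phi x != 0]).

(* Classes of Lebesgue measurable functions up to a.e. equality are represented
   by Borel functions. *)
Definition L1 f := L.-integrable setT (EFin \o f).

Definition is_distr_derivative f (mu : vmeasure Rn R n) :=
  forall phi, test_function phi -> forall i,
    \int[L]_x (f x * partial i phi x) = - charge_integral (mu i) phi.

Definition BV f := L1 f /\ exists mu, is_distr_derivative f mu.

(* The default value is never used for f in BV, see distr_derivativeP. *)
Definition distr_derivative f : vmeasure Rn R n :=
  xget ((fun=> czero) : {classic vmeasure Rn R n}) (is_distr_derivative f).

Lemma distr_derivativeP f : BV f -> is_distr_derivative f (distr_derivative f).
Proof. by move=> [_ exD]; exact: (@xgetPex {classic vmeasure Rn R n}). Qed.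

Definition W11 f := L1 f /\
  exists2 g : 'I_n -> Rn -> R, forall i, L1 (g i) &
    forall phi, test_function phi -> forall i,
      \int[L]_x (f x * partial i phi x) = - \int[L]_x (g i x * phi x).

End BV.

(* Main.v *)
Require Import Defs.
From mathcomp Require Import all_boot all_order all_algebra finmap.
From mathcomp Require Import all_classical all_reals all_analysis.
From mathcomp Require Import measurable_realfun.
From mathcomp Require Import ring lra.

Set Implicit Arguments.
Unset Strict Implicit.
Unset Printing Implicit Defensive.

Import Order.TTheory GRing.Theory Num.Theory.
Import numFieldNormedType.Exports.

Local Open Scope classical_set_scope.
Local Open Scope ring_scope.

(* Lower bound.  Testing Df against a bump adapted to the cube Q(x, r) gives
   A f >= c r^-d |int (bump) dD_i f| on Q(x, 2r), since the integral of the
   partial derivative of the bump vanishes and f may be replaced by f minus its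
   mean.  Write D_i f = p - q (Jordan) and let K be a compact Lebesgue-null set
   with q(K) = 0.  For x in K take the first radius r, on a geometric scale
   descending from a fixed one, at which p(Q(x, r)) > mu r^d; by Vitali finitely
   many disjoint cubes Q(x, 2r) carry a fixed fraction of p(K) / mu of Lebesgue
   measure.  The cubes charged by q are negligible because q is small near K,
   and those where no radius was found because K is null; on the remaining ones
   A f > c mu.  This bounds the liminf below by a multiple of p(K).

   Vanishing for W^{1,1}.  By duality with test functions and the mean value
   theorem, int_Q |f(y + h) - f(y)| <= C |h| int_{Q'} |grad f|; averaging over h
   gives a Poincare inequality, so that A f is bounded by the maximal function
   of |grad f|.  The weak (1,1) estimate applied to |grad f| truncated at height
   c lambda shows that lambda |{A f > lambda}| tends to 0. *)

(** * Covering *)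

(** Stopping at the first radius of high density is what closes the covering argument: at the
    preceding scale [8 * r] the density of [p] is still at most [mu], so a tripled Vitali cube
    carries at most [mu * (8 * r) ^+ n], a fixed multiple of [mu] times the Lebesgue measure of the
    cube itself. The smallness of [q] is fixed before lambda, through a neighbourhood of K that
    bounds all radii; the neighbourhood of small Lebesgue measure is chosen after it. Everything is
    done per coordinate: each [D_i f] is a charge, its singular part is its restriction to one null
    set, and the two Jordan parts of the n coordinates give 2n positive masses, each playing p
    against its partner q; hence the factor 2n in the final constant. Bumps and coverings live on
    cubes, the balls of the sup norm, where a product of one-variable functions is a bump; Euclidean
    balls enter only through the oscillation and are compared with cubes up to a factor n. Lower
    semicontinuity of A f makes its superlevel sets open, hence measurable. If the liminf vanishes,
    the lower bound kills the singular part and Radon-Nikodym densities give the weak gradient. *)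

Section vitali_cover.
Context {R : realType} {V : normedModType R}.
Implicit Types (rad : V -> R) (s D : seq V).

(** Greedy selection: keep a ball of largest radius, discard those meeting it, recurse on the
    others. A discarded ball is no larger than the ball it meets, hence lies in the triple of that
    ball. *)
Lemma vitali_seq rad s : {in s, forall x, 0 < rad x} ->
  exists D, [/\ uniq D, {subset D <= s},
    trivIset [set` D] (fun x => ball x (rad x)) &
    forall x, x \in s -> exists2 y, y \in D & ball x (rad x) `<=` ball y (3 * rad y)].
Proof.
have [k] := ubnP (size s); elim: k s => // k IH [|a s] sk rad_gt0.
  by exists [::]; split => // x y.
have [j js jmax] : exists2 j, j \in a :: s & forall x, x \in a :: s -> rad x <= rad j.
  have lerad : total (fun x y => rad y <= rad x) by move=> x y; exact: le_total.
  have : size (sort (fun x y => rad y <= rad x) (a :: s)) = (size s).+1.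
    by rewrite size_sort.
  have := mem_sort (fun x y => rad y <= rad x) (a :: s).
  have := sort_sorted lerad (a :: s).
  case: (sort _ _) => [|j t]//= st memt _; exists j.
    by rewrite -memt mem_head.
  move=> x; rewrite -memt inE => /predU1P[->//|xt].
  have tr : transitive (fun x y => rad y <= rad x).
    by move=> ? ? ? /[swap]; exact: le_trans.
  by have /allP/(_ _ xt) := order_path_min tr st.
pose P x := `[< ball x (rad x) `&` ball j (rad j) = set0 >].
(* The ball of [j] meets itself, its radius being positive, so [j] fails [P] and the filtered list
   is strictly shorter. *)
have sP : (size (seq.filter P (a :: s)) < k)%N.
  rewrite size_filter -ltnS (leq_trans _ sk)// ltnS.
  rewrite -(count_predC P (a :: s)) -addn1 leq_add2l -has_count.
  apply/hasP; exists j => //=; apply/asboolP => j0.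
  have : (ball j (rad j) `&` ball j (rad j)) j.
    by split; apply: ballxx; exact: rad_gt0.
  by rewrite j0.
have [|D [uD Ds tD maxD]] := IH _ sP.
  by move=> x; rewrite mem_filter => /andP[_]; exact: rad_gt0.
have jD : j \notin D.
  apply/negP => /Ds; rewrite mem_filter => /andP[/asboolP j0 _].
  have : (ball j (rad j) `&` ball j (rad j)) j.
    by split; apply: ballxx; exact: rad_gt0.
  by rewrite j0.
exists (j :: D); split => /=.
- by rewrite jD.
- by move=> x; rewrite inE => /predU1P[->//|/Ds]; rewrite mem_filter => /andP[].
- move=> x y /=; rewrite !inE => /predU1P[->|xD] /predU1P[->//|yD].
  + move: (Ds _ yD); rewrite mem_filter => /andP[/asboolP y0 _].
    by rewrite setIC y0 => -[].
  + move: (Ds _ xD); rewrite mem_filter => /andP[/asboolP y0 _].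
    by rewrite y0 => -[].
  + exact: tD.
- move=> x xs; have [Px|] := boolP (P x).
    have [|y yD xy] := maxD x; first by rewrite mem_filter Px.
    by exists y => //; rewrite inE yD orbT.
  move=> /asboolP/eqP/set0P[z [xz jz]]; exists j; first by rewrite mem_head.
  move=> y xy; move: xz jz xy; rewrite -!ball_normE /ball_/= => xz jz xy.
  have := jmax _ xs => radxj.
  have -> : j - y = (j - z) - (x - z) + (x - y) by rewrite opprB !subrKA.
  rewrite (le_lt_trans (ler_normD _ _))// (le_lt_trans (lerD (ler_normB _ _) (lexx _)))//.
  lra.
Qed.

(** Passing to a finite subcover first guarantees a largest radius at each selection, so the
    enlargement factor is exactly 3. *)
Lemma vitali_compact rad (K : set V) : compact K ->
  (forall x, K x -> 0 < rad x) ->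
  exists D, [/\ uniq D, forall x, x \in D -> K x,
    trivIset [set` D] (fun x => ball x (rad x)) &
    K `<=` cover [set` D] (fun x => ball x (3 * rad x))].
Proof.
rewrite compact_cover => cK rad_gt0.
have [||s sK Ks] := cK _ K (fun x => ball x (rad x)).
- by move=> x Kx; apply: ball_open; exact: rad_gt0.
- by move=> x Kx; exists x => //; apply: ballxx; exact: rad_gt0.
have sK' x : x \in (s : seq V) -> K x by move=> /sK; rewrite inE.
have [|D [uD Ds tD maxD]] := @vitali_seq rad s.
  by move=> x /sK'; exact: rad_gt0.
exists D; split => //; first by move=> x /Ds /sK'.
by move=> x /Ks[y ys yx]; have [z zD yz] := maxD y ys; exists z => //; exact: yz.
Qed.

End vitali_cover.

(** * Cubes and Euclidean balls *)

Section rV_geometry.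
Context {R : realType} {n : nat}.
Local Notation Rn := 'rV[R]_n.
Local Notation L := (lebesgue_rV R n).
Implicit Types (x y h : Rn) (r : R).

Lemma measurable_rV_ball x r : measurable (ball x r).
Proof.
have [r0|r0] := ltP 0 r; first by apply: open_measurable_rV; exact: ball_open.
rewrite (_ : ball x r = set0); first exact: measurable0.
apply/seteqP; split => // y; rewrite -ball_normE /ball_/= => xyr.
by have := le_lt_trans (normr_ge0 _) xyr; rewrite ltNge r0.
Qed.

Lemma ball_rVE x r : 0 < r ->
  ball x r = [set y | forall i, ball (x ord0 i) r (y ord0 i)].
Proof.
move=> r0; apply/seteqP; split => [y [_ xy] i|y xy]; first exact: xy.
by split => // i j; rewrite (ord1 i).
Qed.

Lemma lebesgue_rV_ball x r : 0 < r -> L (ball x r) = ((2 * r) ^+ n)%:E.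
Proof.
move=> r0; rewrite ball_rVE// (@lebesgue_rV_box R n (fun i => ball (x ord0 i) r)) => [|i]; last first.
  exact: measurable_realfun.measurable_ball.
rewrite (eq_bigr (fun=> (2 * r)%:E)) => [|i _].
  by rewrite prodEFin big_const_ord iter_mulr_1.
by rewrite lebesgue_measure_ball ?ltW// mulr_natl.
Qed.

Lemma coord_ler_norm x i : `|x ord0 i| <= `|x|.
Proof.
rewrite [leRHS]mx_normrE; apply: (@le_bigmax _ _ _ 0 (fun ij => `|x ij.1 ij.2|) (ord0, i)).
Qed.

Lemma coord_le_enorm x i : `|x ord0 i| <= enorm x.
Proof.
rewrite -sqrtr_sqr ler_sqrt; last by rewrite sumr_ge0// => j _; rewrite sqr_ge0.
by rewrite (bigD1 i)//= lerDl sumr_ge0// => j _; rewrite sqr_ge0.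
Qed.

Lemma norm_le_enorm x : `|x| <= enorm x.
Proof.
rewrite [leLHS]mx_normrE; apply: bigmax_le; first exact: sqrtr_ge0.
by move=> [i j] _ /=; rewrite (ord1 i) coord_le_enorm.
Qed.

Lemma enorm_le_sum x : enorm x <= \sum_i `|x ord0 i|.
Proof.
have s0 : 0 <= \sum_i `|x ord0 i| by rewrite sumr_ge0.
rewrite -[leRHS]ger0_norm// -sqrtr_sqr ler_wsqrtr//.
rewrite expr2 mulr_sumr; apply: ler_sum => i _.
rewrite -normr_id -real_normK ?num_real// expr2 normr_id ler_wpM2r//.
by rewrite (bigD1 i)//= lerDl sumr_ge0.
Qed.

Lemma enorm_le_norm x : enorm x <= n%:R * `|x|.
Proof.
rewrite (le_trans (enorm_le_sum _))// (le_trans (ler_sum _ (fun i _ => coord_ler_norm x i)))//.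
by rewrite sumr_const card_ord mulr_natl.
Qed.

Lemma eball_sub_ball x r : eball x r `<=` ball x r.
Proof.
move=> y; rewrite /eball/= -ball_normE /ball_/= distrC; apply: le_lt_trans.
exact: norm_le_enorm.
Qed.

Lemma ball_sub_eball x r : (0 < n)%N -> ball x r `<=` eball x (n%:R * r).
Proof.
move=> n0 y; rewrite /eball/= -ball_normE /ball_/= distrC => xyr.
by rewrite (le_lt_trans (enorm_le_norm _))// ltr_pM2l ?ltr0n.
Qed.

Lemma enorm_continuous : continuous (@enorm R n).
Proof.
move=> x; apply: continuous_comp; last exact: sqrt_continuous.
apply: continuous_big.
  exact: add_continuous.
by move=> i _ y; apply: continuousM; exact: coord_continuous.
Qed.

Lemma open_eball x r : open (eball x r).
Proof.
rewrite (_ : eball x r = (fun y => enorm (y - x)) @^-1` [set t | t < r])//.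
apply: open_comp; last exact: open_lt.
move=> y _; apply: continuous_comp; last exact: enorm_continuous.
by apply: continuousB; [exact: cvg_id|exact: cst_continuous].
Qed.

Lemma measurable_eball x r : measurable (eball x r).
Proof. by apply: open_measurable_rV; exact: open_eball. Qed.

Lemma measurable_rV_translation h : measurable_fun setT (fun x : Rn => x + h).
Proof.
apply: measurable_fun_rV => i; under eq_fun do rewrite mxE.
by apply: measurable_funD => //; exact: measurable_rV_coord.
Qed.

End rV_geometry.

(** * Finite coverings and packings *)

Section measure_cover.
Context {d} {T : measurableType d} {R : realType}.
Variable m : {measure set T -> \bar R}.

Lemma measure_le_cover {I : choiceType} (D : seq I) (B : I -> set T) (A : set T) :
  measurable A -> (forall i, measurable (B i)) ->
  A `<=` cover [set` D] B -> (m A <= \sum_(i <- D) m (B i))%E.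
Proof.
(* Indexing [D] by [nth] takes a default element of [I]; if [I] is empty, so are [D] and [A]. *)
move=> mA mB AB; have [x0|] := pselect (exists x : I, True).
  have [i0 _] := x0; rewrite (big_nth i0) big_mkord.
  apply: (@content_subadditive _ _ _ m A (fun k => B (nth i0 D k))) => //.
  by apply: subset_trans AB _; rewrite /cover bigcup_seq (big_nth i0) big_mkord.
case: D AB => [|i D _ []]; last by exists i.
move=> AB _; rewrite big_nil (_ : A = set0) ?measure0//.
by rewrite -subset0 => x /AB[].
Qed.

Lemma measure_disjoint_le {I : choiceType} (D : seq I) (B : I -> set T) (A : set T) :
  measurable A -> (forall i, measurable (B i)) -> uniq D -> trivIset [set` D] B ->
  (forall i, i \in D -> B i `<=` A) -> (\sum_(i <- D) m (B i) <= m A)%E.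
Proof.
move=> mA mB uD tD BA.
have -> : (\sum_(i <- D) m (B i) = m (\bigcup_(i in [set` D]) B i))%E.
  by rewrite measure_fin_bigcup// fsbig_seq.
apply: le_measure; rewrite ?inE//.
  by apply: fin_bigcup_measurable.
by move=> x [i /= iD /(BA _ iD)].
Qed.

End measure_cover.

(** * Regularity of Borel measures on R^n *)

Section regularity.
Context {R : realType} {n : nat}.
Local Notation Rn := 'rV[R]_n.

Definition nbhd (K : set Rn) (e : R) : set Rn := \bigcup_(x in K) ball x e.

Lemma nbhd_open (K : set Rn) e : 0 < e -> open (nbhd K e).
Proof. by move=> e0; apply: bigcup_open => x _; exact: ball_open. Qed.

Lemma measurable_nbhd (K : set Rn) e : measurable (nbhd K e).
Proof.
have [e0|e0] := ltP 0 e; first by apply: open_measurable_rV; exact: nbhd_open.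
rewrite (_ : nbhd K e = set0); first exact: measurable0.
apply/seteqP; split => // y [x _]; rewrite -ball_normE /ball_/= => xyr.
by have := le_lt_trans (normr_ge0 _) xyr; rewrite ltNge e0.
Qed.

Lemma nbhd_sub (K : set Rn) e : 0 < e -> K `<=` nbhd K e.
Proof. by move=> e0 x Kx; exists x => //; exact: ballxx. Qed.

Lemma nbhd_le (K : set Rn) e1 e2 : e1 <= e2 -> nbhd K e1 `<=` nbhd K e2.
Proof. by move=> e12 y [x Kx xy]; exists x => //; exact: le_ball xy. Qed.

Lemma bigcap_nbhd (K : set Rn) : closed K -> \bigcap_k nbhd K k.+1%:R^-1 = K.
Proof.
move=> cK; apply/seteqP; split; last first.
  by move=> x Kx k _; apply: nbhd_sub.
move=> x Hx; rewrite (closure_id K).1// => B /nbhs_ballP[e /= e0 eB].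
have [k _ ke] := near_infty_natSinv_lt (PosNum e0).
have [y Ky yx] := Hx k I; exists y; split => //; apply: eB.
by apply: ball_sym; apply: le_ball yx; apply: ltW; apply: (ke k) => /=.
Qed.

Lemma closed_measurable_rV (K : set Rn) : closed K -> measurable K.
Proof.
move=> cK; rewrite -[K]setCK; apply: measurableC; apply: open_measurable_rV.
exact: closed_openC.
Qed.

Lemma compact_closed_rV (K : set Rn) : compact K -> closed K.
Proof. by apply: compact_closed; exact: norm_hausdorff. Qed.

Lemma compact_measurable_rV (K : set Rn) : compact K -> measurable K.
Proof. by move=> /compact_closed_rV; exact: closed_measurable_rV. Qed.

(** Continuity from above along neighbourhoods shrinking to the closed set [K]; the minimum with
    [e0] keeps them inside one of finite measure. *)
Lemma nbhd_measure (m : {measure set Rn -> \bar R}) (K : set Rn) (e0 : R) (c : \bar R) :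
  closed K -> 0 < e0 -> (m (nbhd K e0) < +oo)%E -> (m K < c)%E ->
  exists2 e, 0 < e & (m (nbhd K e) < c)%E.
Proof.
move=> cK e00 moo mKc.
pose F k := nbhd K (Num.min e0 k.+1%:R^-1).
have F_cap : \bigcap_k F k = K.
  apply/seteqP; split => [x Fx|x Kx k _].
    by rewrite -(bigcap_nbhd cK) => k _; apply: nbhd_le (Fx k I); rewrite ge_min lexx orbT.
  by apply: nbhd_sub => //; rewrite lt_min e00/=.
have : m (F k) @[k --> \oo] --> m (\bigcap_k F k).
  apply: nonincreasing_cvg_mu.
  - apply: le_lt_trans moo; apply: le_measure; rewrite ?inE; [exact: measurable_nbhd..|].
    by apply: nbhd_le; rewrite ge_min lexx.
  - by move=> k; exact: measurable_nbhd.
  - by rewrite F_cap; exact: closed_measurable_rV.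
  - move=> i j ij; apply/subsetPset; apply: nbhd_le.
    by rewrite le_min ge_min lexx/= ge_min lef_pV2 ?posrE// ler_nat ltnS ij orbT.
rewrite F_cap => /(_ [set z | (z < c)%E]) [].
  exact: open_ereal_lt'.
move=> k _ /(_ k (leqnn k)) mk; exists (Num.min e0 k.+1%:R^-1) => //.
by rewrite lt_min e00/=.
Qed.

Section inner.
Variable m : {measure set Rn -> \bar R}.
Hypothesis moo : (m setT < +oo)%E.

Let mfin A : measurable A -> m A \is a fin_num.
Proof.
move=> mA; rewrite ge0_fin_numE//; apply: le_lt_trans moo.
by rewrite le_measure ?inE.
Qed.

(** The two-sided condition is the one stable under complements, which exchange closed inner and
    open outer sets; it therefore spreads from open sets to the whole sigma-algebra. *)
Let approx (A : set Rn) := forall e : R, 0 < e -> exists F U,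
  [/\ closed F, open U, F `<=` A, A `<=` U & (m (U `\` F) < e%:E)%E].

Let approx_open U : open U -> approx U.
Proof.
move=> oU e e0; pose F k := ~` nbhd (~` U) k.+1%:R^-1.
have cF k : closed (F k) by apply: open_closedC; exact: nbhd_open.
have UF : \bigcap_k (U `\` F k) = set0.
  rewrite -subset0 => x Hx.
  have Ux : U x by case: (Hx 0%N I).
  have : (\bigcap_k nbhd (~` U) k.+1%:R^-1) x.
    by move=> k _; have [_ /contrapT] := Hx k I.
  by rewrite bigcap_nbhd => [//|]; exact: open_closedC.
have mUF k : measurable (U `\` F k).
  by apply: measurableD; [exact: open_measurable_rV|exact: closed_measurable_rV].
have : m (U `\` F k) @[k --> \oo] --> m (\bigcap_k (U `\` F k)).
  apply: nonincreasing_cvg_mu => //.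
  - by rewrite -ge0_fin_numE// mfin.
  - by rewrite UF.
  - move=> i j ij; apply/subsetPset => x [Ux nF]; split => // Fi; apply: nF.
    by move=> /nbhd_le H; apply: Fi; apply: H; rewrite lef_pV2 ?posrE// ler_nat ltnS.
rewrite UF measure0 => /(_ [set z | (z < e%:E)%E]) [].
  by apply: open_ereal_lt'; rewrite lte_fin.
move=> k _ /(_ k (leqnn k)) mk; exists (F k), U; split => //.
by move=> x Fx; apply: contrapT => nUx; apply: Fx; exact: nbhd_sub.
Qed.

Let approxC A : approx A -> approx (~` A).
Proof.
move=> aA e e0; have [F [U [cF oU FA AU mUF]]] := aA e e0.
exists (~` U), (~` F); split.
- exact: open_closedC.
- exact: closed_openC.
- exact: subsetC.
- exact: subsetC.
- by rewrite setDE setCK setIC -setDE.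
Qed.

Let approx_bigcup (A : (set Rn)^nat) : (forall k, approx (A k)) -> approx (\bigcup_k A k).
Proof.
move=> aA e e0.
have ek k : 0 < e / 2 / (2 ^ k.+1)%:R by rewrite divr_gt0 ?divr_gt0 ?ltr0n ?expn_gt0.
have /choice[F /choice[U FU]] : forall k, exists F U, [/\ closed F, open U, F `<=` A k,
    A k `<=` U & (m (U `\` F) < (e / 2 / (2 ^ k.+1)%:R)%:E)%E].
  by move=> k; exact: aA.
have mF k : measurable (F k) by apply: closed_measurable_rV; case: (FU k).
have mU k : measurable (U k) by apply: open_measurable_rV; case: (FU k).
(* The union of all the [F k] need not be closed. Half of [e] pays for the approximation of the
   pieces, the other half for truncating to a finite union. *)
pose G k := \big[setU/set0]_(i < k) F i.
have mG k : measurable (G k) by apply: bigsetU_measurable.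
pose UF := \bigcup_k F k; pose UU := \bigcup_k U k.
have mUF : measurable UF by exact: bigcupT_measurable.
have mUU : measurable UU by exact: bigcupT_measurable.
have h1 : (m (UU `\` UF) <= (e / 2)%:E)%E.
  apply: (@le_trans _ _ (\sum_(k <oo) m (U k `\` F k))%E).
    apply: measure_sigma_subadditive => //.
    - by move=> k; exact: measurableD.
    - exact: measurableD.
    - by move=> x [[k _ Ux] nF]; exists k => //; split => // Fx; apply: nF; exists k.
  apply: le_trans (epsilon_trick0 xpredT _); last by rewrite divr_ge0// ltW.
  by apply: lee_nneseries => // k _; case: (FU k) => _ _ _ _ /ltW.
have h2 : exists k, (m (UF `\` G k) < (e / 2)%:E)%E.
  have GF : \bigcap_k (UF `\` G k) = set0.
    rewrite -subset0 => x Hx; have [[k _ Fk] _] := Hx 0%N I.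
    by have [_] := Hx k.+1 I; apply; rewrite /G big_ord_recr/=; right.
  have : m (UF `\` G k) @[k --> \oo] --> m (\bigcap_k (UF `\` G k)).
    apply: nonincreasing_cvg_mu => //.
    - by rewrite -ge0_fin_numE// mfin//; exact: measurableD.
    - by move=> k; exact: measurableD.
    - by rewrite GF.
    - move=> i j ij; apply/subsetPset => x [Ux nF]; split => // Gi; apply: nF.
      move: Gi; rewrite /G -!bigcup_mkord => -[l /= li Fl]; exists l => //=.
      exact: leq_trans li ij.
  rewrite GF measure0 => /(_ [set z | (z < (e / 2)%:E)%E]) [].
    by apply: open_ereal_lt'; rewrite lte_fin divr_gt0.
  by move=> k _ /(_ k (leqnn k)) mk; exists k.
have [k mk] := h2; exists (G k), UU; split.
- rewrite /G -bigcup_mkord; apply: closed_bigcup => //.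
  by move=> i _; case: (FU i).
- by apply: bigcup_open => i _; case: (FU i).
- rewrite /G -bigcup_mkord => x [i _ Fi]; exists i => //.
  by case: (FU i) => _ _ + _ _; exact.
- by move=> x [i _ Ai]; exists i => //; case: (FU i) => _ _ _ + _; exact.
- apply: (@le_lt_trans _ _ (m ((UU `\` UF) `|` (UF `\` G k)))).
    apply: le_measure; rewrite ?inE; first exact: measurableD.
      by apply: measurableU; exact: measurableD.
    move=> x [UUx nG]; have [UFx|nUFx] := pselect (UF x); [by right|by left].
  apply: (@le_lt_trans _ _ (m (UU `\` UF) + m (UF `\` G k))%E).
    by apply: measureU2; exact: measurableD.
  by rewrite [e in e%:E]splitr EFinD lee_ltD// mfin//; exact: measurableD.
Qed.

Lemma closed_regular (A : set Rn) : measurable A -> forall e : R, 0 < e ->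
  exists F : set Rn, [/\ closed F, F `<=` A & (m (A `\` F) < e%:E)%E].
Proof.
move=> mA e e0.
have : approx A.
  move: A mA; rewrite rV_measurableE; apply: smallest_sub; last exact: approx_open.
  split.
  - by apply: approx_open; exact: open0.
  - by move=> A aA; rewrite setTD; exact: approxC.
  - exact: approx_bigcup.
move=> /(_ e e0)[F [U [cF oU FA AU mUF]]]; exists F; split => //.
apply: le_lt_trans mUF; apply: le_measure; rewrite ?inE.
- by apply: measurableD => //; exact: closed_measurable_rV.
- by apply: measurableD; [exact: open_measurable_rV|exact: closed_measurable_rV].
- exact: setSD.
Qed.

Lemma compact_regular (A : set Rn) : measurable A -> forall e : R, 0 < e ->
  exists K : set Rn, [/\ compact K, K `<=` A & (m (A `\` K) < e%:E)%E].
Proof.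
move=> mA e e0; have e20 : 0 < e / 2 by rewrite divr_gt0.
have [F [cF FA mF]] := closed_regular mA e20.
(* The measure being finite, cutting the closed set by a large closed ball costs at most the second
   half of [e]. *)
pose B k : set Rn := [set x | `|x| <= k%:R].
have cB k : closed (B k).
  rewrite (_ : B k = (fun x : Rn => `|x|) @^-1` [set t | t <= k%:R])//.
  by apply: preimage_closed; [move=> x _; exact: norm_continuous|exact: closed_le].
have mB k : measurable (B k) by exact: closed_measurable_rV.
have mF' := closed_measurable_rV cF.
have FB : \bigcap_k (F `\` B k) = set0.
  rewrite -subset0 => x Hx; have [_] := Hx (Num.truncn `|x|).+1 I; apply.
  by rewrite /B/= ltW// truncnS_gt.
have : m (F `\` B k) @[k --> \oo] --> m (\bigcap_k (F `\` B k)).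
  apply: nonincreasing_cvg_mu => //.
  - by rewrite -ge0_fin_numE// mfin//; exact: measurableD.
  - by move=> k; exact: measurableD.
  - by rewrite FB.
  - move=> i j ij; apply/subsetPset => x [Fx nB]; split => // Bi; apply: nB.
    by rewrite /B/= (le_trans Bi)// ler_nat.
rewrite FB measure0 => /(_ [set z | (z < (e / 2)%:E)%E]) [].
  by apply: open_ereal_lt'; rewrite lte_fin.
move=> k _ /(_ k (leqnn k)) mk; exists (F `&` B k); split.
- apply: bounded_closed_compact; last exact: closedI.
  exists k%:R; split; first by rewrite num_real.
  by move=> t kt x [_ Bx]; rewrite /= (le_trans Bx)// ltW.
- by move=> x [/FA].
- apply: (@le_lt_trans _ _ (m ((A `\` F) `|` (F `\` B k)))).
    apply: le_measure; rewrite ?inE.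
    - by apply: measurableD => //; exact: measurableI.
    - by apply: measurableU; exact: measurableD.
    move=> x [Ax nFB]; have [Fx|nF] := pselect (F x); last by left.
    by right; split => // Bx; apply: nFB.
  apply: (@le_lt_trans _ _ (m (A `\` F) + m (F `\` B k))%E).
    by apply: measureU2; exact: measurableD.
  by rewrite [e in e%:E]splitr EFinD lteD.
Qed.

End inner.
End regularity.

(** * Translation invariance of Lebesgue measure *)

Section translation.
Context {R : realType}.

Lemma lebesgue_measure_translation (h : R) (A : set R) : measurable A ->
  pushforward lebesgue_measure ((fun x => x + h) : _ -> measurableTypeR R) A =
  lebesgue_measure A.
Proof.
move=> mA; have mh : measurable_fun setT ((fun x => x + h) : measurableTypeR R -> measurableTypeR R).
  exact: measurable_funD.
pose mu : {measure set (measurableTypeR R) -> \bar R} :=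
  measure_function_pushforward__canonical__measure_function_Measure lebesgue_measure mh.
rewrite -[LHS]/(mu A); apply/esym/lebesgue_measure_unique => //= _ [[a b]] _ <-.
rewrite /= /pushforward (_ : _ @^-1` _ = `](a - h), (b - h)]%classic).
  by rewrite !lebesgue_measure_itv/= !lte_fin ltrD2r -!EFinB opprB addrA subrK.
by apply/seteqP; split => x /=; rewrite !in_itv/= ltrBlDr lerBrDr.
Qed.

Variable n : nat.
Local Notation Rn := 'rV[R]_n.
Local Notation L := (lebesgue_rV R n).
Implicit Type h : Rn.

(** The measure and its translate agree on boxes, a class stable under intersection that generates
    the sigma-algebra, and cubes centred at 0 exhaust the space with finite measure. *)
Lemma lebesgue_rV_translation h (A : set Rn) : measurable A ->
  L ((fun x => x + h) @^-1` A) = L A.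
Proof.
move=> mA.
pose box (B : 'I_n -> set (measurableTypeR R)) := [set x : Rn | forall i, B i (x ord0 i)].
pose G := [set box B | B in [set B | forall i, measurable (B i)]].
have mh : measurable_fun setT (fun x : Rn => x + h) by exact: measurable_rV_translation.
pose mu : {measure set Rn -> \bar R} :=
  measure_function_pushforward__canonical__measure_function_Measure L mh.
have mbox B : (forall i, measurable (B i)) -> measurable (box B).
  move=> mB; rewrite (_ : box B = \bigcap_(i in [set: 'I_n]) (rV_coord i @^-1` B i)).
    apply: fin_bigcap_measurable => // i _; rewrite -[X in measurable X]setTI.
    by apply: measurable_rV_coord => //; exact: mB.
  by apply/seteqP; split => [x Bx i _|x Bx i]; [exact: Bx|exact: (Bx i I)].
suff : mu A = L A by [].
apply: (measure_unique G (fun k => ball 0 k.+1%:R)) => //.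
- apply/seteqP; split; last first.
    apply: smallest_sub; first exact: sigma_algebra_measurable.
    by move=> _ [B mB <-]; exact: mbox.
  apply: smallest_sub; first exact: smallest_sigma_algebra.
  move=> E; rewrite -bigcup_seq => -[i _ [B mB <-]]; rewrite setTI.
  apply: sub_sigma_algebra; exists (fun j => if j == i then B else setT).
    by move=> j /=; case: ifP.
  apply/seteqP; split => [x /(_ i)|x Bx j] /=; first by rewrite eqxx.
  by case: eqP => // ->.
- move=> _ _ [B mB <-] [C mC <-]; exists (fun i => B i `&` C i).
    by move=> i; apply: measurableI; [exact: mB|exact: mC].
  apply/seteqP; split => x; last by move=> [Bx Cx] i; split; [exact: Bx|exact: Cx].
  by move=> BCx; split => i; case: (BCx i).
- move=> k; exists (fun i => ball (0 : R) k.+1%:R).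
    by move=> i; exact: measurable_ball.
  by rewrite ball_rVE//; apply/seteqP; split => x /= + i => /(_ i); rewrite mxE.
- apply/seteqP; split => // x _; exists (Num.truncn `|x|) => //.
  by rewrite -ball_normE /ball_/= sub0r normrN truncnS_gt.
- move=> _ [B mB <-]; rewrite [LHS]/= /pushforward.
  rewrite (_ : _ @^-1` _ = box (fun i => (fun x => x + h ord0 i) @^-1` B i)).
    transitivity (\prod_(i < n) lebesgue_measure (B i))%E; last exact/esym/lebesgue_rV_box.
    transitivity (\prod_(i < n) lebesgue_measure ((fun x : R => (x + h ord0 i)%R) @^-1` B i))%E.
      apply: lebesgue_rV_box.
      move=> i; rewrite -[X in measurable X]setTI.
      have : measurable_fun setT ((fun x => x + h ord0 i) : measurableTypeR R -> measurableTypeR R).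
        by apply: measurable_funD.
      by apply.
    by apply: eq_bigr => i _; exact: (lebesgue_measure_translation _ (mB i)).
  by apply/seteqP; split => x /= + i => /(_ i); rewrite mxE.
- move=> k; rewrite /= /pushforward.
  rewrite (_ : _ @^-1` _ = ball (- h) k.+1%:R); first by rewrite lebesgue_rV_ball// ltry.
  by apply/seteqP; split => x; rewrite -!ball_normE /ball_/= sub0r opprD addrC.
Qed.

Lemma ge0_integral_translation h D (f : Rn -> \bar R) : measurable D ->
  measurable_fun D f -> (forall x, D x -> 0 <= f x)%E ->
  (\int[L]_(x in (fun x => (x + h)%R) @^-1` D) f (x + h)%R = \int[L]_(x in D) f x)%E.
Proof.
move=> mD mf f0; have mh : measurable_fun setT (fun x : Rn => x + h).
  exact: measurable_rV_translation.
rewrite -(@ge0_integral_pushforward _ _ _ _ _ _ mh L D f)//; last first.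
  by move=> x /set_mem; exact: f0.
by apply: eq_measure_integral => A mA _; exact: lebesgue_rV_translation.
Qed.

Lemma integral_translation h (f : Rn -> \bar R) : measurable_fun setT f ->
  (\int[L]_x f (x + h)%R = \int[L]_x f x)%E.
Proof.
move=> mf; rewrite [LHS]integralE [RHS]integralE.
have ge0 (g : Rn -> \bar R) : measurable_fun setT g -> (forall x, 0 <= g x)%E ->
    (\int[L]_x g (x + h)%R = \int[L]_x g x)%E.
  by move=> mg g0; rewrite -(@ge0_integral_translation h setT g).
rewrite -(ge0 f^\+%E (measurable_funepos mf))//.
rewrite -(ge0 f^\-%E (measurable_funeneg mf))//.
by congr (_ - _)%E; apply: eq_integral => x _; rewrite (funepos_comp, funeneg_comp).
Qed.

Lemma Rintegral_translation h (f : Rn -> R) : measurable_fun setT f ->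
  \int[L]_x f (x + h) = \int[L]_x f x.
Proof.
move=> mf; rewrite /Rintegral -(integral_translation h (f := EFin \o f))//.
exact: measurableT_comp.
Qed.

Lemma L1_translation h (f : Rn -> R) : L1 f -> L1 (fun x => f (x + h)).
Proof.
move=> /integrableP[mf intf]; apply/integrableP; split.
  by apply: (measurableT_comp mf); exact: measurable_rV_translation.
rewrite (integral_translation h (f := fun x => `|(f x)%:E|%E))//.
exact: measurableT_comp.
Qed.

End translation.

(** * Smooth bumps *)

Section flat_function.
Context {R : realType}.
Implicit Types (p : {poly R}) (x t : R).

(** A family containing [exp(-1/x)] and closed under differentiation, so that smoothness is a single
    induction with the polynomial generalized. *)
Definition flat p x : R := if 0 < x then p.[x^-1] * expR (- x^-1) else 0.

(** Chain rule with t = 1/x: the derivative of [p(t) exp(-t)] in t is [(p' - p)(t) exp(-t)], and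
    dt/dx = -t^2. *)
Definition flatD p : {poly R} := 'X^2 * (p - p^`()).

(** For positive k, raise [t / k <= exp(t / k)] to the power k. *)
Lemma exprn_expRN_le (k : nat) t : 0 <= t -> t ^+ k * expR (- t) <= k%:R ^+ k.
Proof.
move=> t0; case: k => [|k].
  by rewrite !expr0 mul1r -[leRHS]expR0 ler_expR oppr_le0.
rewrite expRN ler_pdivrMr ?expR_gt0//.
have -> : t = k.+1%:R * (t / k.+1%:R) by rewrite mulrC divfK.
rewrite expRM_natl exprMn ler_wpM2l ?exprn_ge0// lerXn2r ?nnegrE ?divr_ge0 ?expR_ge0//.
by rewrite (le_trans _ (expR_ge1Dx _))// lerDr.
Qed.

Lemma flat_bounded p : exists2 C, 0 < C & forall x, `|flat p x| <= C.
Proof.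
exists (1 + \sum_(i < size p) `|p`_i| * i%:R ^+ i).
  by rewrite ltr_wpDr// sumr_ge0// => i _; rewrite mulr_ge0// exprn_ge0.
move=> x; rewrite /flat; case: ifPn => [x0|_]; last first.
  by rewrite normr0 addr_ge0// sumr_ge0// => i _; rewrite mulr_ge0// exprn_ge0.
rewrite horner_coef normrM (ger0_norm (expR_ge0 _)).
apply: (@le_trans _ _ (\sum_(i < size p) `|p`_i| * i%:R ^+ i)); last by rewrite lerDr.
rewrite (le_trans (ler_wpM2r _ (ler_norm_sum _ _ _))) ?expR_ge0// mulr_suml.
apply: ler_sum => i _; rewrite normrM -mulrA ler_wpM2l//.
have xi0 : 0 <= x^-1 by rewrite invr_ge0 ltW.
by rewrite normrX (ger0_norm xi0) exprn_expRN_le.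
Qed.

Lemma is_derive_flat p x : is_derive x 1 (flat p) (flat (flatD p) x).
Proof.
have [x0|x0|<-] := ltgtP 0 x.
- have near_eq : \near x, p.[x^-1] * expR (- x^-1) = flat p x.
    near=> y; rewrite /flat ifT//.
    by near: y; exact: lt_nbhsr.
  apply: (near_eq_is_derive near_eq).
  have xn0 : x != 0 by rewrite gt_eqF.
  have dV : is_derive x 1 (fun y : R => y^-1) (- x ^- 2 *: 1).
    exact: (is_deriveV xn0 (is_derive_id x 1)).
  have dp := is_derive1_comp (is_derive_poly p x^-1) dV.
  have dE := @is_derive1_comp R expR (fun y => - y^-1) x _ _ (is_derive_expR _) (is_deriveN dV).
  apply: is_derive_eq (is_deriveM dp dE) _.
  rewrite /flat x0 /flatD !hornerE /= /GRing.scale/=.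
  by field.
- have near_eq : \near x, 0 = flat p x.
    near=> y; rewrite /flat ifF//; apply/negbTE; rewrite -leNgt ltW//.
    by near: y; exact: lt_nbhsl.
  apply: (near_eq_is_derive near_eq).
  by rewrite /flat (lt_gtF x0); exact: is_derive_cst.
(* At 0 the bound for ['X^2 * p] gains two powers of h: the difference quotient is at most
   [C * |h|], so the derivative is 0. *)
- have [C C0 flatC] := flat_bounded ('X^2 * p).
  have bnd h : h != 0 -> `|h^-1 * flat p h| <= C * `|h|.
    move=> h0; have := flatC h; rewrite /flat; case: ifPn => hgt; last first.
      by rewrite mulr0 normr0 => _; rewrite mulr_ge0// ltW.
    rewrite hornerM hornerXn => H.
    have -> : h^-1 * (p.[h^-1] * expR (- h^-1)) =
        (h^-1 ^+ 2 * p.[h^-1] * expR (- h^-1)) * h by field.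
    by rewrite normrM ler_wpM2r.
  have lim0 : h^-1 *: ((flat p \o shift 0) (h *: 1) - flat p 0) @[h --> 0^'] --> (0 : R).
    apply/cvgrPdist_le => e e0; near=> h.
    have h0 : h != 0 by near: h; exact: nbhs_dnbhs_neq.
    rewrite sub0r normrN /= /GRing.scale/= mulr1 addr0 /flat ltxx subr0 -/(flat p h).
    rewrite (le_trans (bnd _ h0))// mulrC -ler_pdivlMr//.
    by near: h; apply: dnbhs0_le; rewrite divr_gt0.
  apply: DeriveDef; first by apply/cvg_ex; exists 0.
  by rewrite [RHS]/flat ltxx; exact: cvg_lim lim0.
Unshelve. all: by end_near. Qed.

Lemma flat1_ge0 x : 0 <= flat 1 x.
Proof. by rewrite /flat; case: ifP => // _; rewrite hornerE mul1r expR_ge0. Qed.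

Lemma flat1_le1 x : flat 1 x <= 1.
Proof.
rewrite /flat; case: ifP => // x0; rewrite hornerE mul1r -[leRHS]expR0 ler_expR.
by rewrite oppr_le0 invr_ge0 ltW.
Qed.

Lemma flat1_lb x : 1 <= x -> expR (-1) <= flat 1 x.
Proof.
move=> x1; have x0 := lt_le_trans ltr01 x1.
by rewrite /flat x0 hornerE mul1r ler_expR lerN2 invf_le1.
Qed.

Lemma flat_eq0 p x : x <= 0 -> flat p x = 0.
Proof. by rewrite leNgt /flat => /negbTE ->. Qed.

End flat_function.

Section Ck_theory.
Context {R : realType} {n : nat}.
Local Notation Rn := 'rV[R]_n.
Implicit Types (f g phi : Rn -> R) (x y v : Rn) (i j : 'I_n) (k : nat).

(** Reduces directional derivatives to one real variable, where the chain rule [is_derive1_comp]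
    applies. *)
Lemma derive_line f x v : 'D_v f x = 'D_1 (fun t : R => f (t *: v + x)) 0.
Proof.
rewrite /derive.
suff -> : (fun h : R => h^-1 *: ((f \o shift x) (h *: v) - f x)) =
  (fun h : R => h^-1 *: (((fun t : R => f (t *: v + x)) \o shift 0) (h *: 1) -
    f (0 *: v + x))) by [].
by apply/funext => h /=; rewrite addr0 scale0r add0r /GRing.scale/= mulr1.
Qed.

Lemma derivable_line f x v :
  derivable f x v <-> derivable (fun t : R => f (t *: v + x)) 0 1.
Proof.
rewrite /derivable.
suff -> : (fun h : R => h^-1 *: ((f \o shift x) (h *: v) - f x)) =
  (fun h : R => h^-1 *: (((fun t : R => f (t *: v + x)) \o shift 0) (h *: 1) -
    f (0 *: v + x))) by [].
by apply/funext => h /=; rewrite addr0 scale0r add0r /GRing.scale/= mulr1.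
Qed.

Lemma is_derive_line f x v l :
  is_derive (0 : R) 1 (fun t : R => f (t *: v + x)) l -> is_derive x v f l.
Proof.
move=> [df <-]; apply: DeriveDef; first exact/derivable_line.
exact: derive_line.
Qed.

Lemma partialE i f x : partial i f x = 'D_1 (fun t : R => f (t *: delta_mx ord0 i + x)) 0.
Proof. exact: derive_line. Qed.

Lemma CkW k f : Ck k.+1 f -> Ck k f.
Proof.
elim: k f => [f []//|k IH f [cf df]]; split => // i; have [di Ci] := df i.
by split => //; exact: IH.
Qed.

Lemma Ck_continuous k f : Ck k f -> continuous f.
Proof. by case: k => [|k] []. Qed.

Lemma Ck_cst k (c : R) : @Ck R n k (fun=> c).
Proof.
elim: k c => [|k IH] c; split => //; try exact: cst_continuous.
move=> i; split; first by move=> x; exact: (@ex_derive _ _ _ _ _ _ _ (is_derive_cst c x _)).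
rewrite (_ : partial i _ = fun=> 0); first exact: IH.
by apply/funext => x; rewrite /partial derive_cst.
Qed.

Lemma CkD k f g : Ck k f -> Ck k g -> Ck k (fun x => f x + g x).
Proof.
elim: k f g => [|k IH] f g Cf Cg.
  by split => // x; apply: continuousD; [exact: (Ck_continuous Cf)|exact: (Ck_continuous Cg)].
split; first by move=> x; apply: continuousD; [exact: (Ck_continuous Cf)|exact: (Ck_continuous Cg)].
case: Cf Cg => _ df [_ dg] i; have [dfi Cfi] := df i; have [dgi Cgi] := dg i.
split; first by move=> x; exact: derivableD.
rewrite (_ : partial i _ = fun x => partial i f x + partial i g x); first exact: IH.
by apply/funext => x; rewrite /partial -deriveD.
Qed.

Lemma CkM k f g : Ck k f -> Ck k g -> Ck k (fun x => f x * g x).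
Proof.
elim: k f g => [|k IH] f g Cf Cg.
  by split => // x; apply: continuousM; [exact: (Ck_continuous Cf)|exact: (Ck_continuous Cg)].
split; first by move=> x; apply: continuousM; [exact: (Ck_continuous Cf)|exact: (Ck_continuous Cg)].
have [Cf' Cg'] := (CkW Cf, CkW Cg).
case: Cf Cg => _ df [_ dg] i; have [dfi Cfi] := df i; have [dgi Cgi] := dg i.
split; first by move=> x; exact: derivableM.
rewrite (_ : partial i _ = fun x => f x * partial i g x + g x * partial i f x).
  by apply: CkD; exact: IH.
by apply/funext => x; rewrite /partial deriveM.
Qed.

Lemma Ck_prod k (I : Type) (s : seq I) (F : I -> Rn -> R) :
  (forall a, Ck k (F a)) -> Ck k (fun x => \prod_(a <- s) F a x).
Proof.
move=> CF; elim: s => [|a s IH].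
  by under eq_fun do rewrite big_nil; exact: Ck_cst.
by under eq_fun do rewrite big_cons; exact: CkM.
Qed.

(** The factor [c] and the polynomial [p] make the induction go through: a partial derivative has
    the same form, with [c * (a * (i == j)%:R)] and [flatD p]. *)
Lemma Ck_flat k j (a b c : R) (p : {poly R}) :
  Ck k (fun x => c * flat p (a * x ord0 j + b)).
Proof.
have dG x i q e : is_derive x (delta_mx ord0 i) (fun x : Rn => e * flat q (a * x ord0 j + b))
    ((e * (a * (i == j)%:R)) * flat (flatD q) (a * x ord0 j + b)).
  apply: is_derive_line.
  have dl : is_derive (0 : R) 1 (fun t : R => a * (i == j)%:R * t + (a * x ord0 j + b))
      (a * (i == j)%:R).
    apply: is_derive_eq; rewrite addr0 /GRing.scale/=.
    by rewrite mulr1.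
  have -> : (fun t : R => e * flat q (a * (t *: delta_mx ord0 i + x) ord0 j + b)) =
      (fun t => e * (flat q \o (fun t : R => a * (i == j)%:R * t + (a * x ord0 j + b))) t).
    apply/funext => t /=; rewrite !mxE eqxx/= (eq_sym j).
    by congr (_ * flat _ _); ring.
  have := is_derive_flat q (a * (i == j)%:R * 0 + (a * x ord0 j + b)).
  move=> dq; have := @is_derive1_comp R (flat q)
    (fun t => a * (i == j)%:R * t + (a * x ord0 j + b)) 0 _ _ dq dl.
  rewrite mulr0 add0r => H.
  apply: is_derive_eq; rewrite /GRing.scale/=.
  by rewrite -mulrA; congr (_ * _); rewrite mulrC.
have cG q e : continuous (fun x : Rn => e * flat q (a * x ord0 j + b)).
  have cflat : continuous (flat q).
    move=> y; apply: differentiable_continuous; apply/derivable1_diffP.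
    by have [] := is_derive_flat q y.
  move=> x; apply: (@continuousM R Rn (cst e) (fun x => flat q (a * x ord0 j + b))); first exact: cst_continuous.
  apply: (@continuous_comp _ _ _ (fun x : Rn => a * x ord0 j + b) (flat q)); last exact: cflat.
  apply: (@continuousD _ R Rn (fun x => a * x ord0 j) (cst b)); last exact: cst_continuous.
  apply: (@continuousM R Rn (cst a) (fun x => x ord0 j)); first exact: cst_continuous.
  exact: coord_continuous.
elim: k c p => [|k IH] c p; split => //.
move=> i; split; first by move=> x; have [] := dG x i p c.
rewrite (_ : partial i _ = fun x => (c * (a * (i == j)%:R)) * flat (flatD p) (a * x ord0 j + b)).
  exact: IH.
by apply/funext => x; rewrite /partial; have [_ ->] := dG x i p c.
Qed.

Lemma compact_closure_rV (A : set Rn) (r : R) : A `<=` ball 0 r -> compact (closure A).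
Proof.
move=> Ar; apply: bounded_closed_compact; last exact: closed_closure.
exists r; split; first by rewrite num_real.
move=> t rt x /(closure_subset Ar) xr /=.
have : closure [set y : Rn | `|y| <= r] x.
  by apply: closure_subset xr => y; rewrite -ball_normE /ball_/= sub0r normrN => /ltW.
have cB : closed [set y : Rn | `|y| <= r].
  rewrite (_ : [set y | _] = (fun x : Rn => `|x|) @^-1` [set t | t <= r])//.
  by apply: preimage_closed; [move=> y _; exact: norm_continuous|exact: closed_le].
by rewrite -(closure_id _).1// => /le_trans; apply; exact: ltW.
Qed.

(** The arguments are 2 + (y_j - x_j)/r and 2 - (y_j - x_j)/r, expanded to the affine form of
    [Ck_flat]. Both are positive for all j exactly on the cube of half-side 2r, and they exceed 1 on
    the cube of half-side r. *)
Definition rV_bump x (r : R) y : R :=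
  \prod_j (flat 1 (r^-1 * y ord0 j + (2 - x ord0 j / r)) *
           flat 1 (- r^-1 * y ord0 j + (2 + x ord0 j / r))).

(** Each of the n coordinates contributes two factors, each at least exp(-1) on the inner cube by
    [flat1_lb]. *)
Definition bump_min : R := (expR (-1) ^+ 2) ^+ n.

Lemma bump_min_gt0 : 0 < bump_min.
Proof. by rewrite /bump_min !exprn_gt0// expR_gt0. Qed.

Lemma bump_ge0 x r y : 0 <= rV_bump x r y.
Proof. by apply: prodr_ge0 => j _; rewrite mulr_ge0// flat1_ge0. Qed.

Lemma bump_le1 x r y : rV_bump x r y <= 1.
Proof.
apply: prodr_ile1 => j _; rewrite mulr_ge0 ?flat1_ge0//=.
by rewrite mulr_ile1 ?flat1_ge0 ?flat1_le1.
Qed.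

Lemma bump_lb x r y : 0 < r -> ball x r y -> bump_min <= rV_bump x r y.
Proof.
move=> r0; rewrite ball_rVE// => xy; rewrite /bump_min /rV_bump.
rewrite -[X in _ ^+ X]card_ord -prodr_const; apply: ler_prod => j _.
rewrite exprn_ge0 ?expR_ge0//= expr2.
have := xy j; rewrite /ball/= ltr_distl => /andP[xy1 xy2].
by apply: ler_pM; rewrite ?expR_ge0//; apply: flat1_lb;
  rewrite -(ler_pM2r r0) !mulrDl !mul1r ?mulNr ?mulrN ?divfK ?gt_eqF// mulrAC mulVf ?gt_eqF//; lra.
Qed.

Lemma bump_eq0 x r y : 0 < r -> ~ ball x (2 * r) y -> rV_bump x r y = 0.
Proof.
move=> r0; rewrite ball_rVE ?mulr_gt0// => /existsNP[j].
rewrite /ball/= => /negP; rewrite -leNgt ler_normr => xy.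
rewrite /rV_bump (bigD1 j)//=; apply/eqP; rewrite !mulf_eq0; apply/orP; left.
have H t : t * r <= 0 -> t <= 0 by rewrite pmulr_lle0.
case/orP: xy => xy; apply/orP; [left|right]; apply/eqP/flat_eq0/H;
  by rewrite !mulrDl ?mulNr ?mulrN ?divfK ?gt_eqF// mulrAC mulVf ?gt_eqF//; lra.
Qed.

Lemma Ck_bump k x r : Ck k (rV_bump x r).
Proof.
apply: Ck_prod => j; apply: CkM.
  by have := @Ck_flat k j r^-1 (2 - x ord0 j / r) 1 1; under eq_fun do rewrite mul1r.
by have := @Ck_flat k j (- r^-1) (2 + x ord0 j / r) 1 1; under eq_fun do rewrite mul1r.
Qed.

Lemma test_functionP phi (r : R) : (forall k, Ck k phi) ->
  (forall y, ~ ball 0 r y -> phi y = 0) -> test_function phi.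
Proof.
move=> Cphi phi0; split => //; apply: (@compact_closure_rV _ r) => y /= /eqP.
by apply: contra_notP => /phi0.
Qed.

Lemma ball_sub0 x (r : R) : ball x r `<=` ball 0 (`|x| + r).
Proof.
move=> y; rewrite -!ball_normE /ball_/= sub0r normrN => xy.
rewrite -[y](subrK x) (le_lt_trans (ler_normD _ _))// addrC ltrD2l.
by rewrite distrC.
Qed.

Lemma test_bump x r : 0 < r -> test_function (rV_bump x r).
Proof.
move=> r0; apply: (@test_functionP _ (`|x| + 2 * r)); first by move=> k; exact: Ck_bump.
by move=> y ny; apply: bump_eq0 => // /ball_sub0.
Qed.

End Ck_theory.

Section bump_partial.
Context {R : realType} {n : nat}.
Local Notation Rn := 'rV[R]_n.
Implicit Types (f g phi : Rn -> R) (x y v : Rn) (i j : 'I_n) (k : nat).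

(** Only the two factors of coordinate [i] are differentiated, each yielding a factor 1/r up to
    sign; all others lie in [0, 1]. The bound is thus uniform in the centre and the scale. *)
Lemma bump_partial_bound : exists2 C : R, 0 < C &
  forall i x (r : R) y, 0 < r -> `|partial i (rV_bump x r) y| <= C / r.
Proof.
have [C C0 flatC] := @flat_bounded R (flatD 1).
exists (2 * C) => [|i x r y r0]; first by rewrite mulr_gt0.
pose a := r^-1 * y ord0 i + (2 - x ord0 i / r).
pose b := - r^-1 * y ord0 i + (2 + x ord0 i / r).
pose c := \prod_(j | j != i) (flat 1 (r^-1 * y ord0 j + (2 - x ord0 j / r)) *
           flat 1 (- r^-1 * y ord0 j + (2 + x ord0 j / r))).
have c01 : 0 <= c <= 1.
  rewrite prodr_ge0/=; last by move=> j _; rewrite mulr_ge0// flat1_ge0.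
  apply: prodr_ile1 => j _; rewrite mulr_ge0 ?flat1_ge0//=.
  by rewrite mulr_ile1 ?flat1_ge0 ?flat1_le1.
have lineE : (fun t : R => rV_bump x r (t *: delta_mx ord0 i + y)) =
    (fun t => c * ((flat 1 \o (fun t => r^-1 * t + a)) t *
                   (flat 1 \o (fun t => - r^-1 * t + b)) t)).
  apply/funext => t; rewrite /rV_bump (bigD1 i)//= mulrC; congr (_ * _).
    apply: eq_bigr => j ji; rewrite !mxE eqxx/= (negbTE ji) mulr0 add0r.
    by [].
  by rewrite !mxE !eqxx/= mulr1 !mulrDr /a /b !addrA.
have dl (u w : R) : is_derive (0 : R) 1 (fun t : R => u * t + w) u.
  by apply: is_derive_eq; rewrite addr0 /GRing.scale/= mulr1.
have df (u w : R) : is_derive (0 : R) 1 (flat 1 \o (fun t => u * t + w))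
    (flat (flatD 1) w * u).
  have := is_derive_flat 1 (u * 0 + w).
  move=> dq; have := @is_derive1_comp R (flat 1) (fun t => u * t + w) 0 _ _ dq (dl u w).
  by rewrite mulr0 add0r.
have dp : is_derive (0 : R) 1 (fun t : R => rV_bump x r (t *: delta_mx ord0 i + y))
   (c * (flat 1 a * (flat (flatD 1) b * - r^-1) + flat 1 b * (flat (flatD 1) a * r^-1))).
  rewrite lineE.
  have [d1 d2] := (df r^-1 a, df (- r^-1) b).
  apply: is_derive_eq; rewrite /GRing.scale/= ?mulr0 ?add0r ?addr0.
  by [].
rewrite partialE; have [_ ->] := dp.
have [c0 c1] := andP c01.
rewrite normrM (ger0_norm c0) -[leRHS]mul1r ler_pM//.
rewrite mulr2n mulrDl mul1r mulrDl (le_trans (ler_normD _ _))//.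
have rV : 0 <= r^-1 by rewrite invr_ge0 ltW.
have H u w : `|flat 1 u * (flat (flatD 1) w * r^-1)| <= C / r.
  rewrite normrM (ger0_norm (flat1_ge0 _)) normrM (ger0_norm rV) mulrA ler_wpM2r//.
  by rewrite -[leRHS]mul1r ler_pM// ?flat1_ge0// flat1_le1.
by rewrite lerD// ?H// !mulrN normrN H.
Qed.

(* [1 - \prod (1 - bump)] is smooth without composing with a smooth step
   function; the price is the value [bump_min] instead of 1 on [K]. *)
Lemma smooth_urysohn (K U : set Rn) (r : R) : compact K -> open U -> K `<=` U ->
  U `<=` ball 0 r ->
  exists phi, [/\ test_function phi, (forall x, 0 <= phi x <= 1),
    (forall x, K x -> @bump_min R n <= phi x) & (forall x, ~ U x -> phi x = 0)].
Proof.
move=> cK oU KU Ur.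
(* The bump of radius [rad x] lives on the cube of radius [2 * rad x], which must fit in [U]. Off
   [K] the radius 1 is a default. *)
have /choice[rad Hrad] : forall x, exists e : R, 0 < e /\ (K x -> ball x (2 * e) `<=` U).
  move=> x; have [Kx|nKx] := pselect (K x); last by exists 1.
  have /nbhs_ballP[e /= e0 eU] : nbhs x U by apply: open_nbhs_nbhs; split => //; exact: KU.
  by exists (e / 2); split => [|_]; [rewrite divr_gt0|rewrite mulrC divfK].
have [s sK Ks] : finite_subset_cover K (fun x => ball x (rad x)) K.
  move: cK; rewrite compact_cover; apply.
    by move=> x _; apply: ball_open; case: (Hrad x).
  by move=> x Kx; exists x => //; apply: ballxx; case: (Hrad x).
have sK' x : x \in (s : seq Rn) -> K x by move=> /sK; rewrite inE.
have f01 x : 0 <= \prod_(y <- s) (1 - rV_bump y (rad y) x) <= 1.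
  by rewrite prodr_ge0 ?prodr_ile1// => y _;
    rewrite ?subr_ge0 bump_le1//= lerBlDl lerDr bump_ge0.
(* Differences are written with [(-1) *] so that [CkD] and [CkM] apply. *)
exists (fun x => 1 + (-1) * \prod_(y <- s) (1 + (-1) * rV_bump y (rad y) x)).
have E x : \prod_(y <- s) (1 + (-1) * rV_bump y (rad y) x) = \prod_(y <- s) (1 - rV_bump y (rad y) x).
  by apply: eq_bigr => y _; rewrite mulN1r.
have off x : ~ U x -> 1 + (-1) * \prod_(y <- s) (1 + (-1) * rV_bump y (rad y) x) = 0.
  move=> nUx; rewrite big_seq big1 ?mulr1 ?subrr// => y ys.
  rewrite bump_eq0 ?mulr0 ?addr0//; first by case: (Hrad y).
  by move=> yx; apply: nUx; case: (Hrad y) => _ /(_ (sK' _ ys)); apply.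
split => //.
- apply: (@test_functionP _ _ _ r); last first.
    by move=> y nry; apply: off => /Ur.
  move=> k; apply: CkD; first exact: Ck_cst.
  apply: CkM; first exact: Ck_cst.
  apply: Ck_prod => y; apply: CkD; first exact: Ck_cst.
  by apply: CkM; [exact: Ck_cst|exact: Ck_bump].
- move=> x; rewrite E mulN1r subr_ge0 lerBlDl lerDr.
  by have /andP[-> ->] := f01 x.
- move=> x /Ks[y /= ys yx]; rewrite E mulN1r.
  rewrite (perm_big _ (perm_to_rem ys)) big_cons/=.
  rewrite (@le_trans _ _ (rV_bump y (rad y) x))//; first by apply: bump_lb => //; case: (Hrad y).
  rewrite lerBrDl -lerBrDr -[leRHS]mulr1 ler_wpM2l// ?subr_ge0 ?bump_le1//.
  apply: prodr_ile1 => z _.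
  by rewrite subr_ge0 bump_le1 lerBlDl lerDr bump_ge0.
Qed.

End bump_partial.

(** * Test functions *)

Section integration_lemmas.
Context {d} {T : measurableType d} {R : realType}.
Variable m : {measure set T -> \bar R}.

Lemma integrable_mul_bounded (D : set T) (u phi : T -> R) (C : R) : measurable D ->
  m.-integrable D (EFin \o u) -> measurable_fun D phi ->
  (forall x, D x -> `|phi x| <= C) -> m.-integrable D (fun x => (u x * phi x)%:E).
Proof.
move=> mD iu mphi phiC.
rewrite (_ : (fun x => _) = ((EFin \o u) \* (EFin \o phi))%E)//.
apply: integrableMl => //; exists C; split; first by rewrite num_real.
by move=> N CN x Dx /=; rewrite (le_trans (phiC _ Dx))// ltW.
Qed.

Lemma integrable_mul_indic (D E : set T) (u : T -> R) : measurable D -> measurable E ->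
  m.-integrable D (EFin \o u) -> m.-integrable D (fun x => (u x * \1_E x)%:E).
Proof.
move=> mD mE iu; apply: (@integrable_mul_bounded _ _ _ 1) => //.
by move=> x _; rewrite indicE ger0_norm ?ler0n// lern1 leq_b1.
Qed.

Lemma Rintegral_indic_mul (E : set T) (u : T -> R) : measurable E ->
  \int[m]_x (u x * \1_E x) = \int[m]_(x in E) u x.
Proof.
move=> mE; rewrite [RHS]Rintegral_mkcond; apply: eq_Rintegral => x _.
by rewrite patchE indicE; case: ifP => _; rewrite ?mulr1 ?mulr0.
Qed.

Lemma integrable_bounded_set (D : set T) (u : T -> R) (C : R) : measurable D ->
  (m D < +oo)%E -> measurable_fun D u -> (forall x, D x -> `|u x| <= C) ->
  m.-integrable D (EFin \o u).
Proof.
move=> mD Doo mu uC.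
apply: measurable_bounded_integrable => //; exists C; split; first by rewrite num_real.
by move=> N CN x Dx /=; rewrite (le_trans (uC _ Dx))// ltW.
Qed.

End integration_lemmas.

Section continuous_measurable.
Context {R : realType} {n : nat}.
Local Notation Rn := 'rV[R]_n.

Lemma continuous_measurable_rV (f : Rn -> R) : continuous f -> measurable_fun setT f.
Proof.
move=> cf _ B mB; rewrite setTI.
suff : @measurable _ (measurableTypeR R) `<=` image_set_system setT f (@measurable _ Rn).
  by move=> /(_ _ mB); rewrite /image_set_system/= setTI.
rewrite RGenOpens.measurableE; apply: smallest_sub.
  exact/sigma_algebra_image/sigma_algebra_measurable.
move=> _ [x [y ->]]; rewrite /image_set_system/= setTI.
apply: open_measurable_rV; apply: open_comp; last exact: interval_open.
by move=> z _; exact: cf.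
Qed.

Lemma bounded_compact_support (f : Rn -> R) (S : set Rn) : continuous f -> compact S ->
  (forall x, ~ S x -> f x = 0) -> exists2 C : R, 0 < C & forall x, `|f x| <= C.
Proof.
move=> cf cS fS.
have : compact (f @` S).
  by apply: continuous_compact => //; apply: continuous_subspaceT.
move=> /compact_bounded[M [_ HM]]; exists (`|M| + 1); first by rewrite ltr_pwDr.
move=> x; have [Sx|/fS ->] := pselect (S x); last by rewrite normr0 addr_ge0.
by apply: HM; [rewrite (le_lt_trans (ler_norm _))// ltrDl|exists x].
Qed.

End continuous_measurable.

Section test_functions.
Context {R : realType} {n : nat}.
Local Notation Rn := 'rV[R]_n.
Local Notation L := (lebesgue_rV R n).
Implicit Types (phi f u g w : Rn -> R) (i : 'I_n) (x y h : Rn).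

Lemma test_continuous phi : test_function phi -> continuous phi.
Proof. by move=> [/(_ 0%N)/Ck_continuous]. Qed.

Lemma test_partial_continuous phi i : test_function phi -> continuous (partial i phi).
Proof. by move=> [/(_ 1%N)[_ /(_ i)[_ []]]]. Qed.

Lemma test_derivable phi i x : test_function phi -> derivable phi x (delta_mx ord0 i).
Proof. by move=> [/(_ 1%N)[_ /(_ i)[+ _]]]; exact. Qed.

Lemma test_eq0 phi x : ~ closure [set x | phi x != 0] x -> phi x = 0.
Proof.
by apply: contra_notP => phix; apply: subset_closure; apply/eqP.
Qed.

Lemma partial_eq0 phi i x : ~ closure [set x | phi x != 0] x -> partial i phi x = 0.
Proof.
move=> nSx; rewrite /partial.
have : open (~` closure [set x | phi x != 0]) by exact/closed_openC/closed_closure.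
move=> oS; have H : nbhs x (~` closure [set x | phi x != 0]) by exact: open_nbhs_nbhs.
have near0 : \near x, phi x = cst 0 x by apply: filterS H => y; exact: test_eq0.
by rewrite (near_eq_derive _ near0) derive_cst.
Qed.

Lemma test_bounded phi : test_function phi -> exists2 C : R, 0 < C & forall x, `|phi x| <= C.
Proof.
move=> tphi; apply: (@bounded_compact_support _ _ _ (closure [set x | phi x != 0])).
- exact: test_continuous.
- by case: tphi.
- by move=> x; exact: test_eq0.
Qed.

Lemma test_partial_bounded phi i : test_function phi ->
  exists2 C : R, 0 < C & forall x, `|partial i phi x| <= C.
Proof.
move=> tphi; apply: (@bounded_compact_support _ _ _ (closure [set x | phi x != 0])).
- exact: test_partial_continuous.
- by case: tphi.
- by move=> x; exact: partial_eq0.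
Qed.

Lemma test_support phi : test_function phi -> exists2 r : R, 0 < r &
  forall x, ~ ball 0 r x -> ~ closure [set x | phi x != 0] x.
Proof.
move=> [_ /compact_bounded[M [_ HM]]]; exists (`|M| + 2); first by rewrite ltr_pwDr.
move=> x nx Sx; apply: nx; rewrite -ball_normE /ball_/= sub0r normrN.
have := HM (`|M| + 1); rewrite (le_lt_trans (ler_norm _)) ?ltrDl// => /(_ isT x Sx)/=.
by move=> /le_lt_trans; apply; rewrite ltrD2l ltrDr.
Qed.

Lemma Ck_shift k phi h : Ck k phi -> Ck k (fun x => phi (x - h)).
Proof.
elim: k phi => [|k IH] phi Cphi; split => //.
- move=> x; apply: (@continuous_comp _ _ _ (fun x => x - h) phi).
    by apply: continuousB; [exact: cvg_id|exact: cst_continuous].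
  exact: (Ck_continuous Cphi).
- move=> x; apply: (@continuous_comp _ _ _ (fun x => x - h) phi).
    by apply: continuousB; [exact: cvg_id|exact: cst_continuous].
  exact: (Ck_continuous Cphi).
move=> i; have [_ /(_ i)[dphi Ci]] := Cphi; split.
  move=> x; apply/derivable_line.
  by under eq_fun do rewrite -addrA; apply/derivable_line.
rewrite (_ : partial i _ = fun x => partial i phi (x - h)); first exact: IH.
by apply/funext => x; rewrite !partialE; under eq_fun do rewrite -addrA.
Qed.

Lemma partial_shift phi h i : partial i (fun x => phi (x - h)) = fun x => partial i phi (x - h).
Proof.
by apply/funext => x; rewrite !partialE; under eq_fun do rewrite -addrA.
Qed.

Lemma test_shift phi h : test_function phi -> test_function (fun x => phi (x - h)).
Proof.
move=> tphi; have [r r0 Hr] := test_support tphi.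
apply: (@test_functionP _ _ _ (`|h| + r)); first by move=> k; apply: Ck_shift; case: tphi.
move=> y ny; apply: test_eq0; apply: Hr => yr; apply: ny; apply: (@ball_sub0 _ _ h r).
by move: yr; rewrite -!ball_normE /ball_/= sub0r normrN distrC.
Qed.

Lemma is_derive_translate phi i y (t : R) : test_function phi ->
  is_derive t 1 (fun s => phi (y - s *: delta_mx ord0 i))
    (- partial i phi (y - t *: delta_mx ord0 i)).
Proof.
move=> tphi; set e : Rn := delta_mx ord0 i.
pose g s := phi (s *: e + (y - t *: e)).
have dg : is_derive (0 : R) 1 g (partial i phi (y - t *: e)).
  apply: DeriveDef; last by rewrite partialE.
  by apply/derivable_line; exact: test_derivable.
have -> : (fun s => phi (y - s *: e)) = g \o (fun s => t - s).
  apply/funext => s; rewrite /g /=; congr phi.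
  by rewrite scalerBl [RHS]addrC subrKA.
have dl : is_derive t 1 (fun s : R => t - s) (-1).
  by apply: is_derive_eq; rewrite add0r mul1r.
have dg' : is_derive (t - t) 1 g (partial i phi (y - t *: e)) by rewrite subrr.
have := @is_derive1_comp R g (fun s => t - s) t _ _ dg' dl.
by rewrite mulrN1.
Qed.

Lemma measurable_translate phi h : continuous phi -> measurable_fun setT (fun y => phi (y - h)).
Proof.
move=> cphi; apply: continuous_measurable_rV => x.
apply: (@continuous_comp _ _ _ (fun x => x - h) phi); last exact: cphi.
by apply: continuousB; [exact: cvg_id|exact: cst_continuous].
Qed.

Lemma L1_mul_test u phi h : L1 u -> test_function phi -> L1 (fun y => u y * phi (y - h)).
Proof.
move=> iu tphi; have [C C0 HC] := test_bounded tphi.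
apply: (@integrable_mul_bounded _ _ _ _ _ _ _ C) => //.
  by apply: measurable_translate; exact: test_continuous.
Qed.

Lemma L1_mul_partial u phi i h : L1 u -> test_function phi ->
  L1 (fun y => u y * partial i phi (y - h)).
Proof.
move=> iu tphi; have [C C0 HC] := test_partial_bounded i tphi.
apply: (@integrable_mul_bounded _ _ _ _ _ _ _ C) => //.
  by apply: measurable_translate; exact: test_partial_continuous.
Qed.

(** Differentiation under the integral sign, dominated by [|u|] times a bound of the partial
    derivative. It serves both [int_partial_eq0] and the mean value argument for translations. *)
Lemma is_derive_convolution u phi i (t : R) : L1 u -> test_function phi ->
  is_derive t 1 (fun s => \int[L]_y (u y * phi (y - s *: delta_mx ord0 i)))
    (- \int[L]_y (u y * partial i phi (y - t *: delta_mx ord0 i))).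
Proof.
move=> iu tphi; set e : Rn := delta_mx ord0 i.
have [C C0 HC] := test_partial_bounded i tphi.
pose F s y := u y * phi (y - s *: e).
have It : `]t - 1, t + 1[%classic t by rewrite /= in_itv/= ltrBlDr !ltrDl ltr01.
have dF (s : R) y : is_derive s 1 (F ^~ y) (- (u y * partial i phi (y - s *: e))).
  have := is_derive_translate i y s tphi => H.
  apply: (is_derive_eq (is_deriveZ (u y) H)).
  by rewrite /GRing.scale/= mulrN.
have intF s : `]t - 1, t + 1[%classic s -> L.-integrable setT (EFin \o F s).
  by move=> _; exact: L1_mul_test.
have derF s y : `]t - 1, t + 1[%classic s -> setT y -> derivable (F ^~ y) s 1.
  by move=> _ _; have [] := dF s y.
have G0 y : 0 <= `|u y| * C by rewrite mulr_ge0// ltW.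
have intG : L.-integrable setT (EFin \o (fun y => `|u y| * C)).
  apply: (@integrable_mul_bounded _ _ _ _ _ (fun y => `|u y|) (cst C) C) => //.
    exact: integrable_norm.
  by move=> x _; rewrite ger0_norm// ltW.
have Gub s y : `]t - 1, t + 1[%classic s -> setT y -> `|partial1of2 F s y| <= `|u y| * C.
  move=> _ _; rewrite partial1of2E; have [_ ->] := dF s y.
  by rewrite normrN normrM ler_wpM2l.
apply: DeriveDef.
  exact: (derivable_under_integral measurableT It intF derF G0 intG Gub).
have := differentiation_under_integral measurableT It intF derF G0 intG Gub.
rewrite derive1E => ->.
have : L1 (fun y => u y * partial i phi (y - t *: e)) by exact: L1_mul_partial.
move=> /(RintegralZl (-1) measurableT); rewrite mulN1r => <-.
apply: eq_Rintegral => y _; rewrite partial1of2E; have [_ ->] := dF t y.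
by rewrite mulN1r.
Qed.

Lemma L1_indic (A : set Rn) : measurable A -> (L A < +oo)%E -> L1 (\1_A : Rn -> R).
Proof.
move=> mA Aoo; rewrite /L1.
have : L.-integrable A (EFin \o cst (1 : R)).
  by apply: (@integrable_bounded_set _ _ _ _ _ _ 1) => // x _; rewrite normr1.
move=> /(integrable_mkcond _ mA); apply: eq_integrable => // x _.
by rewrite patchE /= indicE; case: ifP.
Qed.

(* [\int phi (y - s e_i) dy] does not depend on [s]. *)
Lemma int_partial_eq0 phi i : test_function phi -> \int[L]_y partial i phi y = 0.
Proof.
move=> tphi; set e : Rn := delta_mx ord0 i.
have [r r0 Hr] := test_support tphi.
(* [is_derive_convolution] asks for an integrable weight, so the constant 1 is replaced by the
   indicator of a cube exceeding the support by 1; translations with [|s| < 1] stay inside it. *)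
pose A : set Rn := ball 0 (r + 1).
have r10 : 0 < r + 1 by rewrite addr_gt0.
have mA : measurable A by exact: measurable_rV_ball.
have iA : L1 (\1_A : Rn -> R) by apply: L1_indic => //; rewrite lebesgue_rV_ball// ltry.
have e1 : `|e| <= 1.
  rewrite [leLHS]mx_normrE; apply: bigmax_le => //= -[a b] _ /=; rewrite mxE.
  by rewrite normr_nat lern1 leq_b1.
have [_] := is_derive_convolution i 0 iA tphi.
have near_cst : \forall s \near (0 : R), \int[L]_y (\1_A y * phi (y - s *: e)) =
    cst (\int[L]_y phi y) s.
  apply/nbhs_ballP; exists 1 => //= s; rewrite /ball/= sub0r normrN => s1.
  rewrite -[RHS](Rintegral_translation (- (s *: e))); last first.
    by apply: continuous_measurable_rV; exact: test_continuous.
  apply: eq_Rintegral => y _; rewrite indicE.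
  have [|nyA] := boolP (y \in A); rewrite ?mul1r// mul0r.
  rewrite test_eq0//; apply: Hr => ys; move/negP: nyA; apply; apply/mem_set.
  move: ys; rewrite /A -!ball_normE /ball_/= !sub0r !normrN => ys.
  rewrite -[y](subrK (s *: e)) (le_lt_trans (ler_normD _ _))// ltr_leD//.
  by rewrite normrZ mulr_ile1// ltW.
rewrite (near_eq_derive _ near_cst) derive_cst => /esym/eqP; rewrite oppr_eq0 => /eqP H.
rewrite -[RHS]H; apply: eq_Rintegral => y _; rewrite scale0r subr0 indicE.
have [|nyA] := boolP (y \in A); rewrite ?mul1r// mul0r partial_eq0//.
apply: Hr => yr; move/negP: nyA; apply; apply/mem_set.
by apply: le_ball yr; rewrite lerDl.
Qed.

End test_functions.

(** * Lower semicontinuity of the oscillation *)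

Section enorm_triangle.
Context {R : realType} {n : nat}.
Local Notation Rn := 'rV[R]_n.
Local Notation L := (lebesgue_rV R n).
Implicit Types (x y : Rn) (r : R).

Lemma enorm_ge0 x : 0 <= enorm x. Proof. exact: sqrtr_ge0. Qed.

Lemma enorm_sqr x : enorm x ^+ 2 = \sum_i x ord0 i ^+ 2.
Proof. by rewrite sqr_sqrtr// sumr_ge0// => i _; rewrite sqr_ge0. Qed.

Lemma enormN x : enorm (- x) = enorm x.
Proof. by congr Num.sqrt; apply: eq_bigr => i _; rewrite mxE sqrrN. Qed.

Lemma enorm_eq0 x : enorm x = 0 -> x = 0.
Proof.
move=> x0; have := norm_le_enorm x; rewrite x0 => ?.
by apply/eqP; rewrite -normr_le0.
Qed.

Lemma enormD x y : enorm (x + y) <= enorm x + enorm y.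
Proof.
have [->|x0] := eqVneq x 0; first by rewrite add0r lerDr enorm_ge0.
have [->|y0] := eqVneq y 0; first by rewrite addr0 lerDl enorm_ge0.
have ex : 0 < enorm x.
  by rewrite lt_neqAle enorm_ge0 andbT eq_sym; apply: contra_neq x0 => /enorm_eq0.
have ey : 0 < enorm y.
  by rewrite lt_neqAle enorm_ge0 andbT eq_sym; apply: contra_neq y0 => /enorm_eq0.
(* Cauchy-Schwarz, by summing [(enorm y * x_i - enorm x * y_i) ^+ 2 >= 0] over i. *)
have xy : \sum_i x ord0 i * y ord0 i <= enorm x * enorm y.
  rewrite -(@ler_pM2l _ (2 * (enorm x * enorm y))); last by rewrite !mulr_gt0.
  rewrite mulr_sumr.
  apply: (@le_trans _ _ (\sum_i ((enorm y ^+ 2 * x ord0 i ^+ 2) +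
                                 (enorm x ^+ 2 * y ord0 i ^+ 2)))).
    apply: ler_sum => i _; rewrite -subr_ge0.
    rewrite (_ : _ - _ = (enorm y * x ord0 i - enorm x * y ord0 i) ^+ 2) ?sqr_ge0//.
    ring.
  rewrite big_split/= -!mulr_sumr -!enorm_sqr.
  by rewrite le_eqVlt; apply/orP; left; apply/eqP; ring.
rewrite -[leRHS]ger0_norm ?addr_ge0 ?enorm_ge0// -sqrtr_sqr ler_wsqrtr// sqrrD.
rewrite (eq_bigr (fun i => x ord0 i ^+ 2 + 2 * (x ord0 i * y ord0 i) + y ord0 i ^+ 2)).
  by rewrite !big_split/= -!enorm_sqr lerD2r lerD2l -mulr_sumr -[leRHS]mulr_natl ler_pM2l.
by move=> i _; rewrite mxE sqrrD mulr_natl.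
Qed.

Lemma lebesgue_eball_lty x r : (L (eball x r) < +oo)%E.
Proof.
have [r0|r0] := ltP 0 r.
  apply: (@le_lt_trans _ _ (L (ball x r))); last by rewrite lebesgue_rV_ball// ltry.
  by apply: le_measure; rewrite ?inE; [exact: measurable_eball|exact: measurable_rV_ball|exact: eball_sub_ball].
rewrite (_ : eball x r = set0) ?measure0// -subset0 => y; rewrite /eball/= => H.
by have := le_lt_trans (enorm_ge0 _) H; rewrite ltNge r0.
Qed.

Lemma lebesgue_eball_gt0 x r : (0 < n)%N -> 0 < r -> (0 < L (eball x r))%E.
Proof.
move=> n0 r0; have rn : 0 < r / n%:R by rewrite divr_gt0// ltr0n.
apply: (@lt_le_trans _ _ (L (ball x (r / n%:R)))).
  by rewrite lebesgue_rV_ball// lte_fin exprn_gt0// mulr_gt0.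
apply: le_measure; rewrite ?inE; [exact: measurable_rV_ball|exact: measurable_eball|].
apply: subset_trans (@ball_sub_eball _ _ x (r / n%:R) n0) _.
by rewrite mulrC divfK// pnatr_eq0 -lt0n.
Qed.

(* The balls [B(y, r - |y - x|)] are contained in [B(x, r)] and exhaust it as [y]
   tends to [x], so no regularity of the sphere is needed for semicontinuity. *)
Lemma eball_subset x y r : eball y (r - enorm (y - x)) `<=` eball x r.
Proof.
move=> z; rewrite /eball/= ltrBrDr; apply: le_lt_trans.
by rewrite (le_trans _ (enormD _ _))// subrKA.
Qed.

(** If [enorm (y - x)] is below 1/(k+1), the smaller ball contains the one centred at [x] of radius
    r - 2/(k+1), and these exhaust the open ball of radius r. *)
Lemma eball_setD_small x r (e : R) : 0 < e ->
  \forall y \near x, (L (eball x r `\` eball y (r - enorm (y - x))) < e%:E)%E.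
Proof.
move=> e0; pose D k := eball x r `\` eball x (r - 2 * k.+1%:R^-1).
have mD k : measurable (D k) by apply: measurableD; exact: measurable_eball.
have D0 : \bigcap_k D k = set0.
  rewrite -subset0 => y Hy; have [yr _] := Hy 0%N I.
  have : 0 < (r - enorm (y - x)) / 2 by rewrite divr_gt0// subr_gt0.
  move=> d0; have [k _ kd] := near_infty_natSinv_lt (PosNum d0).
  have [_] := Hy k I; apply; rewrite /eball/= ltrBrDl -ltrBrDr.
  by rewrite -ltr_pdivlMl// mulrC; apply: (kd k) => /=.
have : L (D k) @[k --> \oo] --> L (\bigcap_k D k).
  apply: nonincreasing_cvg_mu => //.
  - apply: le_lt_trans (lebesgue_eball_lty x r); apply: le_measure; rewrite ?inE//.
      exact: measurable_eball.
    exact: subDsetl.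
  - by rewrite D0.
  - move=> i j ij; apply/subsetPset => y [yr nj]; split => // yi; apply: nj.
    move: yi; rewrite /eball/= => /lt_le_trans; apply.
    by rewrite lerD2l lerN2 ler_pM2l// lef_pV2 ?posrE// ler_nat ltnS.
rewrite D0 measure0 => /(_ [set z | (z < e%:E)%E]) [].
  by apply: open_ereal_lt'; rewrite lte_fin.
move=> k _ /(_ k (leqnn k)) /= Dk.
have : \forall y \near x, enorm (y - x) < k.+1%:R^-1.
  have : enorm (y - x) @[y --> x] --> enorm (x - x).
    apply: (@continuous_comp _ _ _ (fun y => y - x) (@enorm R n)); last exact: enorm_continuous.
    by apply: continuousB; [exact: cvg_id|exact: cst_continuous].
  rewrite subrr (_ : enorm 0 = 0); last first.
    by rewrite /enorm big1 ?sqrtr0// => i _; rewrite mxE expr0n.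
  by move=> /cvgr_lt/(_ _ _); apply.
apply: filterS => y yk; apply: le_lt_trans Dk; apply: le_measure; rewrite ?inE//.
  by apply: measurableD; exact: measurable_eball.
move=> z [zr nz]; split => // zx; apply: nz; move: zx; rewrite /eball/= => zx.
have -> : z - y = (z - x) + (x - y) by rewrite subrKA.
rewrite (le_lt_trans (enormD _ _))//.
rewrite -[X in _ + X < _]enormN opprB.
move: zx yk; move: (k.+1%:R^-1 : R) (enorm (z - x)) (enorm (y - x)) => q s t zx yk.
lra.
Qed.

(** The two integrals differ by an integral over the set of [eball_setD_small], which is small by
    absolute continuity. *)
Lemma cvg_Rintegral_eball x r (g : Rn -> R) : L.-integrable (eball x r) (EFin \o g) ->
  \int[L]_(z in eball y (r - enorm (y - x))) g z @[y --> x] -->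
  \int[L]_(z in eball x r) g z.
Proof.
move=> ig; set B := eball x r; pose G : Rn -> R := g \_ B.
have mB y s : measurable (eball y s) by exact: measurable_eball.
have iG : L1 G.
  have /(integrable_mkcond _ (mB x r)) := ig.
  by rewrite /L1; apply: eq_integrable => // z _; rewrite /G /= !patchE; case: ifP.
have FF : Filter (nbhs x) by exact: nbhs_filter.
apply/(@cvgrPdist_lt _ _ _ _ FF) => e e0.
have [d [d0 Hd]] := integral_normr_continuous iG e0.
have := eball_setD_small x r d0; apply: filterS => y yd.
set B' := eball y (r - enorm (y - x)) in yd *.
have B'B : B' `<=` B by exact: eball_subset.
have mD : measurable (B `\` B') by apply: measurableD; exact: mB.
have BU : B = B' `|` (B `\` B') by rewrite setDUK.
have -> : \int[L]_(z in B) g z = \int[L]_(z in B') g z + \int[L]_(z in B `\` B') g z.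
  rewrite {1}BU Rintegral_setU//; [exact: mB|by rewrite -BU|].
  by apply/disj_setPS => z [B'z [_ ]].
rewrite addrC addKr.
have iD : L.-integrable (B `\` B') (EFin \o g).
  by apply: integrableS ig.
rewrite (le_lt_trans (le_normr_Rintegral mD iD))//.
apply: le_lt_trans (Hd _ mD yd).
rewrite le_eqVlt; apply/orP; left; apply/eqP; apply: eq_Rintegral => z /set_mem[Bz _].
by rewrite /G patchE mem_set.
Qed.

Lemma integrable_eball_cst x r (c : R) : L.-integrable (eball x r) (EFin \o cst c).
Proof.
apply: (@integrable_bounded_set _ _ _ _ _ _ `|c|) => //; first exact: measurable_eball.
exact: lebesgue_eball_lty.
Qed.

Lemma integrable_eball_dist x r (f : Rn -> R) (c : R) : L1 f ->
  L.-integrable (eball x r) (EFin \o (fun y => `|f y - c|)).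
Proof.
move=> f1; apply: (@integrable_norm _ _ _ _ _ (fun y => f y - c)).
have : L.-integrable (eball x r) (fun y => ((f y)%:E - (cst c y)%:E)%E).
  apply: integrableB; first exact: measurable_eball.
    by apply: integrableS f1 => //; exact: measurable_eball.
  exact: integrable_eball_cst.
by apply: eq_integrable => //; exact: measurable_eball.
Qed.

(** Take a radius r that beats [l] at [x]. The mean oscillation on the ball centred at [y] of radius
    r - |y - x|, divided by that radius, is continuous in [y] at [x], hence still beats [l] for [y]
    near [x]. *)
Lemma open_oscillation_sup (f : Rn -> R) (l : R) : (0 < n)%N -> L1 f ->
  open [set x | (l%:E < oscillation_sup f x)%E].
Proof.
move=> n0 f1; rewrite openE => x /= /ereal_sup_gt[_ [r /= r0 <-]]; rewrite lte_fin => lr.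
rewrite /interior.
pose rho y := r - enorm (y - x).
pose V y := fine (L (eball y (rho y))).
pose a y := average f y (rho y).
have rhox : rho x = r.
  rewrite /rho subrr (_ : enorm 0 = 0) ?subr0//.
  by rewrite /enorm big1 ?sqrtr0// => i _; rewrite mxE expr0n.
have cvg_rho : rho y @[y --> x] --> rho x.
  apply: (@continuousB _ _ _ (cst r) (fun y => enorm (y - x))); first exact: cst_continuous.
  apply: (@continuous_comp _ _ _ (fun y => y - x) (@enorm R n)); last exact: enorm_continuous.
  by apply: continuousB; [exact: cvg_id|exact: cst_continuous].
have VE y : V y = \int[L]_(z in eball y (rho y)) (cst 1 z).
  by rewrite Rintegral_cst ?mul1r//; exact: measurable_eball.
have cvg_V : V y @[y --> x] --> V x.
  under eq_fun do rewrite VE; rewrite VE rhox.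
  exact: (cvg_Rintegral_eball (integrable_eball_cst x r 1)).
have Vx0 : 0 < V x.
  by rewrite /V rhox fine_gt0// lebesgue_eball_gt0//= lebesgue_eball_lty.
have FF : Filter (nbhs x) by exact: nbhs_filter.
have cvg_Vinv : (V y)^-1 @[y --> x] --> (V x)^-1.
  exact: (@cvgV _ _ (nbhs x) FF _ _ (lt0r_neq0 Vx0) cvg_V).
have cvg_a : a y @[y --> x] --> a x.
  apply: cvgM; first exact: cvg_Vinv.
  rewrite rhox; apply: cvg_Rintegral_eball; apply: integrableS f1 => //.
  exact: measurable_eball.
(* The subtracted mean also moves with [y]: [J] freezes it at [a x], and replacing it by [a y] costs
   at most [|a y - a x| * V y]. *)
pose J y := \int[L]_(z in eball y (rho y)) `|f z - a x|.
pose W y := \int[L]_(z in eball y (rho y)) `|f z - a y|.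
have cvg_J : J y @[y --> x] --> J x.
  by rewrite /J rhox; apply: cvg_Rintegral_eball; exact: integrable_eball_dist.
have WJ y : `|W y - J y| <= `|a y - a x| * V y.
  have mB := measurable_eball y (rho y).
  rewrite /W /J -RintegralB//; try exact: integrable_eball_dist.
  apply: le_trans (le_normr_Rintegral mB _) _.
    have : L.-integrable (eball y (rho y)) (fun z => (`|f z - a y|%:E - `|f z - a x|%:E)%E).
      by apply: integrableB => //; exact: integrable_eball_dist.
    by apply: eq_integrable.
  rewrite VE -RintegralZl//; last exact: integrable_eball_cst.
  apply: le_Rintegral => //.
  - apply: (@integrable_norm _ _ _ _ _ (fun z => `|f z - a y| - `|f z - a x|)).
    have : L.-integrable (eball y (rho y)) (fun z => (`|f z - a y|%:E - `|f z - a x|%:E)%E).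
      by apply: integrableB => //; exact: integrable_eball_dist.
    by apply: eq_integrable.
  - rewrite (_ : (EFin \o _) = EFin \o cst (`|a y - a x|)); first exact: integrable_eball_cst.
    by apply/funext => z /=; rewrite mulr1.
  - move=> z _; rewrite mulr1 (le_trans (ler_dist_dist _ _))//.
    by rewrite opprB addrC subrKA distrC.
have cvg_WJ : (W y - J y) @[y --> x] --> (0 : R).
  apply: norm_cvg0; apply: (@squeeze_cvgr _ _ _ _ (cst 0) (fun y => `|a y - a x| * V y)).
  - by apply: nearW => y; rewrite normr_ge0/= WJ.
  - exact: cvg_cst.
  - rewrite -(mul0r (V x)); apply: cvgM => //.
    have /subr_cvg0/cvg_norm := cvg_a.
    by rewrite normr0.
have cvg_W : W y @[y --> x] --> W x.
  have -> : W x = 0 + J x by rewrite add0r.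
  have -> : W = (fun y => (W y - J y) + J y) by apply/funext => y; rewrite subrK.
  exact: cvgD.
have rx : 0 < rho x by rewrite rhox.
have cvg_all : ((rho y)^-1 * ((V y)^-1 * W y)) @[y --> x] --> ((rho x)^-1 * ((V x)^-1 * W x)).
  apply: cvgM; first exact: (@cvgV _ _ (nbhs x) FF _ _ (lt0r_neq0 rx) cvg_rho).
  by apply: cvgM => //; exact: cvg_Vinv.
have lx : l < (rho x)^-1 * ((V x)^-1 * W x) by rewrite /V /W /a rhox.
near=> y.
have : l < (rho y)^-1 * ((V y)^-1 * W y) by near: y; exact: cvgr_gt cvg_all _ lx.
rewrite /= -lte_fin => /lt_le_trans; apply.
apply: ereal_sup_ubound; exists (rho y) => //=.
by near: y; exact: cvgr_gt cvg_rho _ rx.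
Unshelve. all: by end_near. Qed.

End enorm_triangle.

(** * The lower bound *)

Section lower_bound.
Context {R : realType} {n : nat}.
Local Notation Rn := 'rV[R]_n.
Local Notation L := (lebesgue_rV R n).
Implicit Types (f : Rn -> R) (x y : Rn) (i : 'I_n).

Lemma closure_bump_support x (r : R) : 0 < r ->
  closure [set z | rV_bump x r z != 0] `<=` [set z | `|x - z| <= 2 * r].
Proof.
move=> r0 z.
have cB : closed [set z : Rn | `|x - z| <= 2 * r].
  rewrite (_ : [set z | _] = (fun z : Rn => `|x - z|) @^-1` [set t | t <= 2 * r])//.
  apply: preimage_closed; last exact: closed_le.
  move=> y _; apply: (@continuous_comp _ _ _ (fun z : Rn => x - z) (fun v : Rn => `|v|)).
    by apply: continuousB; [exact: cst_continuous|exact: cvg_id].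
  exact: norm_continuous.
move=> Hz; have : closure [set z | `|x - z| <= 2 * r] z.
  apply: closure_subset Hz => y /= /eqP; apply: contra_notP => /negP.
  rewrite -ltNge => xy; apply: bump_eq0 => //.
  by rewrite -ball_normE /ball_/= => yx; rewrite ltNge ltW in xy.
by rewrite -(closure_id _).1.
Qed.

Lemma oscillation_sup_ge : (0 < n)%N -> exists2 c : R, 0 < c &
  forall f i x (r : R) y, L1 f -> 0 < r -> ball x (2 * r) y ->
  ((c / r ^+ n * `|\int[L]_z (f z * partial i (rV_bump x r) z)|)%:E <=
    oscillation_sup f y)%E.
Proof.
move=> n0; have [C C0 HC] := @bump_partial_bound R n.
have nR : 0 < n%:R :> R by rewrite ltr0n.
(* With [rho = 4 n r]: the first factor is [r / rho], the second bounds [r ^+ n] over the volume of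
   the ball, at most [(2 * rho) ^+ n], and [1 / C] comes from the gradient bound [C / r]. *)
exists ((4 * n%:R)^-1 * (8 * n%:R) ^- n / C).
  by rewrite !mulr_gt0 ?invr_gt0 ?exprn_gt0 ?mulr_gt0.
move=> f i x r y f1 r0 xy.
(* The bump is supported within 2r of [x], itself within 2r of [y]: the support lies in the cube of
   half-side 4r at [y], hence in the Euclidean ball of radius 4nr. *)
pose rho := 4 * n%:R * r; have rho0 : 0 < rho by rewrite !mulr_gt0.
pose B := eball y rho; pose a := average f y rho.
have mB : measurable B by exact: measurable_eball.
have tb := test_bump x r0.
have supp z : ~ B z -> partial i (rV_bump x r) z = 0.
  move=> nBz; apply: partial_eq0 => /(closure_bump_support r0)/= xz; apply: nBz.
  have -> : B = eball y (n%:R * (4 * r)) by rewrite /B /rho mulrCA mulrA.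
  apply: ball_sub_eball => //; move: xy; rewrite -!ball_normE /ball_/= => xy.
  have yx : `|y - x| < 2 * r by rewrite distrC.
  rewrite -(subrKA x) (le_lt_trans (ler_normD _ _))//.
  move: xz yx; move: `|x - z| `|y - x| => s t; lra.
have ipb : L1 (partial i (rV_bump x r)).
  rewrite /L1; have [D D0 HD] := test_partial_bounded i tb.
  apply: (@le_integrable _ _ _ _ _ _ _ (fun z => ((D * \1_B z)%:E)%E)) => //.
  - apply/measurable_EFinP; apply: continuous_measurable_rV.
    exact: test_partial_continuous.
  - move=> z _; rewrite /= lee_fin indicE; have [Bz|nBz] := boolP (z \in B).
      by rewrite mulr1 (le_trans (HD z))// ler_norm.
    by rewrite supp ?normr0 ?normr_ge0//; apply/negP; rewrite notin_setE in nBz; apply/negP.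
  - have := L1_indic mB (lebesgue_eball_lty y rho) => /(integrableZl measurableT D).
    by apply: eq_integrable => // z _; rewrite EFinM.
have ifb : L1 (fun z => f z * partial i (rV_bump x r) z).
  have [D D0 HD] := test_partial_bounded i tb.
  apply: (@integrable_mul_bounded _ _ _ _ _ _ _ D) => //.
  by apply: continuous_measurable_rV; exact: test_partial_continuous.
have ifab : L1 (fun z => (f z - a) * partial i (rV_bump x r) z).
  have := integrableB measurableT ifb (integrableZl measurableT a ipb).
  by apply: eq_integrable => // z _ /=; rewrite mulrBl.
have JE : \int[L]_z (f z * partial i (rV_bump x r) z) =
    \int[L]_z ((f z - a) * partial i (rV_bump x r) z).
  under [RHS]eq_Rintegral do rewrite mulrBl.
  rewrite RintegralB//; last first.
    by have := integrableZl measurableT a ipb; apply: eq_integrable.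
  by rewrite RintegralZl// int_partial_eq0// mulr0 subr0.
pose I := \int[L]_(z in B) `|f z - a|.
have I0 : 0 <= I by exact: Rintegral_ge0.
have JI : `|\int[L]_z (f z * partial i (rV_bump x r) z)| <= C / r * I.
  rewrite JE (le_trans (le_normr_Rintegral _ ifab))//.
  have -> : \int[L]_z `|(f z - a) * partial i (rV_bump x r) z| =
      \int[L]_(z in B) `|(f z - a) * partial i (rV_bump x r) z|.
    rewrite [RHS]Rintegral_mkcond; apply: eq_Rintegral => z _; rewrite patchE.
    case: ifPn => //; rewrite notin_setE => /supp ->.
    by rewrite mulr0 normr0.
  rewrite -RintegralZl//; last exact: integrable_eball_dist.
  apply: le_Rintegral => //.
  - by apply: integrableS (integrable_norm ifab).
  - by have := integrableZl mB (C / r) (integrable_eball_dist y rho a f1); apply: eq_integrable.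
  - by move=> z _; rewrite normrM mulrC ler_wpM2r// HC.
apply: (@le_trans _ _ (rho^-1 * average (fun z => `|f z - a|) y rho)%:E); last first.
  by apply: ereal_sup_ubound; exists rho.
rewrite lee_fin /average -/B -/I.
have V0 : 0 < fine (L B) by rewrite fine_gt0// lebesgue_eball_gt0//= lebesgue_eball_lty.
have VB : fine (L B) <= (2 * rho) ^+ n.
  rewrite -lee_fin fineK; last by rewrite ge0_fin_numE// lebesgue_eball_lty.
  rewrite -(lebesgue_rV_ball y rho0); apply: le_measure; rewrite ?inE//.
    exact: measurable_rV_ball.
  exact: eball_sub_ball.
apply: (@le_trans _ _ (rho^-1 * ((2 * rho) ^- n * I))); last first.
  by rewrite ler_wpM2l ?invr_ge0 ?(ltW rho0)// ler_wpM2r// lef_pV2// posrE exprn_gt0// mulr_gt0.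
have := JI; rewrite -(@ler_pM2l _ ((4 * n%:R)^-1 * (8 * n%:R) ^- n / C / r ^+ n)); last first.
  by rewrite !mulr_gt0 ?invr_gt0 ?exprn_gt0 ?mulr_gt0.
move=> /le_trans; apply; rewrite le_eqVlt; apply/orP; left; apply/eqP.
have -> : (2 * rho) ^+ n = (8 * n%:R) ^+ n * r ^+ n.
  by rewrite -exprMn; congr (_ ^+ n); rewrite /rho; ring.
have rn0 : 0 < r ^+ n by rewrite exprn_gt0.
have n80 : 0 < (8 * n%:R) ^+ n :> R by rewrite exprn_gt0// mulr_gt0.
rewrite /rho; move: ((8 * n%:R) ^+ n) (r ^+ n) n80 rn0 => X Y X0 Y0.
by field; rewrite !gt_eqF.
Qed.

Lemma bump_integral_ge (p : {finite_measure set Rn -> \bar R}) x (r : R) : 0 < r ->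
  @bump_min R n * fine (p (ball x r)) <= \int[p]_z rV_bump x r z.
Proof.
move=> r0; have mb := measurable_rV_ball x r.
rewrite -(Rintegral_cst p mb) -(Rintegral_indic_mul p _ mb).
have pfin : (p setT < +oo)%E by rewrite -ge0_fin_numE// fin_num_measure.
have mbump : measurable_fun setT (rV_bump x r).
  by apply: continuous_measurable_rV; apply: test_continuous; exact: test_bump.
apply: le_Rintegral => //.
- apply: (@integrable_mul_indic _ _ _ _ _ _ (cst (@bump_min R n))) => //.
  by apply: (@integrable_bounded_set _ _ _ _ _ _ `|@bump_min R n|).
- apply: (@integrable_bounded_set _ _ _ _ _ _ 1) => // z _.
  by rewrite ger0_norm ?bump_ge0 ?bump_le1.
- move=> z _; rewrite indicE; have [|] := boolP (z \in (ball x r : set Rn)).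
    by rewrite inE mulr1 => /(bump_lb r0).
  by rewrite mulr0 bump_ge0.
Qed.

Lemma bump_integral_le (p : {finite_measure set Rn -> \bar R}) x (r : R) : 0 < r ->
  \int[p]_z rV_bump x r z <= fine (p (ball x (2 * r))).
Proof.
move=> r0; have mb := measurable_rV_ball x (2 * r).
rewrite -[leRHS]mul1r -(Rintegral_cst p mb) -(Rintegral_indic_mul p _ mb).
have pfin : (p setT < +oo)%E by rewrite -ge0_fin_numE// fin_num_measure.
have mbump : measurable_fun setT (rV_bump x r).
  by apply: continuous_measurable_rV; apply: test_continuous; exact: test_bump.
apply: le_Rintegral => //.
- apply: (@integrable_bounded_set _ _ _ _ _ _ 1) => // z _.
  by rewrite ger0_norm ?bump_ge0 ?bump_le1.
- apply: (@integrable_mul_indic _ _ _ _ _ _ (cst (1 : R))) => //.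
  by apply: (@integrable_bounded_set _ _ _ _ _ _ 1) => // z _; rewrite normr1.
- move=> z _; rewrite indicE; have [|] := boolP (z \in (ball x (2 * r) : set Rn)).
    by rewrite mulr1 bump_le1.
  by rewrite mulr0 notin_setE => /(bump_eq0 r0) ->.
Qed.

(* [r] is the first radius [delta * 8^-k], [k >= 1], at which the density of
   [p] exceeds [mu], or at which the radius drops below [e]. *)
Lemma stopping_radius (p : {finite_measure set Rn -> \bar R}) x (delta mu e : R) :
  0 < delta -> 0 < e -> fine (p setT) < mu * delta ^+ n ->
  exists r : R, [/\ 0 < r, 2 * r <= delta,
    fine (p (ball x (8 * r))) <= mu * (8 * r) ^+ n &
    mu * r ^+ n < fine (p (ball x r)) \/ 2 * r <= e].
Proof.
move=> d0 e0 pmu; pose r k : R := delta * 8 ^- k.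
have r0 k : 0 < r k by rewrite mulr_gt0// invr_gt0 exprn_gt0.
pose P k := (0 < k)%N && ((mu * r k ^+ n < fine (p (ball x (r k)))) || (2 * r k <= e)).
have exP : exists k, P k.
  have [k _ ke] := near_infty_natSinv_lt (PosNum (divr_gt0 e0 (mulr_gt0 (@ltr0Sn R 1) d0))).
  exists k.+1; rewrite /P /=; apply/orP; right.
  have /ltW := ke k (leqnn k); rewrite /= => ke'.
  rewrite /r mulrA -ler_pdivlMl ?mulr_gt0// [leRHS]mulrC (le_trans _ ke')//.
  rewrite lef_pV2 ?posrE ?exprn_gt0// -natrX ler_nat.
  by rewrite (leq_trans (ltnW (ltn_expl k.+1 (isT : 1 < 8)%N))).
case: (ex_minnP exP) => -[|k]; first by rewrite /P ltnn.
rewrite /P /= => Pk mink; exists (r k.+1).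
have rS : 8 * r k.+1 = r k by rewrite /r exprS invfM mulrCA (mulrA 8) divff// mul1r.
have rd : r k <= delta.
  by rewrite /r -[leRHS]mulr1 ler_wpM2l ?(ltW d0)// invf_le1 ?exprn_gt0// exprn_ege1// ler1n.
split => //.
- by rewrite (le_trans _ rd)// -rS ler_wpM2r ?(ltW (r0 _))// ler_nat.
(* The previous scale [8 * r] was not selected, so its density is at most [mu]; for the first scale
   it equals [delta], where the total mass gives the bound. *)
- rewrite rS; case: k Pk mink rS rd => [|k] Pk mink rS rd.
    have -> : r 0%N = delta by rewrite /r expr0 invr1 mulr1.
    rewrite ltW// (le_lt_trans _ pmu)// fine_le ?fin_num_measure//.
      exact: measurable_rV_ball.
    by apply: le_measure; rewrite ?inE//; exact: measurable_rV_ball.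
  rewrite leNgt; apply/negP => H; have := mink k.+1; rewrite H/= => /(_ isT).
  by rewrite ltnn.
- by case/orP: Pk; [left|right].
Qed.

End lower_bound.

Section lower_bound_main.
Context {R : realType} {n : nat}.
Local Notation Rn := 'rV[R]_n.
Local Notation L := (lebesgue_rV R n).

Lemma nbhd_lebesgue_lty (K : set Rn) (e : R) : compact K -> (L (nbhd K e) < +oo)%E.
Proof.
move=> /compact_bounded[M [_ HM]].
have KM x : K x -> `|x| <= `|M| + 1.
  by apply: HM; rewrite (le_lt_trans (ler_norm _))// ltrDl.
apply: (@le_lt_trans _ _ (L (ball 0 (`|M| + 1 + `|e| + 1)))); last first.
  by rewrite lebesgue_rV_ball// ltry.
apply: le_measure; rewrite ?inE; [exact: measurable_nbhd|exact: measurable_rV_ball|].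
move=> y [x Kx xy]; apply: le_ball (ball_sub0 xy).
by have := KM x Kx; have := ler_norm e; lra.
Qed.

(** The inequality with an absolute value in the hypothesis on test functions lets [p] and [q]
    exchange roles. In the constant, 1/2 is lost to [q] on good cubes, and 2^n = 8^n / 4^n compares
    the cubes of half-side [8 * rad x], whose mass is controlled, with those of half-side
    [2 * rad x], which are disjoint. *)
Lemma oscillation_density (p q : {finite_measure set Rn -> \bar R})
    (A : set Rn) (f : Rn -> R) (i : 'I_n) (c1 : R) : (0 < n)%N -> L1 f ->
  0 < c1 ->
  (forall x (r : R) y, 0 < r -> ball x (2 * r) y ->
    ((c1 / r ^+ n * `|\int[L]_z (f z * partial i (rV_bump x r) z)|)%:E <=
     oscillation_sup f y)%E) ->
  (forall phi, test_function phi -> \int[p]_x phi x - \int[q]_x phi x <=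
     `|\int[L]_x (f x * partial i phi x)|) ->
  measurable A -> L A = 0%E -> q A = 0%E ->
  forall e : R, 0 < e -> exists l0 : R, forall l, l0 < l ->
    (((c1 * @bump_min R n / 2 / 2 ^+ n) * (fine (p A) - e))%:E <=
      l%:E * L [set x | (l%:E < oscillation_sup f x)%E])%E.
Proof.
move=> n0 f1 c10 osc distr mA LA qA e e0.
pose c0 := @bump_min R n; have c00 : 0 < c0 by exact: bump_min_gt0.
have pfin B : measurable B -> p B \is a fin_num by move=> mB; exact: fin_num_measure.
have qfin B : measurable B -> q B \is a fin_num by move=> mB; exact: fin_num_measure.
have poo : (p setT < +oo)%E by rewrite -ge0_fin_numE// pfin.
have mball x (r : R) : measurable (ball x r : set Rn) by exact: measurable_rV_ball.
(* [p (A \ K)], the null cubes and the cubes charged by [q] cost, respectively,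
   [e1], [2^n e1] and [2^n 4^n (2 / c0) e1]. *)
pose e1 := e / (1 + 2 ^+ n * (1 + 4 ^+ n * (2 / c0))).
have den0 : 0 < 1 + 2 ^+ n * (1 + 4 ^+ n * (2 / c0)).
  by rewrite addr_gt0// mulr_gt0 ?exprn_gt0// addr_gt0// !mulr_gt0 ?exprn_gt0// invr_gt0.
have e10 : 0 < e1 by rewrite divr_gt0.
have [K [cK KA pAK]] := compact_regular poo mA e10.
have mK : measurable K by exact: compact_measurable_rV.
have LK : L K = 0%E by apply: (subset_measure0 mK mA KA LA).
have qK : q K = 0%E by apply: (subset_measure0 mK mA KA qA).
have pK : fine (p A) - e1 <= fine (p K).
  rewrite lerBlDr -lee_fin EFinD !fineK ?pfin//.
  have -> : p A = (p K + p (A `\` K))%E.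
    rewrite -measureU//; [by rewrite setDUK|exact: measurableD|by rewrite setDIK].
  by rewrite leeD2l// ltW.
have qK1 : (q K < e1%:E)%E by rewrite qK lte_fin.
(* All radii will satisfy [2 * rad x <= delta], so the disjoint cubes together have [q]-mass below
   [e1], whatever [l] is. *)
have [||delta d0 qd] := @nbhd_measure _ _ q K 1 e1%:E (compact_closed_rV cK) ltr01.
- by rewrite -ge0_fin_numE// qfin//; exact: measurable_nbhd.
- exact: qK1.
(* This threshold makes [mu * delta ^+ n] exceed the total mass of [p], as [stopping_radius]
   requires; the summand 1 makes [mu] positive. Density [mu] is calibrated so that a good cube
   forces the oscillation above [l]. *)
exists (c1 * c0 / 2 * (1 + fine (p setT) / delta ^+ n)) => l ll.
pose mu := l / (c1 * c0 / 2).
have cc0 : 0 < c1 * c0 / 2 by rewrite !mulr_gt0.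
have lE : l = c1 * c0 / 2 * mu by rewrite /mu mulrC divfK// gt_eqF.
have mup : 1 + fine (p setT) / delta ^+ n < mu by rewrite ltr_pdivlMr// mulrC.
have mu0 : 0 < mu by apply: lt_trans mup; rewrite ltr_wpDr// divr_ge0 ?fine_ge0// exprn_ge0// ltW.
have pmu : fine (p setT) < mu * delta ^+ n.
  by rewrite -ltr_pdivrMr ?exprn_gt0// (lt_trans _ mup)// ltrDr.
have LK1 : (L K < (e1 / mu)%:E)%E by rewrite LK lte_fin divr_gt0.
(* Unlike [delta], this scale depends on [l]: cubes that reach it lie in a set of measure below
   [e1 / mu]. *)
have [e2 e20 Le2] : exists2 e2, 0 < e2 & (L (nbhd K e2) < (e1 / mu)%:E)%E.
  apply: (nbhd_measure (compact_closed_rV cK) ltr01).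
    exact: nbhd_lebesgue_lty.
  exact: LK1.
have /choice[rad Hrad] := fun x => @stopping_radius R n p x delta mu e2 d0 e20 pmu.
have rad0 x : 0 < rad x by case: (Hrad x).
have rad20 x : 0 < 2 * rad x by rewrite mulr_gt0.
have [D [uD DK tD KD]] := @vitali_compact R Rn (fun x => 2 * rad x) K cK (fun x _ => rad20 x).
have tDsub (P : pred Rn) : trivIset [set` seq.filter P D] (fun x => ball x (2 * rad x)).
  by apply: sub_trivIset tD => x /=; rewrite mem_filter => /andP[].
pose P x := fine (p (ball x (rad x))); pose Q x := fine (q (ball x (2 * rad x))).
have LB x : L (ball x (2 * rad x)) = (4 ^+ n * rad x ^+ n)%:E.
  rewrite lebesgue_rV_ball//; congr EFin; rewrite -exprMn; congr (_ ^+ n); ring.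
(* The tripled cubes have half-side [6 * rad x], below the scale [8 * rad x] at which the density of
   [p] is at most [mu]. *)
have H1 : fine (p K) <= mu * 8 ^+ n * \sum_(x <- D) rad x ^+ n.
  rewrite -lee_fin fineK ?pfin// mulr_sumr -sumEFin.
  apply: le_trans (measure_le_cover p mK (fun x => mball x (3 * (2 * rad x))) KD) _.
  apply: lee_sum => x _; rewrite -mulrA -exprMn.
  have [_ _ + _] := Hrad x; rewrite -lee_fin fineK ?pfin//; apply: le_trans.
  apply: le_measure; rewrite ?inE//; apply: le_ball.
  by move: (rad x) (rad0 x) => t t0; clear -t0; lra.
have H2 : \sum_(x <- D) Q x <= e1.
  rewrite -lee_fin -sumEFin.
  rewrite (eq_bigr (fun x => q (ball x (2 * rad x)))) => [|x _]; last by rewrite fineK ?qfin.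
  apply: le_trans (ltW qd).
  apply: measure_disjoint_le => //; first exact: measurable_nbhd.
  move=> x /DK Kx y xy; exists x => //; apply: le_ball xy.
  by case: (Hrad x).
pose S1 := \sum_(x <- seq.filter (fun x => 2 * rad x <= e2) D) rad x ^+ n.
have H3 : mu * 4 ^+ n * S1 <= e1.
  rewrite -mulrA -ler_pdivlMl// [leRHS]mulrC -lee_fin /S1 mulr_sumr -sumEFin.
  rewrite (eq_bigr (fun x => L (ball x (2 * rad x)))) => [|x _]; last by rewrite LB.
  apply: le_trans (ltW Le2).
  apply: measure_disjoint_le => //; [exact: measurable_nbhd|exact: filter_uniq|].
  move=> x; rewrite mem_filter => /andP[xe /DK Kx] y xy; exists x => //.
  exact: le_ball xy.
(* The second condition reads [Q x <= c0 / 2 * P x], so testing against the bump still leaves at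
   least [c0 / 2 * P x]. *)
pose good x := (mu * rad x ^+ n < P x) && (2 / c0 * Q x <= P x).
pose S2 := \sum_(x <- seq.filter good D) rad x ^+ n.
set T := L _.
have H4 : ((4 ^+ n * S2)%:E <= T)%E.
  rewrite /S2 mulr_sumr -sumEFin.
  rewrite (eq_bigr (fun x => L (ball x (2 * rad x)))) => [|x _]; last by rewrite LB.
  apply: measure_disjoint_le => //.
  - by apply: open_measurable_rV; exact: open_oscillation_sup.
  - exact: filter_uniq.
  - move=> x; rewrite mem_filter => /andP[/andP[g1 g2] xD] y xy /=.
    apply: lt_le_trans (osc _ _ _ (rad0 x) xy); rewrite lte_fin.
    have rn0 : 0 < rad x ^+ n by rewrite exprn_gt0.
    have := distr _ (test_bump x (rad0 x)); set J := `|_| => HJ.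
    have b1 := bump_integral_ge p x (rad0 x); have b2 := bump_integral_le q x (rad0 x).
    rewrite -/c0 -/(P x) in b1; rewrite -/(Q x) in b2.
    have HJ2 : c0 * P x - Q x <= J by clear -HJ b1 b2; lra.
    have Q2 : Q x <= c0 / 2 * P x.
      by rewrite -ler_pdivrMl ?divr_gt0// invf_div.
    rewrite lE [ltRHS]mulrAC ltr_pdivlMr//.
    have -> : c1 * c0 / 2 * mu * rad x ^+ n = c1 * (c0 / 2 * (mu * rad x ^+ n)) by ring.
    rewrite ltr_pM2l//; apply: (@lt_le_trans _ _ (c0 / 2 * P x)); last by clear -HJ2 Q2; lra.
    by rewrite ltr_pM2l// divr_gt0.
(* Cube by cube: it is small and counted in [S1], or it is good and counted in [S2], or
   [mu * rad x ^+ n < P x < 2 / c0 * Q x]. *)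
have H5 : mu * \sum_(x <- D) rad x ^+ n <= mu * S1 + 2 / c0 * (\sum_(x <- D) Q x) + mu * S2.
  rewrite /S1 /S2 !big_filter (big_mkcond (fun x => 2 * rad x <= e2)) (big_mkcond good)/= !mulr_sumr -!big_split/=.
  apply: ler_sum => x _.
  have rn0 : 0 <= mu * rad x ^+ n by rewrite mulr_ge0 ?ltW ?exprn_gt0.
  have Q0 : 0 <= 2 / c0 * Q x by rewrite mulr_ge0 ?divr_ge0 ?(ltW c00)// fine_ge0.
  rewrite /good; have [_ _ _ Hx] := Hrad x.
  case: ifPn => [_|xe]; first by case: ifP => _; clear -rn0 Q0; lra.
  case: Hx => [Hx|]; last by rewrite (negbTE xe).
  rewrite -/(P x) in Hx; rewrite Hx/=; case: ifPn => [_|]; first by clear -rn0 Q0; lra.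
  by rewrite -ltNge => HQ; clear -rn0 Hx HQ; lra.
have [->|Tfin] := eqVneq T +oo%E.
  by rewrite gt0_muley ?leey// lte_fin lE mulr_gt0.
have Tf : T \is a fin_num by rewrite ge0_fin_numE ?lt_neqAle ?Tfin ?leey// measure_ge0.
rewrite -(fineK Tf) -EFinM lee_fin; rewrite -(fineK Tf) lee_fin in H4.
rewrite -/c0 lE -mulrA -[leRHS]mulrA ler_pM2l//.
have H6 : mu * 4 ^+ n * S2 <= mu * fine T by rewrite -mulrA ler_pM2l.
apply: le_trans H6.
rewrite ler_pdivrMl ?exprn_gt0//.
have E8 : (8 : R) ^+ n = 2 ^+ n * 4 ^+ n by rewrite -exprMn; congr (_ ^+ n); ring.
have X4 : 0 < (4 : R) ^+ n by rewrite exprn_gt0.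
have X2 : 0 < (2 : R) ^+ n by rewrite exprn_gt0.
have c02 : 0 < 2 / c0 by rewrite divr_gt0.
have eE : e = e1 + 2 ^+ n * (e1 + 4 ^+ n * (2 / c0) * e1).
  by rewrite /e1; move: den0; move: (2 / c0) => t den0; field; rewrite gt_eqF.
have H7 : fine (p K) <= 2 ^+ n * (mu * 4 ^+ n * S1 + 4 ^+ n * (2 / c0) * (\sum_(x <- D) Q x) + mu * 4 ^+ n * S2).
  apply: (le_trans H1); rewrite E8.
  have := H5; rewrite -(ler_pM2l (mulr_gt0 X2 X4)) => H; apply: le_trans (le_trans _ H) _.
    by rewrite le_eqVlt; apply/orP; left; apply/eqP; ring.
  by rewrite le_eqVlt; apply/orP; left; apply/eqP; ring.
have H8 : 4 ^+ n * (2 / c0) * (\sum_(x <- D) Q x) <= 4 ^+ n * (2 / c0) * e1.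
  by rewrite ler_pM2l// mulr_gt0.
have H9 : 2 ^+ n * (mu * 4 ^+ n * S1 + 4 ^+ n * (2 / c0) * (\sum_(x <- D) Q x) + mu * 4 ^+ n * S2)
  <= 2 ^+ n * (e1 + 4 ^+ n * (2 / c0) * e1 + mu * 4 ^+ n * S2).
  by rewrite ler_pM2l// lerD2r lerD.
have := le_trans H7 H9; rewrite [X in _ <= X -> _]mulrDr => H10.
by rewrite eE; clear -pK H10; lra.
Qed.

Lemma limf_einf_pinfty_ge (h : R -> \bar R) (a : R) :
  (forall e : R, 0 < e -> exists l0 : R, forall l, l0 < l -> ((a - e)%:E <= h l)%E) ->
  (a%:E <= limf_einf h (pinfty_nbhs R))%E.
Proof.
move=> H; apply/lee_addgt0Pr => e e0; have [l0 Hl] := H e e0.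
rewrite -leeBlDr// -EFinB.
rewrite limf_einfE; apply: (@le_trans _ _ (ereal_inf (h @` [set l | l0 < l]))).
  by apply: le_ereal_inf_tmp => _ [l /= ll <-]; exact: Hl.
apply: ereal_sup_ubound; exists [set l | l0 < l] => //.
by exists l0; split; [exact: num_real|].
Qed.

End lower_bound_main.

(** * Translations and the Poincare inequality *)

Section L1_duality.
Context {R : realType} {n : nat}.
Local Notation Rn := 'rV[R]_n.
Local Notation L := (lebesgue_rV R n).

Lemma measurable_L1 (w : Rn -> R) : L1 w -> measurable_fun setT w.
Proof. by move=> /integrableP[/measurable_EFinP]. Qed.

Lemma L1_integrable (w : Rn -> R) (D : set Rn) : L1 w -> measurable D ->
  L.-integrable D (EFin \o w).
Proof. by move=> w1 mD; apply: integrableS w1. Qed.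

Lemma Rintegral_norm_subset (w : Rn -> R) (A B : set Rn) : measurable A -> measurable B ->
  L1 w -> A `<=` B -> \int[L]_(y in A) `|w y| <= \int[L]_(y in B) `|w y|.
Proof.
move=> mA mB w1 AB; have iw : L1 (fun y => `|w y|) by exact: integrable_norm.
rewrite -(Rintegral_indic_mul L _ mA) -(Rintegral_indic_mul L _ mB).
apply: le_Rintegral => //.
- exact: integrable_mul_indic.
- exact: integrable_mul_indic.
- move=> y _; rewrite ler_wpM2l// !indicE ler_nat.
  have [/set_mem/AB/mem_set ->//|//] := boolP (y \in A).
Qed.

(** Restricting Lebesgue measure to [D] makes it finite, so that [compact_regular] applies. *)
Lemma compact_regular_lebesgue (D A : set Rn) (e : R) : measurable D ->
  (L D < +oo)%E -> measurable A -> A `<=` D -> 0 < e ->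
  exists K : set Rn, [/\ compact K, K `<=` A & (L (A `\` K) < e%:E)%E].
Proof.
move=> mD Doo mA AD e0.
have moo : (mrestr L mD setT < +oo)%E by rewrite /mrestr setTI.
have [K [cK KA LK]] := compact_regular moo mA e0.
exists K; split => //; move: LK; rewrite /= /mrestr setIidl//.
by move=> x [/AD].
Qed.

(* The sign of [w] is approximated by the difference of two smooth Urysohn
   functions of compact subsets of [w > 0] and [w < 0]. *)
Lemma L1_dual (w : Rn -> R) (x : Rn) (r M : R) : 0 < r -> L1 w ->
  (forall phi, test_function phi -> (forall y, `|phi y| <= 1) ->
    (forall y, ~ ball x r y -> phi y = 0) -> \int[L]_y (w y * phi y) <= M) ->
  @bump_min R n * \int[L]_(y in ball x r) `|w y| <= M.
Proof.
move=> r0 w1 HM; set Q : set Rn := ball x r; set c0 := @bump_min R n.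
have oQ : open Q by exact: ball_open.
have mQ : measurable Q by exact: measurable_rV_ball.
have Qoo : (L Q < +oo)%E by rewrite lebesgue_rV_ball// ltry.
have mw : measurable_fun setT w by exact: measurable_L1.
have c00 : 0 <= c0 by rewrite ltW// bump_min_gt0.
apply/ler_addgt0Pr => e e0.
have e4 : 0 < e / 2 by rewrite divr_gt0.
have [d [d0 Hd]] := integral_normr_continuous w1 e4.
have d4 : 0 < d / 4 by rewrite divr_gt0.
(* The values 1 and -1 of [s] treat the two signs of [w] at once. *)
pose pos (s : R) : set Rn := Q `&` [set y | 0 < s * w y].
have mpos (s : R) : measurable (pos s).
  apply: measurableI => //; rewrite -[X in measurable X]setTI.
  rewrite (_ : [set y | _] = (fun y => s * w y) @^-1` `]0, +oo[%classic).
    have : measurable_fun setT (fun y => s * w y) by exact: measurable_funM.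
    by apply => //; exact: measurable_itv.
  by apply/seteqP; split => y /=; rewrite in_itv/= andbT.
have wpart (s : R) : exists K U, [/\ compact K, open U, K `<=` U, U `<=` Q &
    [/\ forall y, K y -> 0 < s * w y,
      (L (pos s `\` K) < (d / 4)%:E)%E &
      (L (U `\` K) < (d / 4)%:E)%E]].
  have [K [cK KA LK]] := compact_regular_lebesgue mQ Qoo (mpos s) (@subIsetl _ _ _) d4.
  have mK := compact_measurable_rV cK.
  have KQ : K `<=` Q by move=> y /KA[].
  have LKfin : L K \is a fin_num.
    rewrite ge0_fin_numE//; apply: le_lt_trans Qoo.
    by apply: le_measure; rewrite ?inE.
  have [|e2 e20 Le2] := @nbhd_measure _ _ L K 1 (L K + (d / 4)%:E)%E
      (compact_closed_rV cK) ltr01 (nbhd_lebesgue_lty 1 cK).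
    by rewrite lteDl// lte_fin.
  exists K, (nbhd K e2 `&` Q); split => //.
  - by apply: openI => //; exact: nbhd_open.
  - by move=> y Ky; split; [exact: nbhd_sub|exact: KQ].
  - split => //; first by move=> y /KA[].
    apply: (@le_lt_trans _ _ (L (nbhd K e2 `\` K))).
      apply: le_measure; rewrite ?inE.
      + by apply: measurableD => //; apply: measurableI => //; exact: measurable_nbhd.
      + by apply: measurableD => //; exact: measurable_nbhd.
      + by apply: setSD; exact: subIsetl.
    rewrite measureD//; [|exact: measurable_nbhd|].
    + rewrite setIidr; last exact: nbhd_sub.
      by rewrite lteBlDl.
    + by apply: lt_le_trans Le2 _; rewrite leey.
have [K1 [U1 [cK1 oU1 KU1 UQ1 [w1K1 LA1 LU1]]]] := wpart 1.
have [K2 [U2 [cK2 oU2 KU2 UQ2 [w2K2 LA2 LU2]]]] := wpart (-1).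
have Qball : Q `<=` ball 0 (`|x| + r) by exact: ball_sub0.
have [phi1 [t1 b1 l1 z1]] := smooth_urysohn cK1 oU1 KU1 (subset_trans UQ1 Qball).
have [phi2 [t2 b2 l2 z2]] := smooth_urysohn cK2 oU2 KU2 (subset_trans UQ2 Qball).
pose phi y := phi1 y + (-1) * phi2 y.
have phiE y : phi y = phi1 y - phi2 y by rewrite /phi mulN1r.
have phi0 y : ~ Q y -> phi y = 0.
  by move=> nQ; rewrite phiE z1 ?z2 ?subr0// => [/UQ2|/UQ1].
have tphi : test_function phi.
  apply: (@test_functionP _ _ _ (`|x| + r)).
    move=> k; apply: CkD; first by case: t1.
    by apply: CkM; [exact: Ck_cst|case: t2].
  by move=> y ny; apply: phi0 => /Qball.
have phi1le y : `|phi y| <= 1.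
  rewrite phiE ler_norml; have /andP[? ?] := b1 y; have /andP[? ?] := b2 y.
  by apply/andP; split; lra.
have mK1 := compact_measurable_rV cK1; have mK2 := compact_measurable_rV cK2.
have mU1 : measurable U1 by exact: open_measurable_rV.
have mU2 : measurable U2 by exact: open_measurable_rV.
(* Off [E], every point of [Q] with [w] nonzero lies in the compact set of its sign and outside the
   open set of the other sign. The four pieces share the measure [d]. *)
pose E := (pos 1 `\` K1) `|` (pos (-1) `\` K2)
  `|` (U1 `\` K1) `|` (U2 `\` K2).
have mE : measurable E by apply: measurableU; [apply: measurableU; [apply: measurableU|]|]; exact: measurableD.
have LE : (L E < d%:E)%E.
  apply: (@le_lt_trans _ _ (L (pos 1%R `\` K1) +
      L (pos (-1)%R `\` K2) + L (U1 `\` K1) + L (U2 `\` K2))%E).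
    have mD1 := measurableD (mpos 1) mK1; have mD2 := measurableD (mpos (-1)) mK2.
    have mD3 := measurableD mU1 mK1; have mD4 := measurableD mU2 mK2.
    apply: le_trans (measureU2 _ _ mD4) _; first by apply: measurableU; [exact: measurableU|].
    rewrite leeD2r//; apply: le_trans (measureU2 _ _ mD3) _; first exact: measurableU.
    by rewrite leeD2r//; exact: measureU2.
  have -> : d%:E = ((d / 4)%:E + (d / 4)%:E + (d / 4)%:E + (d / 4)%:E)%E.
    by rewrite -!EFinD; congr EFin; lra.
  by rewrite !lteD.
(* Off [E], [phi] has the sign of [w] and size at least [c0] wherever [w] is nonzero in [Q]. On [E]
   both [c0 * |w|] and [- w * phi] are at most [|w|], whence the factor 2 and the choice of
   [e / 2]. *)
have key y : c0 * (`|w y| * \1_Q y) <= w y * phi y + 2 * (`|w y| * \1_E y).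
  have IE : \1_E y = (y \in E)%:R :> R by rewrite indicE.
  have IQ : \1_Q y = (y \in Q)%:R :> R by rewrite indicE.
  have [yE|] := boolP (y \in E).
    rewrite IE yE mulr1.
    have c01 : c0 * (`|w y| * \1_Q y) <= `|w y|.
      have c1 : c0 <= 1 by rewrite /c0 /bump_min -exprM exprn_ile1 ?expR_ge0// -[leRHS]expR0 ler_expR.
      have /andP[i0 i1] : 0 <= (\1_Q y : R) <= 1 by rewrite IQ ler0n lern1 leq_b1.
      by rewrite mulrCA -[leRHS]mulr1 ler_wpM2l// mulr_ile1.
    have : `|w y * phi y| <= `|w y| by rewrite normrM -[leRHS]mulr1 ler_wpM2l.
    by rewrite ler_norml => /andP[]; lra.
  rewrite notin_setE => nE; rewrite IE memNset// !mulr0 addr0.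
  have [yQ|] := boolP (y \in Q); last first.
    by rewrite IQ notin_setE => nQ; rewrite memNset// !mulr0 phi0// mulr0.
  rewrite IQ yQ mulr1; move: yQ; rewrite inE => yQ.
  have [w0|w0|w0] := ltgtP 0 (w y).
  - have K1y : K1 y.
      apply: contrapT => nK; apply: nE; left; left; left; split => //; split => //=.
      by rewrite mul1r.
    have z2y : phi2 y = 0.
      apply: z2 => U2y; apply: nE; right; split => // K2y.
      by have := w2K2 y K2y; rewrite mulN1r oppr_gt0 ltNge ltW.
    rewrite phiE z2y subr0 (gtr0_norm w0) mulrC ler_pM2l//.
    exact: l1.
  - have K2y : K2 y.
      apply: contrapT => nK; apply: nE; left; left; right; split => //; split => //=.
      by rewrite mulN1r oppr_gt0.
    have z1y : phi1 y = 0.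
      apply: z1 => U1y; apply: nE; left; right; split => // K1y.
      by have := w1K1 y K1y; rewrite mul1r ltNge ltW.
    rewrite phiE z1y sub0r mulrN -mulNr (ltr0_norm w0) mulrC ler_pM2l ?oppr_gt0//.
    exact: l2.
  - by rewrite -w0 normr0 mulr0 mul0r.
have iw : L1 (fun y => `|w y|) by exact: integrable_norm.
have i1 : L1 (fun y => `|w y| * \1_Q y) by exact: integrable_mul_indic.
have i2 : L1 (fun y => w y * phi y).
  apply: (@integrable_mul_bounded _ _ _ _ _ _ _ 1) => //.
  by apply: continuous_measurable_rV; exact: test_continuous.
have i3 : L1 (fun y => `|w y| * \1_E y) by exact: integrable_mul_indic.
have i1c : L1 (fun y => c0 * (`|w y| * \1_Q y)).
  by have := integrableZl measurableT c0 i1; apply: eq_integrable.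
have i3c : L1 (fun y => 2 * (`|w y| * \1_E y)).
  by have := integrableZl measurableT 2 i3; apply: eq_integrable.
have i23 : L1 (fun y => w y * phi y + 2 * (`|w y| * \1_E y)).
  by have := integrableD measurableT i2 i3c; apply: eq_integrable.
have := le_Rintegral measurableT i1c i23 (fun y _ => key y).
rewrite RintegralZl// RintegralD// RintegralZl// !Rintegral_indic_mul// => /le_trans; apply.
have := HM phi tphi phi1le phi0; have := Hd E mE LE.
by move=> ? ?; lra.
Qed.

End L1_duality.

Section translation_estimate.
Context {R : realType} {n : nat}.
Local Notation Rn := 'rV[R]_n.
Local Notation L := (lebesgue_rV R n).

Lemma norm_delta_mx_le (i : 'I_n) : `|delta_mx ord0 i : Rn| <= 1.
Proof.
rewrite [leLHS]mx_normrE; apply: bigmax_le => //= -[a b] _ /=; rewrite mxE.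
by rewrite normr_nat lern1 leq_b1.
Qed.

Lemma ball_shift_subset (x h : Rn) (r s : R) : `|h| <= s -> ball (x + h) r `<=` ball x (r + s).
Proof.
move=> hs y; rewrite -!ball_normE /ball_/= => xy.
have -> : x - y = (x + h - y) - h by rewrite addrAC addrK.
by rewrite (le_lt_trans (ler_normB _ _))// ltr_leD.
Qed.

(* Mean value theorem for [s |-> \int f phi (. - s e_i)], whose derivative is
   [\int g phi (. - s e_i)]. *)
Lemma translation_estimate_coord (f g : Rn -> R) (i : 'I_n) (x : Rn) (r t : R) :
  0 < r -> L1 f -> L1 g ->
  (forall phi, test_function phi ->
    \int[L]_y (f y * partial i phi y) = - \int[L]_y (g y * phi y)) ->
  @bump_min R n * \int[L]_(y in ball x r) `|f (y + t *: delta_mx ord0 i) - f y| <=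
  `|t| * \int[L]_(y in ball x (r + `|t|)) `|g y|.
Proof.
move=> r0 f1 g1 fg; set e : Rn := delta_mx ord0 i.
have ft1 : L1 (fun y => f (y + t *: e)) by exact: L1_translation.
have w1 : L1 (fun y => f (y + t *: e) - f y).
  by have := integrableB measurableT ft1 f1; apply: eq_integrable.
apply: L1_dual => // phi tphi phi1 phi0.
pose F s := \int[L]_y (f y * phi (y - s *: e)).
set M := \int[L]_(y in _) `|g y|.
have dF (s : R) : is_derive s 1 F (\int[L]_y (g y * phi (y - s *: e))).
  have -> : \int[L]_y (g y * phi (y - s *: e)) =
      - \int[L]_y (f y * partial i phi (y - s *: e)).
    by rewrite -[LHS]opprK -fg ?partial_shift//; exact: test_shift.
  exact: is_derive_convolution.
have E : \int[L]_y ((f (y + t *: e) - f y) * phi y) = F t - F 0.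
  rewrite /F -(Rintegral_translation (t *: e) (f := fun y => f y * phi (y - t *: e))); last first.
    by apply: measurable_L1; exact: L1_mul_test.
  under eq_Rintegral do rewrite mulrBl.
  rewrite RintegralB//.
  - congr (_ - _); apply: eq_Rintegral => y _; first by rewrite addrK.
    by rewrite scale0r subr0.
  - by have := L1_mul_test 0 ft1 tphi; apply: eq_integrable => // y _ /=; rewrite subr0.
  - by have := L1_mul_test 0 f1 tphi; apply: eq_integrable => // y _ /=; rewrite subr0.
have bound s : `|s| <= `|t| -> `|\int[L]_y (g y * phi (y - s *: e))| <= M.
  move=> st; have ig := L1_mul_test (s *: e) g1 tphi.
  apply: le_trans (le_normr_Rintegral measurableT ig) _.
  rewrite /M -(Rintegral_indic_mul L _ (measurable_rV_ball x (r + `|t|))).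
  apply: le_Rintegral => //.
  - exact: integrable_norm.
  - by apply: integrable_mul_indic => //; [exact: measurable_rV_ball|exact: integrable_norm].
  - move=> y _; rewrite normrM ler_wpM2l// indicE.
    have [_|] := boolP (y \in (ball x (r + `|t|) : set Rn)); first exact: phi1.
    rewrite notin_setE => ny; rewrite phi0 ?normr0// => ys; apply: ny.
    have -> : y = (y - s *: e) + s *: e by rewrite subrK.
    move: ys; rewrite -!ball_normE /ball_/= => ys.
    rewrite opprD addrA (le_lt_trans (ler_normB _ _))// ltr_leD//.
    rewrite normrZ (le_trans _ st)// -[leRHS]mulr1 ler_wpM2l//.
    exact: norm_delta_mx_le.
rewrite E (le_trans (ler_norm _))//.
have cF : continuous F.
  by move=> s; apply: differentiable_continuous; apply/derivable1_diffP; have [] := dF s.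
have [t0|t0] := leP 0 t.
  have [c ct ->] := MVT_segment t0 (fun s _ => dF s) (continuous_subspaceT cF).
  rewrite subr0 normrM mulrC ler_wpM2l// bound//.
  by move: ct; rewrite in_itv/= => /andP[c0 ct]; rewrite !ger0_norm// (le_trans c0).
have [c ct H] := MVT_segment (ltW t0) (fun s _ => dF s) (continuous_subspaceT cF).
rewrite distrC H sub0r normrM normrN mulrC ler_wpM2l// bound//.
by move: ct; rewrite in_itv/= => /andP[ct c0]; rewrite !ler0_norm ?lerN2// ltW.
Qed.

(** One coordinate at a time. Each step moves the centre by [h i] along an axis, and the radius
    enlarged by the total length of the path absorbs all these moves. *)
Lemma translation_estimate_seq (f : Rn -> R) (g : 'I_n -> Rn -> R) (h : 'I_n -> R)
    (s : seq 'I_n) (x : Rn) (r : R) :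
  0 < r -> L1 f -> (forall i, L1 (g i)) ->
  (forall i phi, test_function phi ->
    \int[L]_y (f y * partial i phi y) = - \int[L]_y (g i y * phi y)) ->
  @bump_min R n * \int[L]_(y in ball x r)
    `|f (y + \sum_(i <- s) h i *: delta_mx ord0 i) - f y| <=
  \sum_(i <- s) `|h i| * \int[L]_(y in ball x (r + \sum_(i <- s) `|h i|)) `|g i y|.
Proof.
move=> r0 f1 g1 fg; elim: s x => [|i s IH] x.
  rewrite !big_nil.
  rewrite (@eq_Rintegral _ _ _ _ _ (cst 0)); last by move=> y _; rewrite addr0 subrr normr0.
  by rewrite Rintegral_cst ?mul0r ?mulr0//; exact: measurable_rV_ball.
rewrite !big_cons; set S := \sum_(j <- s) `|h j|.
have S0 : 0 <= S by apply: sumr_ge0.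
set k : Rn := \sum_(j <- s) _; set hi : Rn := h i *: _.
have nhi : `|hi| <= `|h i|.
  by rewrite normrZ -[leRHS]mulr1 ler_wpM2l// norm_delta_mx_le.
have mball (z : Rn) (t : R) : measurable (ball z t : set Rn) by exact: measurable_rV_ball.
have fh1 (v : Rn) : L1 (fun y => f (y + v)) by exact: L1_translation.
have iw (v w : Rn) (z : Rn) (t : R) :
    L.-integrable (ball z t : set Rn) (EFin \o (fun y : Rn => `|f (y + v) - f (y + w)| : R)).
  apply: (@integrable_norm _ Rn R L _ (fun y : Rn => f (y + v) - f (y + w))).
  have := integrableB (mball z t) (L1_integrable (fh1 v) (mball z t)) (L1_integrable (fh1 w) (mball z t)).
  by apply: eq_integrable.
have split : \int[L]_(y in ball x r) `|f (y + (hi + k)) - f y| <=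
    \int[L]_(y in ball x r) `|f (y + hi) - f y| +
    \int[L]_(y in ball (x + hi) r) `|f (y + k) - f y|.
  have -> : \int[L]_(y in ball (x + hi) r) `|f (y + k) - f y| =
      \int[L]_(y in ball x r) `|f (y + (hi + k)) - f (y + hi)|.
    rewrite -(Rintegral_indic_mul L _ (mball x r)) -(Rintegral_indic_mul L _ (mball (x + hi) r)).
    rewrite -(Rintegral_translation hi).
      apply: eq_Rintegral => y _; rewrite -addrA; congr (_ * _).
      rewrite !indicE; congr (nat_of_bool _)%:R; apply: asbool_equiv_eq.
      by rewrite -!ball_normE /ball_/= opprD addrACA subrr addr0.
    apply: measurable_funM; last exact: measurable_indic.
    apply: (@measurableT_comp _ _ _ _ _ _ (@Num.norm R R)) => //.
    by apply: measurable_funB; apply: measurable_L1.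
  have i1 := iw (hi + k) 0 x r; have i2 := iw hi 0 x r; have i3 := iw (hi + k) hi x r.
  rewrite -RintegralD//; last first.
    by apply: eq_integrable i2 => // y _ /=; rewrite addr0.
  apply: le_Rintegral => //.
  - by apply: eq_integrable i1 => // y _ /=; rewrite addr0.
  - have := integrableD (mball x r) i2 i3.
    by apply: eq_integrable => // y _ /=; rewrite addr0.
  - move=> y _.
    have -> : f (y + (hi + k)) - f y = (f (y + (hi + k)) - f (y + hi)) + (f (y + hi) - f y).
      by rewrite subrKA.
    by rewrite [leRHS]addrC ler_normD.
have H1 := translation_estimate_coord x (h i) r0 f1 (g1 i) (fg i).
have H2 := IH (x + hi).
rewrite -(ler_pM2l (@bump_min_gt0 R n)) mulrDr in split.
apply: le_trans split _; apply: lerD.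
  apply: (le_trans H1); apply: ler_wpM2l => //.
  apply: Rintegral_norm_subset; [exact: mball|exact: mball|exact: g1|].
  by apply: le_ball; rewrite lerD2l lerDl.
apply: (le_trans H2); apply: ler_sum => j _; apply: ler_wpM2l => //.
apply: Rintegral_norm_subset; [exact: mball|exact: mball|exact: g1|].
apply: subset_trans (ball_shift_subset nhi) _; apply: le_ball.
by rewrite -addrA [S + _]addrC.
Qed.

End translation_estimate.

Section poincare.
Context {R : realType} {n : nat}.
Local Notation Rn := 'rV[R]_n.
Local Notation L := (lebesgue_rV R n).

Lemma EFin_Rintegral (w : Rn -> R) (D : set Rn) : measurable D ->
  L.-integrable D (EFin \o w) ->
  ((\int[L]_(y in D) w y)%:E = \int[L]_(y in D) (w y)%:E)%E.
Proof. by move=> mD iw; rewrite /Rintegral fineK// integrable_fin_num. Qed.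

Variables (f : Rn -> R) (g : 'I_n -> Rn -> R) (G : Rn -> R).
Hypothesis n0 : (0 < n)%N.
Hypothesis f1 : L1 f.
Hypothesis g1 : forall i, L1 (g i).
Hypothesis fg : forall i phi, test_function phi ->
  \int[L]_y (f y * partial i phi y) = - \int[L]_y (g i y * phi y).
Hypothesis G1 : L1 G.
Hypothesis gG : forall i y, `|g i y| <= `|G y|.

Lemma translation_estimate (x h : Rn) (r rho : R) : 0 < r -> `|h| <= rho ->
  @bump_min R n * \int[L]_(y in ball x r) `|f (y + h) - f y| <=
  n%:R * rho * \int[L]_(y in ball x (r + n%:R * rho)) `|G y|.
Proof.
move=> r0 hrho; have rho0 : 0 <= rho by apply: le_trans hrho.
have hi i : `|h ord0 i| <= rho by apply: le_trans hrho; exact: coord_ler_norm.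
have sumh : \sum_i `|h ord0 i| <= n%:R * rho.
  apply: (@le_trans _ _ (\sum_(i < n) rho)); first exact: ler_sum.
  by rewrite sumr_const card_ord mulr_natl.
have := translation_estimate_seq (fun i => h ord0 i) (index_enum 'I_n) x r0 f1 g1 fg.
rewrite -row_sum_delta => /le_trans; apply.
apply: (@le_trans _ _ (\sum_(i < n) rho * \int[L]_(y in ball x (r + n%:R * rho)) `|G y|)).
  apply: ler_sum => i _; apply: ler_pM => //; first exact: Rintegral_ge0.
  apply: (@le_trans _ _ (\int[L]_(y in ball x (r + n%:R * rho)) `|g i y|)).
    apply: Rintegral_norm_subset => //; try exact: measurable_rV_ball.
    by apply: le_ball; rewrite lerD2l.
  by apply: le_Rintegral => //; [exact: measurable_rV_ball|
    apply: integrable_norm; apply: L1_integrable => //; exact: measurable_rV_ball..].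
by rewrite sumr_const card_ord -[leLHS]mulr_natl mulrA.
Qed.

(** The bound of [translation_estimate] for displacements up to [2 * r], which join any two points
    of a cube of half-side [r]. *)
Let c (x : Rn) (r : R) := (@bump_min R n)^-1 *
  (n%:R * (2 * r) * \int[L]_(y in ball x (r + n%:R * (2 * r))) `|G y|).

(** The left side is at most the double integral of |f(z) - f(y)| over B x B. Substituting z = y + h
    confines h to the cube of half-side 2r, of measure (4r)^n; after Tonelli, [translation_estimate]
    bounds the integral in y for each h. *)
Lemma double_integral_le (x : Rn) (r : R) (B : set Rn) : 0 < r -> measurable B ->
  B `<=` ball x r -> 
  fine (L B) * \int[L]_(y in B) `|f y - (fine (L B))^-1 * \int[L]_(z in B) f z| <=
  c x r * (4 * r) ^+ n.
Proof.
move=> r0 mB BQ; set V := fine (L B); set a := V^-1 * _.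
pose Q : set Rn := ball x r; pose H : set Rn := ball 0 (2 * r).
have mQ : measurable Q by exact: measurable_rV_ball.
have mH : measurable H by exact: measurable_rV_ball.
have Qoo : (L Q < +oo)%E by rewrite lebesgue_rV_ball// ltry.
have Boo : (L B < +oo)%E.
  by apply: le_lt_trans Qoo; apply: le_measure; rewrite ?inE.
have mf : measurable_fun setT f by exact: measurable_L1.
have r20 : 0 < 2 * r by rewrite mulr_gt0.
have V0 : 0 <= V by rewrite fine_ge0.
(* If [V] is 0 the left side is 0; afterwards [V] cancels against the inverse in [a]. *)
have [V00|Vn0] := eqVneq V 0.
  rewrite V00 mul0r /c !mulr_ge0 ?exprn_ge0 ?mulr_ge0 ?invr_ge0 ?(ltW bump_min_gt0) ?(ltW r0)//.
  exact: Rintegral_ge0.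
have ifB : L.-integrable B (EFin \o f) by exact: L1_integrable.
have icst (t : R) : L.-integrable B (EFin \o cst t).
  by apply: (@integrable_bounded_set _ _ _ _ _ _ `|t|).
have ifc (t : R) : L.-integrable B (EFin \o (fun z => `|f z - t|)).
  apply: (@integrable_norm _ _ _ _ _ (fun z => f z - t)).
  by have := integrableB mB ifB (icst t); apply: eq_integrable.
(* Indicators extend the integrand to the whole product, where Tonelli and translation invariance
   apply. *)
pose T (p : Rn * Rn) : \bar R := (`|f (p.1 + p.2) - f p.1| * (\1_Q p.1 * \1_H p.2))%:E.
have T0 p : (0 <= T p)%E.
  by rewrite lee_fin !mulr_ge0// indicE ler0n.
have mT : measurable_fun setT T.
  apply/measurable_EFinP; apply: measurable_funM.
    apply: (@measurableT_comp _ _ _ _ _ _ (@Num.norm R R)) => //.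
    apply: measurable_funB; last by apply: measurableT_comp.
    apply: measurableT_comp => //; apply: measurable_fun_rV => i.
    under eq_fun do rewrite mxE.
    by apply: measurable_funD; apply: measurableT_comp (@measurable_rV_coord R n i) _.
  by apply: measurable_funM; apply: measurableT_comp => //; exact: measurable_indic.
have mT1 y : measurable_fun setT (fun h => T (y, h)) by exact: measurableT_comp.
have mT2 h : measurable_fun setT (fun y => T (y, h)) by exact: measurableT_comp.
have low y : B y -> ((V * `|f y - a|)%:E <= \int[L]_h T (y, h))%E.
  move=> By.
  have -> : V * `|f y - a| = `|\int[L]_(z in B) (f z - f y)|.
    have -> : \int[L]_(z in B) (f z - f y) = \int[L]_(z in B) f z - f y * V.
      rewrite (@RintegralB _ _ _ _ _ f (cst (f y)))//; congr (_ - _).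
      exact: (Rintegral_cst L mB (f y)).
    rewrite -[X in X * `|_|](ger0_norm V0) -normrM.
    by rewrite distrC mulrBr /a mulrA divff// mul1r -/V [V * f y]mulrC.
  have ify : L.-integrable B (EFin \o (fun z => f z - f y)).
    by have := integrableB mB ifB (icst (f y)); apply: eq_integrable.
  apply: (@le_trans _ _ (\int[L]_(z in B) `|f z - f y|)%:E).
    by rewrite lee_fin; exact: le_normr_Rintegral.
  rewrite EFin_Rintegral//.
  have mfy : measurable_fun B (fun z => `|f z - f y|%:E).
    by have /integrableP[] := ifc (f y).
  rewrite -(@ge0_integral_translation _ _ y B (fun z => `|f z - f y|%:E))//.
  have mByy : measurable ((fun z => z + y) @^-1` B).
    by rewrite -[X in measurable X]setTI; apply: measurable_rV_translation.
  rewrite integral_mkcond; apply: ge0_le_integral => //.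
  - by move=> h _; rewrite patchE; case: ifP => //; rewrite lee_fin.
  - apply/(measurable_restrictT _ mByy)/measurable_funTS.
    apply/measurable_EFinP.
    apply: (@measurableT_comp _ _ _ _ _ _ (@Num.norm R R)) => //.
    apply: measurable_funB => //; apply: measurableT_comp => //.
    exact: measurable_rV_translation.
  - move=> h _; rewrite patchE; case: ifPn => [|_]; last exact: T0.
    rewrite inE /= => Bhy; rewrite /T /= lee_fin [h + y]addrC !indicE mem_set; last exact: BQ.
    rewrite mem_set ?mul1r ?mulr1//.
    have := BQ _ Bhy; have := BQ _ By; rewrite /H -!ball_normE /ball_/= => xy xhy.
    rewrite sub0r normrN (_ : h = (x - y) - (x - (h + y))); last first.
      by rewrite opprB addrC subrKA addrK.
    by rewrite (le_lt_trans (ler_normB _ _))//; lra.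
have c0 : 0 <= c x r.
  rewrite /c !mulr_ge0 ?invr_ge0 ?(ltW bump_min_gt0) ?(ltW r0)//.
  exact: Rintegral_ge0.
have up h : (\int[L]_y T (y, h) <= (c x r * \1_H h)%:E)%E.
  have [hH|hH] := boolP (h \in H); last first.
    have IH : \1_H h = 0 :> R by rewrite indicE (negbTE hH).
    rewrite IH mulr0 integral0_eq// => y _.
    by rewrite /T /= IH !mulr0.
  have ih : L1 (fun y => `|f (y + h) - f y|).
    apply: (@integrable_norm _ Rn R L _ (fun y : Rn => f (y + h) - f y)).
    by have := integrableB measurableT (L1_translation h f1) f1; apply: eq_integrable.
  have -> : (\int[L]_y T (y, h) = (\int[L]_(y in Q) `|f (y + h) - f y|)%:E)%E.
    rewrite -Rintegral_indic_mul// EFin_Rintegral//; last exact: integrable_mul_indic.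
    by apply: eq_integral => y _; rewrite /T/= (_ : \1_H h = 1) ?mulr1// indicE hH.
  rewrite lee_fin indicE hH mulr1 /c ler_pdivlMl ?bump_min_gt0//.
  apply: translation_estimate => //.
  by move: hH; rewrite inE /H -ball_normE /ball_/= sub0r normrN => /ltW.
have iD : L.-integrable B (EFin \o (fun y => V * `|f y - a|)).
  by have := integrableZl mB V (ifc a); apply: eq_integrable.
have e1 : ((V * \int[L]_(y in B) `|f y - a|)%:E <= \int[L]_y \int[L]_h T (y, h))%E.
  rewrite -RintegralZl//.
  rewrite EFin_Rintegral// integral_mkcond; apply: ge0_le_integral => //.
  - by move=> y _; rewrite patchE; case: ifP => // _; rewrite lee_fin mulr_ge0.
  - by apply/(measurable_restrictT _ mB); have /integrableP[] := iD.
  - exact: (@measurable_fun_fubini_tonelli_F _ _ _ _ _ L T mT T0).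
  - move=> y _; rewrite patchE; case: ifPn => [|_]; last by apply: integral_ge0.
    by rewrite inE; exact: low.
rewrite -lee_fin; apply: le_trans e1 _.
rewrite (fubini_tonelli (m1 := L) (m2 := L) T mT T0).
apply: (@le_trans _ _ (\int[L]_h (c x r * \1_H h)%:E)%E).
  apply: ge0_le_integral => //.
  - by move=> h _; apply: integral_ge0.
  - exact: (@measurable_fun_fubini_tonelli_G _ _ _ _ _ L T mT T0).
  - by apply/measurable_EFinP; apply: measurable_funM => //; exact: measurable_indic.
have iH : L1 (\1_H : Rn -> R) by apply: L1_indic => //; rewrite lebesgue_rV_ball// ltry.
under eq_integral do rewrite EFinM.
have LH : L H = ((2 * (2 * r)) ^+ n)%:E by rewrite lebesgue_rV_ball.
rewrite integralZl// integral_indic// setIT -[X in (_ * X)%E]/(L H) LH -EFinM lee_fin.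
by rewrite mulrA -(natrM R 2 2).
Qed.

Lemma oscillation_sup_poincare : exists2 C : R, 0 < C &
  forall x (l : R), (l%:E < oscillation_sup f x)%E -> exists2 rho : R, 0 < rho &
    l * rho ^+ n < C * \int[L]_(y in ball x rho) `|G y|.
Proof.
have nR : 0 < n%:R :> R by rewrite ltr0n.
have b0 := @bump_min_gt0 R n.
(* The volume factor (4r)^n / V^2, with V at least (2r/n)^n, is at most (n^2)^n / r^n; the rest is
   [n * (2 * r) / bump_min] divided by [r]. *)
pose C0 : R := (n%:R ^+ 2) ^+ n * (2 * n%:R) / @bump_min R n.
have C00 : 0 < C0 by rewrite !mulr_gt0 ?invr_gt0 ?exprn_gt0.
exists (C0 * (1 + n%:R * 2) ^+ n); first by rewrite mulr_gt0// exprn_gt0.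
move=> x l /ereal_sup_gt[_ [r /= r0 <-]]; rewrite lte_fin => lr.
(* The cube on which [double_integral_le] integrates [|G|]; its dilation factor accounts for
   [(1 + n%:R * 2) ^+ n] in the constant. *)
exists ((1 + n%:R * 2) * r); first by rewrite mulr_gt0.
rewrite exprMn mulrCA -[ltRHS]mulrA [ltRHS]mulrCA ltr_pM2l ?exprn_gt0//.
rewrite -ltr_pdivlMr ?exprn_gt0//.
apply: lt_le_trans lr _.
have mB : measurable (eball x r) by exact: measurable_eball.
have := double_integral_le r0 mB (@eball_sub_ball _ _ x r).
rewrite /average -/(average f x r) /c.
set V := fine (L _); set W := \int[L]_(y in _) `|_ - _|; set I := \int[L]_(y in _) `|G y|.
have -> : (1 + n%:R * 2) * r = r + n%:R * (2 * r) by ring.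
rewrite -/I => VW.
have V0 : 0 < V by rewrite fine_gt0// lebesgue_eball_gt0//= lebesgue_eball_lty.
have VB : (2 * (r / n%:R)) ^+ n <= V.
  have rn : 0 < r / n%:R by rewrite divr_gt0.
  rewrite -lee_fin fineK; last by rewrite ge0_fin_numE// lebesgue_eball_lty.
  rewrite -(lebesgue_rV_ball x rn); apply: le_measure; rewrite ?inE//.
    exact: measurable_rV_ball.
  apply: subset_trans (@ball_sub_eball _ _ x (r / n%:R) n0) _.
  by rewrite mulrC divfK// gt_eqF.
set U := (2 * (r / n%:R)) ^+ n in VB.
have U0 : 0 < U by rewrite exprn_gt0// mulr_gt0// divr_gt0.
have W0 : 0 <= W by exact: Rintegral_ge0.
have VW2 : V^-1 * W <= U^-1 * (U^-1 * ((@bump_min R n)^-1 * (n%:R * (2 * r) * I) * (4 * r) ^+ n)).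
  apply: (@le_trans _ _ (U^-1 * W)); first by rewrite ler_wpM2r// lef_pV2.
  rewrite ler_pM2l ?invr_gt0// ler_pdivlMl//; apply: le_trans VW.
  by rewrite ler_wpM2r.
apply: (@le_trans _ _ (r^-1 * (U^-1 * (U^-1 * ((@bump_min R n)^-1 * (n%:R * (2 * r) * I) * (4 * r) ^+ n))))).
  by rewrite ler_pM2l ?invr_gt0.
have E4 : U^-1 * U^-1 * (4 * r) ^+ n = (n%:R ^+ 2) ^+ n / r ^+ n.
  rewrite /U -exprVn -!exprMn -exprVn -exprMn; congr (_ ^+ n).
  by field; rewrite !gt_eqF.
rewrite le_eqVlt; apply/orP; left; apply/eqP.
transitivity (r^-1 * (@bump_min R n)^-1 * (n%:R * (2 * r) * I) * (U^-1 * U^-1 * (4 * r) ^+ n)).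
  by ring.
rewrite E4 /C0; move: b0; set b := bump_min => b0.
have rn0 : 0 < r ^+ n by rewrite exprn_gt0.
move: ((n%:R ^+ 2) ^+ n) (r ^+ n) rn0 => X Y Y0.
by field; rewrite !gt_eqF.
Qed.

End poincare.

(** * The weak (1,1) estimate *)

Section weak_type.
Context {R : realType} {n : nat}.
Local Notation Rn := 'rV[R]_n.
Local Notation L := (lebesgue_rV R n).

Lemma sum_Rintegral_disjoint_le (u : Rn -> R) (D : seq Rn) (B : Rn -> set Rn) :
  L1 u -> (forall y, 0 <= u y) -> (forall x, measurable (B x)) -> uniq D ->
  trivIset [set` D] B -> \sum_(x <- D) \int[L]_(y in B x) u y <= \int[L]_y u y.
Proof.
move=> u1 u0 mB uD tD; rewrite -lee_fin -sumEFin EFin_Rintegral//.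
rewrite (eq_bigr (fun x => \int[L]_(y in B x) (u y)%:E)%E) => [|x _]; last first.
  by rewrite EFin_Rintegral//; exact: L1_integrable.
have mu : measurable_fun setT (EFin \o u) by case/integrableP: u1.
rewrite -ge0_integral_bigsetU//.
- apply: ge0_subset_integral => //; first exact: bigsetU_measurable.
  by move=> y _; rewrite lee_fin.
- exact: measurable_funTS.
- by move=> y _; rewrite lee_fin.
Qed.

(** On a cube of half-side rho, the values of [|G|] up to [mu / 2 ^+ n.+1] contribute at most
    [mu * rho ^+ n / 2], so the larger values carry at least half: this is the factor 2. The factor
    6^n is the volume of a tripled cube over rho^n. Keeping only the superlevel set on the right is
    what later turns boundedness into convergence to 0. *)
Lemma weak_type (G : Rn -> R) (O : set Rn) (mu : R) : L1 G -> 0 < mu -> measurable O ->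
  (forall x, O x -> exists2 rho : R, 0 < rho & mu * rho ^+ n < \int[L]_(y in ball x rho) `|G y|) ->
  (mu%:E * L O <=
    (2 * 6 ^+ n * \int[L]_(y in [set y | mu / 2 ^+ n.+1 < `|G y|]) `|G y|)%:E)%E.
Proof.
move=> G1 mu0 mO HO; set s := mu / 2 ^+ n.+1; set A := [set y | _].
have s0 : 0 < s by rewrite divr_gt0// exprn_gt0.
have mG : measurable_fun setT (fun y => `|G y|).
  by apply: (@measurableT_comp _ _ _ _ _ _ (@Num.norm R R)) => //; exact: measurable_L1.
have mA : measurable A.
  rewrite (_ : A = (fun y => `|G y|) @^-1` `]s, +oo[%classic).
    by rewrite -[X in measurable X]setTI; apply: mG => //; exact: measurable_itv.
  by apply/seteqP; split => y /=; rewrite in_itv/= andbT.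
have iG : L1 (fun y => `|G y|) by exact: integrable_norm.
pose u y := `|G y| * \1_A y.
have u1 : L1 u by exact: integrable_mul_indic.
have u0 y : 0 <= u y by rewrite mulr_ge0// indicE ler0n.
rewrite -(Rintegral_indic_mul L _ mA) -/u.
set I := \int[L]_y _.
have mball (z : Rn) (t : R) : measurable (ball z t : set Rn) by exact: measurable_rV_ball.
(* Vitali covering needs compactness, and [O] may a priori have infinite measure: the estimate goes
   from compact subsets to bounded parts of [O], then to [O] by monotone limit. *)
have cpt (K : set Rn) : compact K -> K `<=` O -> (mu%:E * L K <= (2 * 6 ^+ n * I)%:E)%E.
  move=> cK KO.
  have /choice[rad Hrad] : forall x, exists rho : R, 0 < rho /\
      (O x -> mu * rho ^+ n < \int[L]_(y in ball x rho) `|G y|).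
    move=> x; have [/HO[rho rho0 H]|nO] := pselect (O x); first by exists rho.
    by exists 1.
  have rad0 x : 0 < rad x by case: (Hrad x).
  have [D [uD DK tD KD]] := @vitali_compact R Rn rad K cK (fun x _ => rad0 x).
  have H1 : (L K <= (\sum_(x <- D) (6 * rad x) ^+ n)%:E)%E.
    apply: le_trans (measure_le_cover L (compact_measurable_rV cK)
      (fun x => mball x (3 * rad x)) KD) _.
    rewrite -sumEFin; apply: lee_sum => x _.
    have E : L (ball x (3 * rad x)) = ((6 * rad x) ^+ n)%:E.
      by rewrite lebesgue_rV_ball ?mulr_gt0// mulrA -natrM.
    by rewrite -E; exact: lexx.
  apply: (@le_trans _ _ (mu * \sum_(x <- D) (6 * rad x) ^+ n)%:E).
    by rewrite EFinM lee_pmul2l// lte_fin.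
  rewrite lee_fin mulr_sumr.
  apply: (@le_trans _ _ (\sum_(x <- D) 2 * 6 ^+ n * \int[L]_(y in ball x (rad x)) u y)).
    rewrite big_seq [leRHS]big_seq; apply: ler_sum => x xD.
    have [_ /(_ (KO _ (DK _ xD))) Hx] := Hrad x.
    have Bx := mball x (rad x).
    have ig (w : Rn -> R) : L1 w -> L.-integrable (ball x (rad x)) (EFin \o w).
      by move=> w1; exact: L1_integrable.
    have ic : L.-integrable (ball x (rad x) : set Rn) (EFin \o cst s).
      have Boo : (L (ball x (rad x)) < +oo)%E by rewrite lebesgue_rV_ball// ltry.
      exact: (@integrable_bounded_set _ _ _ _ _ _ `|s|).
    have H2 : \int[L]_(y in ball x (rad x)) `|G y| <=
        \int[L]_(y in ball x (rad x)) u y + s * (2 * rad x) ^+ n.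
      have -> : s * (2 * rad x) ^+ n = \int[L]_(y in ball x (rad x)) cst s y.
        have Er : L (ball x (rad x)) = ((2 * rad x) ^+ n)%:E by rewrite lebesgue_rV_ball.
        by rewrite (Rintegral_cst L Bx); congr (_ * _); exact: (esym (congr1 fine Er)).
      rewrite -RintegralD//; last exact: ig.
      apply: le_Rintegral => //; first exact: ig.
        by have := integrableD Bx (ig _ u1) ic; apply: eq_integrable.
      move=> y _; rewrite /u indicE; have [yA|] := boolP (y \in A).
        by rewrite mulr1 lerDl ltW.
      by rewrite notin_setE /A /= mulr0 add0r => /negP; rewrite -leNgt.
    have sE : s * (2 * rad x) ^+ n = mu * rad x ^+ n / 2.
      rewrite /s exprS exprMn; move: (rad x ^+ n) => X.
      have : (2 : R) ^+ n != 0 by rewrite expf_neq0.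
      by move: (2 ^+ n) => Y Y0; field.
    rewrite exprMn mulrCA; set X := \int[L]_(y in _) u y.
    have -> : 2 * 6 ^+ n * X = 6 ^+ n * (2 * X) by ring.
    rewrite ler_pM2l ?exprn_gt0//; rewrite -/X in H2.
    by rewrite sE in H2; lra.
  rewrite -mulr_sumr ler_pM2l ?mulr_gt0 ?exprn_gt0//.
  exact: sum_Rintegral_disjoint_le.
pose Bn (N : nat) : set Rn := ball 0 N.+1%:R.
have bdd (N : nat) : (mu%:E * L (O `&` Bn N) <= (2 * 6 ^+ n * I)%:E)%E.
  have Boo : (L (Bn N) < +oo)%E by rewrite /Bn lebesgue_rV_ball// ltry.
  have mOB : measurable (O `&` Bn N) by apply: measurableI => //; exact: mball.
  apply/lee_addgt0Pr => e e0.
  have emu : 0 < e / mu by rewrite divr_gt0.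
  have [K [cK KO LK]] := compact_regular_lebesgue (mball 0 N.+1%:R : measurable (Bn N)) Boo mOB (@subIsetr _ _ _) emu.
  have mK := compact_measurable_rV cK.
  have -> : L (O `&` Bn N) = (L K + L ((O `&` Bn N) `\` K))%E.
    rewrite -measureU//; [by rewrite setDUK|exact: measurableD|by rewrite setDIK].
  rewrite ge0_muleDr//; apply: leeD; first by apply: cpt => //; apply: subset_trans KO _; exact: subIsetl.
  have -> : e%:E = (mu%:E * (e / mu)%:E)%E by rewrite -EFinM mulrC divfK// gt_eqF.
  by rewrite lee_pmul2l ?lte_fin// ltW.
have ndF : nondecreasing_seq (fun N => O `&` Bn N).
  move=> i j ij; apply/subsetPset; apply: setIS; apply: le_ball.
  by rewrite ler_nat.
have UO : \bigcup_N (O `&` Bn N) = O.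
  apply/seteqP; split => [x [N _ []]//|x Ox]; exists (Num.truncn `|x|) => //; split => //.
  by rewrite /Bn -ball_normE /ball_/= sub0r normrN truncnS_gt.
have cvgO : L (O `&` Bn N) @[N --> \oo] --> L O.
  rewrite -[X in _ --> L X]UO; apply: nondecreasing_cvg_mu => //.
  - by move=> N; apply: measurableI => //; exact: mball.
  - by rewrite UO.
rewrite muleC -lee_pdivlMr//; apply: (cvge_le _ cvgO).
by apply: nearW => N; rewrite lee_pdivlMr// muleC; exact: bdd.
Qed.

End weak_type.

(** * Assembling the theorem *)

Section jordan_split.
Context {d} {T : measurableType d} {R : realType}.
Variable nu : {charge set T -> \bar R}.

Lemma jordan_split : exists (p q : {finite_measure set T -> \bar R}) (P N : set T),
  [/\ measurable P, measurable N,
      forall phi, charge_integral nu phi = \int[p]_x phi x - \int[q]_x phi x,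
      forall A, measurable A -> nu A = (p A - q A)%E &
      forall A, measurable A -> [/\ p A = p (A `&` P), q (A `&` P) = 0%E,
        q A = q (A `&` N) & p (A `&` N) = 0%E]].
Proof.
(* The same choices as inside [charge_integral], so that the integral formula holds by
   conversion. *)
pose P := projT1 (cid (Hahn_decomposition nu)).
pose N := projT1 (cid (projT2 (cid (Hahn_decomposition nu)))).
pose nuPN : hahn_decomposition nu P N := projT2 (cid (projT2 (cid (Hahn_decomposition nu)))).
have [[mP _] [mN _] PNT PN0] := nuPN.
have mPA A : measurable A -> measurable (A `&` P) by move=> mA; exact: measurableI.
have mNA A : measurable A -> measurable (A `&` N) by move=> mA; exact: measurableI.
have pE A : measurable A -> jordan_pos nuPN A = nu (A `&` P).
  by move=> mA; rewrite jordan_posE cjordan_posE /crestr0 mem_set.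
have qE A : measurable A -> jordan_neg nuPN A = (- nu (A `&` N))%E.
  by move=> mA; rewrite jordan_negE cjordan_negE /crestr0 mem_set.
exists (jordan_pos nuPN : {finite_measure set T -> \bar R}).
exists (jordan_neg nuPN : {finite_measure set T -> \bar R}).
exists P, N; split => //.
- by move=> A mA; rewrite (jordan_decomp nuPN mA) /= /cadd /= cscaleN1.
- move=> A mA; split.
  + by have E := pE _ (mPA A mA); rewrite -setIA setIid -(pE A mA) in E; exact: esym E.
  + by have E := qE _ (mPA A mA); rewrite -setIA PN0 setI0 charge0 oppe0 in E.
  + by have E := qE _ (mNA A mA); rewrite -setIA setIid -(qE A mA) in E; exact: esym E.
  + by have E := pE _ (mNA A mA); rewrite -setIA (setIC N P) PN0 setI0 charge0 in E.
Qed.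

End jordan_split.

Section variation.
Context {d} {T : measurableType d} {R : realType} {n : nat}.

(** The partition of [A] into [B] and its complement in [A] shows that the variation of [A]
    dominates the norm of the value at [B]. *)
Lemma vmeasure_variation_eq0 (nu : vmeasure T R n) (A B : set T) i :
  measurable A -> vmeasure_variation nu A = 0%E -> measurable B -> B `<=` A ->
  nu i B = 0%E.
Proof.
move=> mA vA mB BA; pose F k : set T := nth set0 [:: B; A `\` B] k.
have mF k : measurable (F k).
  by case: k => [|[|k]] //=; [exact: measurableD|rewrite /F nth_default].
have tF : trivIset setT F.
  move=> i' j _ _ [x []]; case: i' => [|[|i']]; case: j => [|[|j]] //=; rewrite /F /= ?nth_nil //.
  - by move=> Bx [_ nB].
  - by move=> [_ nB] Bx.
have UF : \bigcup_k F k = A.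
  apply/seteqP; split => [x [[|[|k]] _]|x Ax]; rewrite ?/F /=.
  - exact: BA.
  - by case.
  - by rewrite nth_default.
  - have [Bx|nBx] := pselect (B x); first by exists 0%N.
    by exists 1%N.
have : ((enorm (vvalue nu (F 0%N)))%:E <= 0)%E.
  rewrite -vA; apply: (@le_trans _ _ (\sum_(k <oo) (enorm (vvalue nu (F k)))%:E)%E).
    rewrite (nneseries_split 0 1); last by move=> k _; rewrite lee_fin enorm_ge0.
    rewrite big_nat1 leeDl// nneseries_ge0// => k _ _; rewrite lee_fin; exact: enorm_ge0.
  by apply: ereal_sup_ubound; exists F.
rewrite lee_fin => e0; have /enorm_eq0/rowP/(_ i) : enorm (vvalue nu (F 0%N)) = 0.
  by apply/eqP; rewrite eq_le e0 enorm_ge0.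
rewrite !mxE /F/= => H.
by rewrite -(fineK (fin_num_measure (nu i) _ mB)) H.
Qed.

(** A supremum over no partition would be -oo; [A] followed by empty sets is a partition. *)
Lemma vmeasure_variation_ge0 (nu : vmeasure T R n) (A : set T) : measurable A ->
  (0 <= vmeasure_variation nu A)%E.
Proof.
move=> mA; pose F k : set T := if k == 0%N then A else set0.
apply: (@le_trans _ _ (\sum_(k <oo) (enorm (vvalue nu (F k)))%:E)%E).
  by apply: nneseries_ge0 => k _ _; rewrite lee_fin enorm_ge0.
apply: ereal_sup_ubound; exists F => //; split.
- by move=> [|k]; rewrite /F/=.
- by move=> [|i] [|j] _ _ // [x []].
- by apply/seteqP; split => [x [[|k] _]//|x Ax]; exists 0%N.
Qed.

Lemma vmeasure_variation_le (nu : vmeasure T R n)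
    (m : 'I_n -> {measure set T -> \bar R}) (Z : set T) : measurable Z ->
  (forall i A, measurable A -> (`|nu i A| <= m i (A `&` Z))%E) ->
  (vmeasure_variation nu setT <= \sum_(i < n) m i Z)%E.
Proof.
move=> mZ H; apply: ge_ereal_sup => _ [F [mF tF UF] <-].
have mFZ k : measurable (F k `&` Z) by exact: measurableI.
apply: (@le_trans _ _ (\sum_(k <oo) \sum_(i < n) m i (F k `&` Z))%E).
  apply: lee_nneseries => [k _ _|k _]; first by rewrite lee_fin enorm_ge0.
  apply: (@le_trans _ _ (\sum_(i < n) `|nu i (F k)|)%E); last by apply: lee_sum => i _; exact: H.
  apply: (@le_trans _ _ (\sum_(i < n) `|vvalue nu (F k) ord0 i|)%:E).
    by rewrite lee_fin enorm_le_sum.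
  rewrite -sumEFin; apply: lee_sum => i _; rewrite mxE -fine_abse ?fin_num_measure//.
  by rewrite fineK// abse_fin_num fin_num_measure.
rewrite nneseries_sum//; apply: lee_sum => i _.
rewrite -[X in (_ <= m i X)%E](setTI Z) -UF setI_bigcupl.
rewrite measure_bigcup//; last exact: trivIset_setIr.
rewrite [leRHS](_ : _ = \sum_(k <oo) m i (F k `&` Z))%E//.
by apply: eq_eseriesl => k; rewrite in_setT.
Qed.

End variation.

Section W11_limit.
Context {R : realType} {n : nat}.
Local Notation Rn := 'rV[R]_n.
Local Notation L := (lebesgue_rV R n).

Definition oscillation_tail (f : Rn -> R) (l : R) : \bar R :=
  (l%:E * L [set x | l%:E < oscillation_sup f x])%E.

Lemma liminf_tail_ge0 (f : Rn -> R) :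
  (0 <= limf_einf (oscillation_tail f) (pinfty_nbhs R))%E.
Proof.
apply: (@limf_einf_pinfty_ge _ _ 0) => e e0; exists 0 => l l0.
apply: (@le_trans _ _ 0%E); first by rewrite lee_fin sub0r oppr_le0 ltW.
by rewrite mule_ge0// lee_fin ltW.
Qed.

Lemma limf_einf_pinfty_le (h : R -> \bar R) (a : \bar R) :
  (exists l0 : R, forall l, l0 < l -> (h l <= a)%E) ->
  (limf_einf h (pinfty_nbhs R) <= a)%E.
Proof.
move=> [l0 Hl]; rewrite limf_einfE; apply: ge_ereal_sup => _ [V [M [_ MV]] <-].
have H : Num.max M l0 < Num.max M l0 + 1 by rewrite ltrDl.
apply: le_trans (Hl (Num.max M l0 + 1) _); last first.
  by rewrite (le_lt_trans _ H)// le_max lexx orbT.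
apply: ereal_inf_lbound; exists (Num.max M l0 + 1) => //; apply: MV.
by rewrite (le_lt_trans _ H)// le_max lexx.
Qed.

(** By Chebyshev's inequality the superlevel sets have small measure for large [s]; absolute
    continuity of the integral concludes. *)
Lemma integral_superlevel_small (G : Rn -> R) (e : R) : L1 G -> 0 < e ->
  exists s0 : R, forall s, s0 < s -> \int[L]_(y in [set y | s < `|G y|]) `|G y| < e.
Proof.
move=> G1 e0; have [d [d0 Hd]] := integral_normr_continuous G1 e0.
have mG : measurable_fun setT (EFin \o G) by case/integrableP: G1.
have iG : L1 (fun y => `|G y|) by exact: integrable_norm.
pose I := \int[L]_y `|G y|; have I0 : 0 <= I by exact: Rintegral_ge0.
exists (Num.max 0 (I / d)) => s; rewrite gt_max => /andP[s0 Is].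
pose A : set Rn := [set y | s < `|G y|].
have mA : measurable A.
  rewrite (_ : A = (fun y => `|G y|) @^-1` `]s, +oo[%classic).
    rewrite -[X in measurable X]setTI; apply: (measurable_L1 iG) => //.
  by apply/seteqP; split => y /=; rewrite in_itv/= andbT.
apply: Hd => //.
have := le_integral_abse L measurableT mG s0.
rewrite setTI => H.
have sA : (s%:E * L A <= I%:E)%E.
  rewrite /I EFin_Rintegral//; apply: le_trans _ H.
  rewrite lee_pmul2l ?lte_fin//; apply: le_measure; rewrite ?inE//.
    rewrite (_ : [set y | _] = (fun y => `|G y|) @^-1` `[s, +oo[%classic).
      rewrite -[X in measurable X]setTI; apply: (measurable_L1 iG) => //.
    by apply/seteqP; split => y /=; rewrite in_itv/= andbT.
  by move=> y /= /ltW.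
rewrite -(@lte_pmul2l _ s%:E) ?lte_fin//.
apply: (le_lt_trans sA); rewrite -EFinM lte_fin.
by rewrite -ltr_pdivrMr.
Qed.

Lemma W11_liminf_eq0 (f : Rn -> R) : (0 < n)%N -> W11 f ->
  limf_einf (oscillation_tail f) (pinfty_nbhs R) = 0%E.
Proof.
move=> n0 [f1 [g g1 fg]]; apply/eqP; rewrite eq_le liminf_tail_ge0 andbT.
pose G y := \sum_i `|g i y|.
have G1 : L1 G.
  have := @integrable_sum _ _ _ L _ measurableT _ (index_enum 'I_n) xpredT
    (fun i y => `|g i y|%:E) (fun i _ => integrable_norm (g1 i)).
  by apply: eq_integrable => // y _; rewrite /= sumEFin.
have gG i y : `|g i y| <= `|G y|.
  rewrite [leRHS]ger0_norm ?sumr_ge0// /G (bigD1 i)//= lerDl.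
  by rewrite sumr_ge0.
have [C C0 HC] := oscillation_sup_poincare n0 f1 g1 (fun i phi tphi => fg phi tphi i) G1 gG.
apply/lee_addgt0Pr => e e0; rewrite add0e.
apply: limf_einf_pinfty_le.
have D0 : 0 < C * (2 * 6 ^+ n) by rewrite !mulr_gt0// exprn_gt0.
have [s0 Hs] := integral_superlevel_small G1 (divr_gt0 e0 D0).
(* Beyond this threshold the truncation level [l / C / 2 ^+ n.+1] of [weak_type] exceeds [s0]. *)
exists (Num.max 0 (C * (2 ^+ n.+1 * s0))) => l; rewrite gt_max => /andP[l0 ls].
have mu0 : 0 < l / C by rewrite divr_gt0.
have mO : measurable [set x | (l%:E < oscillation_sup f x)%E].
  by apply: open_measurable_rV; exact: open_oscillation_sup.
have HO x : (l%:E < oscillation_sup f x)%E ->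
    exists2 rho : R, 0 < rho & l / C * rho ^+ n < \int[L]_(y in ball x rho) `|G y|.
  by move=> /HC[rho rho0 H]; exists rho => //; rewrite mulrAC ltr_pdivrMr// [ltRHS]mulrC.
have := weak_type G1 mu0 mO HO.
have sl : s0 < l / C / 2 ^+ n.+1.
  by rewrite ltr_pdivlMr ?exprn_gt0// ltr_pdivlMr// mulrC [s0 * _]mulrC.
move: (Hs _ sl); set J := \int[L]_(y in _) _ => HJ.
rewrite -(@lee_pmul2l _ C%:E) ?lte_fin// muleA -EFinM mulrC divfK ?gt_eqF// => H.
apply: le_trans H _; rewrite -EFinM lee_fin mulrA -ler_pdivlMl// mulrC.
exact: ltW.
Qed.

End W11_limit.

Section singular_lower_bound.
Context {R : realType} {n : nat}.
Local Notation Rn := 'rV[R]_n.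
Local Notation L := (lebesgue_rV R n).

Lemma liminf_ge_null_mass : (0 < n)%N -> exists2 c : R, 0 < c &
  forall (f : Rn -> R) (i : 'I_n) (p q : {finite_measure set Rn -> \bar R}) (A : set Rn),
  L1 f ->
  (forall phi, test_function phi -> \int[p]_x phi x - \int[q]_x phi x <=
     `|\int[L]_x (f x * partial i phi x)|) ->
  measurable A -> L A = 0%E -> q A = 0%E ->
  ((c * fine (p A))%:E <= limf_einf (oscillation_tail f) (pinfty_nbhs R))%E.
Proof.
move=> n0; have [c1 c10 osc] := @oscillation_sup_ge R n n0.
exists (c1 * @bump_min R n / 2 / 2 ^+ n).
  by rewrite !mulr_gt0 ?invr_gt0 ?exprn_gt0 ?bump_min_gt0.
set c := _ / _ => f i p q A f1 distr mA LA qA.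
have c0 : 0 < c by rewrite !mulr_gt0 ?invr_gt0 ?exprn_gt0 ?bump_min_gt0.
apply: limf_einf_pinfty_ge => e e0.
have [l0 Hl] := oscillation_density n0 f1 c10 (fun x r y => osc f i x r y f1) distr mA LA qA (divr_gt0 e0 c0).
exists l0 => l /Hl; apply: le_trans; rewrite lee_fin -/c mulrBr.
by rewrite [c * (e / c)]mulrC divfK// gt_eqF.
Qed.

(** On the null set [Z] the absolutely continuous part vanishes, and off [Z] the singular part does:
    the latter is the restriction of [mu] to [Z]. *)
Lemma is_singular_part_null (mu nu : vmeasure Rn R n) : is_singular_part L mu nu ->
  exists Z, [/\ measurable Z, L Z = 0%E &
    forall i A, measurable A -> nu i A = mu i (A `&` Z)].
Proof.
move=> [[Z [mZ LZ nuZ]] [ac ac0 muE]]; exists Z; split => // i A mA.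
have mAZ : measurable (A `&` Z) by exact: measurableI.
have LAZ : L (A `&` Z) = 0%E by apply: (subset_measure0 mAZ mZ _ LZ); exact: subIsetr.
rewrite muE// (vmeasure_variation_eq0 i mAZ (ac0 _ mAZ LAZ) mAZ (@subset_refl _ _)) add0e.
have mAC : measurable (A `&` ~` Z) by apply: measurableI => //; exact: measurableC.
rewrite -[in LHS](setIT A) -(setUv Z) setIUr chargeU//.
  by rewrite (vmeasure_variation_eq0 i (measurableC mZ) nuZ mAC (@subIsetr _ A (~` Z))) adde0.
by rewrite setIACA setICr setI0.
Qed.

Lemma singular_variation_le : (0 < n)%N -> exists2 c : R, 0 < c &
  forall (f : Rn -> R) (mu nu : vmeasure Rn R n), L1 f -> is_distr_derivative f mu ->
  is_singular_part L mu nu ->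
  (c%:E * vmeasure_variation nu setT <=
    limf_einf (oscillation_tail f) (pinfty_nbhs R))%E.
Proof.
move=> n0; have [c c0 Hc] := liminf_ge_null_mass n0.
have nR : 0 < n%:R :> R by rewrite ltr0n.
(* The variation is at most the sum of the 2n masses of [Z] under the Jordan parts, each of which,
   times [c], is bounded by the liminf. *)
exists (c / (2 * n%:R)); first by rewrite divr_gt0// mulr_gt0.
move=> f mu nu f1 distr sing; set l := limf_einf _ _.
have l0 : (0 <= l)%E by exact: liminf_tail_ge0.
have [Z [mZ LZ nuE]] := is_singular_part_null sing.
have /choice[p /choice[q pqE]] : forall i : 'I_n, exists p q : {finite_measure set Rn -> \bar R},
    (forall A, measurable A -> mu i A = (p A - q A)%E) /\
    ((c * fine (p Z))%:E <= l)%E /\ ((c * fine (q Z))%:E <= l)%E.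
  move=> i; have [p [q [P [N [mP mN intE muE H]]]]] := jordan_split (mu i).
  exists p, q; split => //.
  have [pZ qZP qZ pZN] := H Z mZ.
  have absE phi : test_function phi ->
      `|\int[L]_x (f x * partial i phi x)| = `|\int[p]_x phi x - \int[q]_x phi x|.
    by move=> tphi; rewrite (distr phi tphi i) intE normrN.
  have mZP : measurable (Z `&` P) by exact: measurableI.
  have mZN : measurable (Z `&` N) by exact: measurableI.
  split.
  (* The [p]-mass of [Z] sits on the positive Hahn set, where [q] vanishes; the other bullet
     exchanges the two parts. *)
  - rewrite pZ; apply: (Hc f i p q) => //.
      by move=> phi tphi; rewrite absE// ler_norm.
    by apply: (subset_measure0 mZP mZ _ LZ); exact: subIsetl.
  - rewrite qZ; apply: (Hc f i q p) => //.
      by move=> phi tphi; rewrite absE// distrC ler_norm.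
    by apply: (subset_measure0 mZN mZ _ LZ); exact: subIsetl.
have varE : (vmeasure_variation nu setT <= \sum_(i < n) (p i Z + q i Z))%E.
  have H : forall i A, measurable A -> (`|nu i A| <= measure_add (p i) (q i) (A `&` Z))%E.
    move=> i A mA.
    have mAZ : measurable (A `&` Z) by exact: measurableI.
    have [muE _] := pqE i; rewrite nuE// muE// measure_addE.
    apply: le_trans (lee_abs_sub _ _) _.
    by rewrite !gee0_abs.
  apply: le_trans (vmeasure_variation_le mZ H) _.
  apply: lee_sum => i _.
  by rewrite -[X in (X <= _)%E]/(measure_add (p i) (q i) Z) measure_addE.
have pfin i : p i Z \is a fin_num by exact: fin_num_measure.
have qfin i : q i Z \is a fin_num by exact: fin_num_measure.
pose S := \sum_(i < n) (fine (p i Z) + fine (q i Z)).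
have SE : (\sum_(i < n) (p i Z + q i Z) = S%:E)%E.
  by rewrite -sumEFin; apply: eq_bigr => i _; rewrite EFinD !fineK.
apply: (@le_trans _ _ ((c / (2 * n%:R)) * S)%:E).
  by rewrite [leRHS]EFinM -SE lee_wpmul2l// lee_fin divr_ge0 ?mulr_ge0 ?ltW.
have [->|loo] := eqVneq l +oo%E; first by rewrite leey.
have lfin : l \is a fin_num by rewrite ge0_fin_numE ?lt_neqAle ?loo ?leey.
rewrite -(fineK lfin) lee_fin mulrAC ler_pdivrMr ?mulr_gt0// mulr_sumr.
apply: (@le_trans _ _ (\sum_(i < n) (fine l + fine l))).
  apply: ler_sum => i _; have [_ [pl ql]] := pqE i.
  by rewrite mulrDr lerD// -lee_fin fineK.
by rewrite sumr_const card_ord le_eqVlt; apply/orP; left; apply/eqP; ring.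
Qed.

(** Without singular part, [mu] and hence its Jordan parts vanish on null sets; the difference of
    their Radon-Nikodym densities is the weak partial derivative. *)
Lemma W11_of_singular_eq0 (f : Rn -> R) (mu nu : vmeasure Rn R n) : L1 f ->
  is_distr_derivative f mu -> is_singular_part L mu nu ->
  vmeasure_variation nu setT = 0%E -> W11 f.
Proof.
move=> f1 distr [_ [ac ac0 muE]] nu0; split => //.
have mu0 i A : measurable A -> L A = 0%E -> mu i A = 0%E.
  move=> mA LA; rewrite muE//.
  rewrite (vmeasure_variation_eq0 i mA (ac0 _ mA LA) mA (@subset_refl _ _)) add0e.
  exact: (vmeasure_variation_eq0 i measurableT nu0 mA).
suff /choice[g Hg] : forall i, exists g : Rn -> R, L1 g /\ forall phi, test_function phi ->
    charge_integral (mu i) phi = \int[L]_x (g x * phi x).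
  exists g => [i|phi tphi i]; first by case: (Hg i).
  by rewrite distr//; have [_ ->] := Hg i.
move=> i; have [p [q [P [N [mP mN intE pqE H]]]]] := jordan_split (mu i).
have dom (m : {finite_measure set Rn -> \bar R}) :
    (forall A, measurable A -> L A = 0%E -> m A = 0%E) ->
    exists g : Rn -> R, L1 g /\ forall phi, test_function phi ->
      \int[m]_x phi x = \int[L]_x (g x * phi x).
  move=> m0; have mL : m `<< L by apply/null_content_dominatesP.
  pose h := Radon_Nikodym (charge_of_finite_measure m) L.
  have hfin x : h x \is a fin_num by exact: Radon_Nikodym_fin_num.
  have hE x : (fine (h x))%:E = h x by rewrite fineK.
  exists (fun x => fine (h x)); split.
    have := @Radon_Nikodym_integrable _ _ _ (charge_of_finite_measure m) L mL.
    by apply: eq_integrable => // x _; rewrite /= hE.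
  move=> phi tphi; rewrite /Rintegral; congr fine.
  rewrite -(@Radon_Nikodym_change_of_variables _ _ _ m L mL (EFin \o phi) setT)//.
    by apply: eq_integral => x _; rewrite EFinM hE muleC.
  have [C C0 HC] := test_bounded tphi.
  apply: (@integrable_bounded_set _ _ _ _ _ _ C) => //.
    by rewrite -ge0_fin_numE// fin_num_measure.
  by apply: continuous_measurable_rV; exact: test_continuous.
have [gp [gp1 gpE]] : exists g : Rn -> R, L1 g /\ forall phi, test_function phi ->
      \int[p]_x phi x = \int[L]_x (g x * phi x).
  (* On the positive Hahn set [q] vanishes, so [p A] equals the value of [mu i] on a null set. *)
  apply: dom => A mA LA; have [-> qAP _ _] := H A mA.
  have mAP : measurable (A `&` P) by exact: measurableI.
  have LAP : L (A `&` P) = 0%E by apply: (subset_measure0 mAP mA _ LA); exact: subIsetl.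
  by have := mu0 i _ mAP LAP; rewrite pqE// qAP sube0.
have [gq [gq1 gqE]] : exists g : Rn -> R, L1 g /\ forall phi, test_function phi ->
      \int[q]_x phi x = \int[L]_x (g x * phi x).
  apply: dom => A mA LA; have [_ _ -> pAN] := H A mA.
  have mAN : measurable (A `&` N) by exact: measurableI.
  have LAN : L (A `&` N) = 0%E by apply: (subset_measure0 mAN mA _ LA); exact: subIsetl.
  by have := mu0 i _ mAN LAN; rewrite pqE// pAN add0e => /eqP; rewrite oppe_eq0 => /eqP.
exists (fun x => gp x - gq x); split.
  by have := integrableB measurableT gp1 gq1; apply: eq_integrable.
move=> phi tphi; rewrite intE gpE// gqE//.
have igp : L1 (fun x => gp x * phi x).
  by have := L1_mul_test 0 gp1 tphi; apply: eq_integrable => // x _ /=; rewrite subr0.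
have igq : L1 (fun x => gq x * phi x).
  by have := L1_mul_test 0 gq1 tphi; apply: eq_integrable => // x _ /=; rewrite subr0.
by rewrite -RintegralB//; apply: eq_Rintegral => x _; rewrite mulrBl.
Qed.

End singular_lower_bound.

Local Open Scope ereal_scope.

Theorem theorem1p3 (R : realType) (d : nat) (d_ge1 : (1 <= d)%N) :
  (exists c : R, (0 < c)%R /\
     forall f : 'rV[R]_d -> R, BV f ->
       c%:E * vmeasure_variation
                (singular_part (lebesgue_rV R d) (distr_derivative f)) setT
       <= limf_einf (fun l : R =>
            l%:E * lebesgue_rV R d [set x | l%:E < oscillation_sup f x])
            (pinfty_nbhs R)) /\
  (forall f : 'rV[R]_d -> R, BV f ->
     (W11 f <->
      limf_einf (fun l : R =>
        l%:E * lebesgue_rV R d [set x | l%:E < oscillation_sup f x])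
        (pinfty_nbhs R) = 0)).
Proof.
have [c c0 Hc] := @singular_variation_le R d d_ge1.
have lower f : BV f -> c%:E * vmeasure_variation
    (singular_part (lebesgue_rV R d) (distr_derivative f)) setT <=
    limf_einf (oscillation_tail f) (pinfty_nbhs R).
  move=> bvf; have [f1 _] := bvf.
  exact: (Hc _ _ _ f1 (distr_derivativeP bvf) (singular_partP _ _)).
split; first by exists c.
move=> f bvf; have [f1 _] := bvf; split; first exact: W11_liminf_eq0.
move=> lim0; apply: (W11_of_singular_eq0 f1 (distr_derivativeP bvf) (singular_partP _ _)).
apply/eqP; rewrite eq_le; apply/andP; split.
  by have := lower f bvf; rewrite /oscillation_tail lim0 pmule_rle0 ?lte_fin.
exact: vmeasure_variation_ge0.
Qed.
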